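(* Let $m>2$ be an integer, let $\rho_0>1$, and let $u$ be a solution of (NLW) on $\{|x|>\rho_0+|t|\}$ with initial data $(u_0,u_1)\in\mathcal H$ (defined for all $t\in\mathbb R$). Assume $$\sum_{\pm}\lim_{t\to\pm\infty}\int_{\{|x|\ge|t|+\rho_0\}}|\nabla_{t,x}u(t,x)|^2\,dx=0 .$$ Then either $(u_0,u_1)(r)=0$ for almost all $r>\rho_0$, or there exist $\ell\in\mathbb R\setminus\{0\}$ and a sign $\iota\in\{\pm1\}$ such that $(u_0,u_1)(r)=(\iota Z_\ell(r),0)$ for all $r>\rho_0$ (the equality for $u_1\in L^2$ being understood almost everywhere).
   Context: Let $\mathbb B=\{x\in\mathbb R^3:|x|<1\}$ and $\Omega=\mathbb R^3\setminus\mathbb B$. $\dot H^1_0(\Omega)$ is the completion of smooth functions compactly supported in $\{|x|>1\}$ for the norm $\|\nabla f\|_{L^2(\Omega)}$, and $\mathcal H$ is the space of radial elements of $\dot H^1_0(\Omega)\times L^2(\Omega)$. Radial functions are written as functions of $r=|x|$; $|\nabla_{t,x}u|^2=|\nabla u|^2+(\partial_tu)^2$. For $R\ge1$, the solution of (NLW) on $\{|x|>R+|t|\}$ with initial data $(u_0,u_1)$ is the restriction to $\{|x|>R+|t|\}$ of the (Duhamel) solution $u$ of $$(\partial_t^2-\Delta)u=|u|^{2m}u\,\mathbf 1_{\{|x|>R+|t|\}}\ \text{on }\mathbb R\times\Omega,\quad (u,\partial_tu)|_{t=0}=(u_0,u_1),\quad u_{|\partial\Omega}=0,$$ with $(u,\partial_tu)$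 continuous in time with values in $\mathcal H$ and $u\mathbf 1_{\{|x|>R+|t|\}}\in L^{2m+1}_t(J,L^{2(2m+1)}_x(\Omega))$ for every compact time interval $J$ in the interval of existence. For $\ell\in\mathbb R\setminus\{0\}$, $Z_\ell$ is the radial $C^2$ solution of $\Delta Z_\ell+Z_\ell^{2m+1}=0$ on $\mathbb R^3\setminus\{0\}$ such that $|rZ_\ell(r)-\ell|\le C/r^2$ for all $r\ge1$ and $\lim_{r\to\infty}r^2\frac{dZ_\ell}{dr}=-\ell$. *)

(* Defs.v *)
From HB Require Import structures.
From mathcomp Require Import all_boot all_order all_algebra.
From mathcomp Require Import all_classical all_reals all_analysis.

Set Implicit Arguments.
Unset Strict Implicit.
Unset Printing Implicit Defensive.

Import Order.TTheory GRing.Theory Num.Theory.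
Import numFieldNormedType.Exports.

Local Open Scope classical_set_scope.
Local Open Scope ring_scope.

(** A radial function on [Omega = {x in R^3, |x| >= 1}] is represented by its
    profile [f : R -> R] in [r = |x|]; only the values [f r], [1 <= r], matter.
    A radial function of time and space is a profile [w t r]. *)

Section Spaces.
Context {R : realType}.
Implicit Types (A : set R) (f g : R -> R).

Definition Omega : set R := `[1, +oo[%classic.

(** Integral over [{x in R^3, |x| in A}], in polar coordinates. *)
Definition int3 A f : \bar R :=
  ((4 * pi)%:E * \int[lebesgue_measure]_(r in A) (f r * r ^+ 2)%:E)%E.

Definition L2norm2 f : \bar R := int3 Omega (fun r => f r ^+ 2).

Definition inL2 f : Prop := measurable_fun Omega f /\ (L2norm2 f < +oo)%E.

Definition Lpnorm (p : R) f : \bar R :=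
  (int3 Omega (fun r => (`|f r| `^ p)%R) `^ p^-1)%E.

(** Profiles of the smooth radial functions compactly supported in
    [{|x| > 1}]. *)
Definition test_function f : Prop :=
  (forall k r, derivable (derive1n k f) r 1) /\
  (exists a b : R, 1 < a /\ forall r, ~~ (a <= r <= b) -> f r = 0).

(** [f] is the element of the completion defined by a Cauchy sequence of test
    functions, and [g] is its (extended) radial derivative.  Every radial test
    function satisfies [|phi r| <= C r^(-1/2) ||nabla phi||_{L^2}], so that
    evaluation at [r] extends to the completion: its elements are identified
    with the pointwise limits, i.e. with their continuous representatives.
    In particular [f 1 = 0]. *)
Definition is_radial_grad f g : Prop :=
  measurable_fun Omega g /\
  exists phi : nat -> R -> R,
    [/\ forall n, test_function (phi n),
        L2norm2 (derive1 (phi n) - g) @[n --> \oo] --> 0%E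
      & forall r, 1 <= r -> phi n r @[n --> \oo] --> f r].

Definition inHdot10 f : Prop := exists g, is_radial_grad f g.

(** [grad f] is unique up to a null set when [inHdot10 f], and it is [0] by
    convention otherwise. *)
Definition grad f : R -> R := xget 0 [set g | is_radial_grad f g].

(** Pairs [(u_0, u_1)]. *)
Definition data : Type := ((R -> R) * (R -> R))%type.

Definition inH (d : data) : Prop := inHdot10 d.1 /\ inL2 d.2.

Definition Hnorm2 (d : data) : \bar R :=
  int3 Omega (fun r => grad d.1 r ^+ 2 + d.2 r ^+ 2).

End Spaces.

Arguments data R : clear implicits.

Section LinearWave.
Context {R : realType}.
Implicit Types (w : R -> R -> R) (d : data R).

Definition dt w : R -> R -> R := fun t r => derive1 (fun s => w s r) t.
Definition dr w : R -> R -> R := fun t r => derive1 (w t) r.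

Definition C1 w : Prop := forall t r, 1 < r ->
  [/\ derivable (fun s => w s r) t 1, derivable (w t) r 1,
      {for (t, r), continuous (fun p : R * R => dt w p.1 p.2)}
    & {for (t, r), continuous (fun p : R * R => dr w p.1 p.2)}].

Definition C2 w : Prop := [/\ C1 w, C1 (dt w) & C1 (dr w)].

(** Classical finite-energy solutions of the Dirichlet problem
    [(d_t^2 - Delta) w = 0] with data in [C_c^oo]. *)
Definition classical_wave w : Prop :=
  C2 w /\
  (forall t r, 1 < r ->
     dt (dt w) t r - (dr (dr w) t r + 2 / r * dr w t r) = 0) /\
  (forall t, w t 1 = 0) /\
  (forall t, inH (w t, dt w t)) /\
  test_function (w 0) /\ test_function (dt w 0).

(** [v t = S_L(t) d], where the Dirichlet wave group [S_L] on the energy space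
    is the extension by density of the classical evolution. *)
Definition free_wave d (v : R -> data R) : Prop :=
  inH d /\
  (forall t, inH (v t)) /\
  Hnorm2 (v 0 - d) = 0%E /\
  exists wn : nat -> R -> R -> R,
    (forall n, classical_wave (wn n)) /\
    (forall t,
       Hnorm2 ((wn n t, dt (wn n) t) - v t) @[n --> \oo] --> 0%E).

End LinearWave.

Section NonlinearWave.
Context {R : realType}.
Implicit Types (U : R -> data R) (d : data R).

(** Oriented integral from [a] to [b]. *)
Definition oint (a b : R) (f : R -> R) : R :=
  if a <= b then \int[lebesgue_measure]_(s in `[a, b]) f s
  else - \int[lebesgue_measure]_(s in `[b, a]) f s.

Definition cutoff (R0 t r : R) : R := (R0 + `|t| < r)%R%:R.

Definition source (m : nat) (R0 : R) U (t r : R) : R :=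
  `|(U t).1 r| ^+ (2 * m) * (U t).1 r * cutoff R0 t r.

(** [U t = S_L(t) d + int_0^t S_L(t - s) (0, F s) ds]: [W s] is the free wave
    with data [(0, F s)].  Evaluation at [r >= 1] is continuous on
    [\dot H^1_0], hence commutes with the integral; the second component
    of [U t] is determined by the first one, see [nlw_vel] below. *)
Definition duhamel d (F : R -> R -> R) U : Prop :=
  exists (v : R -> data R) (W : R -> R -> data R),
    free_wave d v /\
    (forall s, inL2 (F s) -> free_wave (0, F s) (W s)) /\
    (forall t r, 1 <= r ->
       (U t).1 r = (v t).1 r + oint 0 t (fun s => (W s (t - s)).1 r)).

(** [U = (u, d_t u)] where [u] is the global solution on [R x Omega] of
    [(d_t^2 - Delta) u = |u|^(2m) u 1_{|x| > R0 + |t|}], [u = 0] on the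
    boundary, [(u, d_t u) = d] at time [0]; the Dirichlet condition is
    contained in [nlw_inH]. *)
Record nlw_solution (m : nat) (R0 : R) d U : Prop := NLWSolution {
  nlw_inH : forall t, inH (U t);
  nlw_continuous : forall t, Hnorm2 (U s - U t) @[s --> t] --> 0%E;
  (* [U.2] is the time derivative of [U.1] in [L^2(Omega)] *)
  nlw_vel : forall t,
    L2norm2 (fun r => ((U (t + h)).1 r - (U t).1 r) / h - (U t).2 r)
      @[h --> 0^'] --> 0%E;
  nlw_initial : Hnorm2 (U 0 - d) = 0%E;
  (* [u 1_{|x| > R0 + |t|}] is in [L^(2m+1)_t (J, L^(2(2m+1))_x)] *)
  nlw_strichartz : forall a b : R,
    (\int[lebesgue_measure]_(t in `[a, b])
       (Lpnorm (2 * (2 * m + 1))%:R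
          (fun r => (U t).1 r * cutoff R0 t r)%R) ^+ (2 * m + 1)
     < +oo)%E;
  nlw_duhamel : duhamel d (source m R0 U) U
}.

(** [int_{|x| >= R0 + |t|} |nabla_{t,x} u(t,x)|^2 dx] *)
Definition exterior_energy (R0 : R) U (t : R) : \bar R :=
  int3 `[R0 + `|t|, +oo[%classic
    (fun r => grad (U t).1 r ^+ 2 + (U t).2 r ^+ 2).

End NonlinearWave.

Section Stationary.
Context {R : realType}.

(** [Z] is the profile of [Z_l] on [R^3 \ {0}]. *)
Definition is_Z (m : nat) (l : R) (Z : R -> R) : Prop :=
  (forall r : R, 0 < r ->
     [/\ derivable Z r 1, derivable (derive1 Z) r 1,
         {for r, continuous (derive1n 2 Z)}
       & derive1n 2 Z r + 2 / r * derive1 Z r + Z r ^+ (2 * m + 1) = 0]) /\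
  (exists C : R, forall r, 1 <= r -> `|r * Z r - l| <= C / r ^+ 2) /\
  r ^+ 2 * derive1 Z r @[r --> +oo] --> - l.

End Stationary.

(* Main.v *)
(** Write [w (t, r) = r u (t, r)] and, in null coordinates [xi = r - t],
    [eta = r + t], [phi (xi, eta) = w (t, r)].  By d'Alembert's formula, [phi] is a
    function of [xi] plus a function of [eta] plus the integral over a backward cone of
    [r u^(2m+1) = phi^(2m+1) / r^(2m)].  Second differences of [phi] in [(xi, eta)]
    therefore only see the source; since they depend on it monotonically, a bound of
    the source by [k'' r] bounds them by the second differences of the static
    function [k r].

    Energy bounds give [|u| <= C r^(-1/2)], hence a first bound with
    [k r = C r^(-1/2)].  The assumption on the exterior energy says that [phi] becomes
    invariant under [(xi, eta) -> (xi + c, eta + c)] as [|t| --> oo]; together with the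
    decay of the data at infinity, this makes the variations of [phi] along null
    edges vanish at infinity, and [phi] has a limit [l], with
    [|phi - l| <= C r^(-1/2)].

    The static solution [f = r Z_l] is obtained by a fixed point argument in [1/r], and
    satisfies [|f| <= |l|] by monotonicity of an energy.  Comparing sources, a bound
    [|phi - f| <= A r^(-a)] improves to [C r^(-a-1/2)], and also to
    [(A / 2) r^(-a)] when [a] is large; hence [phi = f].  So [u] is static in the
    exterior region, and [u_1 = 0] there. *)

Require Import Defs.
From HB Require Import structures.
From mathcomp Require Import all_boot all_order all_algebra.
From mathcomp Require Import all_classical all_reals all_analysis.
From mathcomp Require Import measurable_realfun.
From mathcomp Require Import ring lra zify.

Import Order.TTheory GRing.Theory Num.Theory.
Import numFieldNormedType.Exports.

Set Implicit Arguments.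
Unset Strict Implicit.
Unset Printing Implicit Defensive.

Local Open Scope classical_set_scope.
Local Open Scope ring_scope.

(** * Calculus on the line *)

(** [u] has only finite energy, so [phi] is merely continuous. Its equation
    [4 d_xi d_eta phi = - phi^(2m+1) / r^(2m)] is therefore used only through differences over
    rectangles with sides along the null directions. A rectangle with vertices in the quadrant
    [xi, eta > rho0], which is the region [r > rho0 + |t|], stays inside it. Only the exterior
    source is seen, and a bound on the whole quadrant reproduces itself.

    The comparison functions are powers: [r^(-a)] has second derivative [a (a + 1) r^(-a-2)], so a
    source bounded by [c r^(-a-2)] costs only [c / (a (a + 1))]. The sources of [phi] and [f] differ
    by at most [L |phi - f| r^(-2m)] with [L] fixed. Since [2m > 2], the surplus decay can be spent
    on raising [a] as far as desired; once [a (a + 1) >= 2 L], the constant is halved at fixed [a].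
    All bounds hold on the whole quadrant, so equality need not be continued from large [r] down to
    [rho0].

    The value [l = 0] is covered by the same argument, with the profile [f = 0]; this is the first
    alternative of the theorem. *)

Section Calculus.
Context {R : realType}.
Implicit Types (f g F : R -> R) (a b x : R).
Local Notation mu := (@lebesgue_measure R).

Lemma is_derive_continuous f x df : is_derive x 1 f df -> {for x, continuous f}.
Proof.
by move=> [fx _]; apply: differentiable_continuous; exact/derivable1_diffP.
Qed.

Lemma is_derive_within f (f' : R -> R) a b :
  (forall x, a <= x <= b -> is_derive x 1 f (f' x)) ->
  {within `[a, b], continuous f}.
Proof.
move=> H; apply: continuous_in_subspaceT => x.
rewrite inE/= in_itv/= => /H; exact: is_derive_continuous.
Qed.

Lemma ge0_is_derive_le f (f' : R -> R) a b : a <= b ->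
  (forall x, a <= x <= b -> is_derive x 1 f (f' x)) ->
  (forall x, a <= x <= b -> 0 <= f' x) -> f a <= f b.
Proof.
move=> ab H H0.
have [|c cab E] := @MVT_segment R f f' a b ab _ (is_derive_within H).
  move=> x; rewrite in_itv/= => /andP[x1 x2]; apply: H; by rewrite !ltW.
rewrite -subr_ge0 E mulr_ge0 ?subr_ge0// H0//.
Qed.

Lemma is_derive_le (f g f' g' : R -> R) a b : a <= b ->
  (forall x, a <= x <= b -> is_derive x 1 f (f' x)) ->
  (forall x, a <= x <= b -> is_derive x 1 g (g' x)) ->
  (forall x, a <= x <= b -> f' x <= g' x) -> f b - f a <= g b - g a.
Proof.
move=> ab Hf Hg H.
have := @ge0_is_derive_le (g - f) (fun x => g' x - f' x) a b ab.
move=> h; have : (g - f) a <= (g - f) b.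
  apply: h => x xab; last by rewrite subr_ge0; exact: H.
  by have := Hf _ xab; have := Hg _ xab => ? ?; exact: is_deriveB.
rewrite !fctE; lra.
Qed.

Lemma is_derive_cst_on f a b : a <= b ->
  (forall x, a <= x <= b -> is_derive x 1 f 0) -> f b = f a.
Proof.
move=> ab H; apply/eqP; rewrite eq_le; apply/andP; split.
  have := @is_derive_le f (cst 0) (fun=> 0) (fun=> 0) a b ab H.
  by move=> /(_ (fun x _ => is_derive_cst _ _ _)) /(_ (fun=> fun=> lexx _)); rewrite /cst; lra.
exact: (@ge0_is_derive_le f (fun=> 0) a b ab H).
Qed.

Lemma continuous_integrable f a b : continuous f ->
  mu.-integrable `[a, b] (EFin \o f).
Proof.
move=> cf; apply: continuous_compact_integrable; first exact: segment_compact.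
exact: continuous_subspaceT.
Qed.

Lemma Rint_point f a : \int[mu]_(x in `[a, a]) f x = 0.
Proof. by rewrite set_itv1 Rintegral_set1. Qed.

Lemma Rint_empty f a b : b < a -> \int[mu]_(x in `[a, b]) f x = 0.
Proof. by move=> ba; rewrite set_itv_ge ?Rintegral_set0// bnd_simp -ltNge. Qed.

Lemma Rint_split f a c b : continuous f -> a <= c -> c <= b ->
  \int[mu]_(x in `[a, b]) f x =
  \int[mu]_(x in `[a, c]) f x + \int[mu]_(x in `[c, b]) f x.
Proof.
move=> cf ac cb.
have := @Rintegral_itvB R f (BLeft a) (BRight b) c (continuous_integrable a b cf).
rewrite !bnd_simp => /(_ ac cb).
rewrite Rintegral_itv_obnd_cbnd; last first.
  apply: (integrableS _ _ _ (continuous_integrable c b cf)) => //.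
  exact: subset_itv_oc_cc.
lra.
Qed.

Definition prim f x : R := oint 0 x f.

Lemma prim_sub f a b : continuous f -> a <= b ->
  \int[mu]_(x in `[a, b]) f x = prim f b - prim f a.
Proof.
move=> cf ab; rewrite /prim /oint.
have [a0|a0] := leP 0 a.
  rewrite (le_trans a0 ab) (@Rint_split f 0 a b)//; lra.
have [b0|b0] := leP 0 b.
  by rewrite (@Rint_split f a 0 b)// ?ltW//; lra.
rewrite (@Rint_split f a b 0)// ?ltW//; lra.
Qed.

Lemma is_derive_prim f x : continuous f -> is_derive x 1 (prim f) (f x).
Proof.
move=> cf; pose A := x - 1.
have x1 : x < x + 1 by rewrite ltrDl.
have Ax : A < x by rewrite /A ltrBlDr ltrDl.
have [dF F'] := continuous_FTC1_closed x1 (continuous_integrable A (x + 1) cf) Ax (cf x).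
set F := (F in derivable F _ _) in dF F'.
have E : \near x, F x + prim f A = prim f x.
  near=> y; rewrite /F prim_sub//; first lra.
  near: y; exact: lt_le_nbhsr.
apply: (near_eq_is_derive E).
have DF : is_derive x 1 F (f x) by constructor; [exact: dF|rewrite -derive1E; exact: F'].
have := is_deriveD DF (is_derive_cst (prim f A) x 1).
by rewrite addr0.
Unshelve. all: end_near. Qed.

Lemma Rint_FTC f F a b : a <= b -> continuous f ->
  (forall x, a <= x <= b -> is_derive x 1 F (f x)) ->
  \int[mu]_(x in `[a, b]) f x = F b - F a.
Proof.
move=> ab cf H; rewrite prim_sub//.
have := @is_derive_cst_on (F - prim f) a b ab.
move=> /(_ _)/wrap[].
  move=> x xab; rewrite -(subrr (f x)); have := H _ xab; have := is_derive_prim x cf.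
  by move=> ? ?; apply: is_deriveB.
rewrite !fctE; lra.
Qed.

Lemma continuous_prim f : continuous f -> continuous (prim f).
Proof. move=> cf x; exact: (is_derive_continuous (is_derive_prim x cf)). Qed.

End Calculus.

(** * d'Alembert's formula *)

Section DAlembert.
Context {R : realType}.
Implicit Types (w : R -> R -> R) (a b c e t r x df : R).

Lemma MVT_between (f f' : R -> R) (x y : R) :
  (forall c, Num.min x y <= c <= Num.max x y -> is_derive c 1 f (f' c)) ->
  exists2 c : R, Num.min x y <= c <= Num.max x y & f y - f x = f' c * (y - x).
Proof.
have [xy|/ltW yx] := leP x y => H.
- have [||c cab E] := @MVT_segment R f f' x y xy.
  + by move=> c; rewrite in_itv/= => /andP[c1 c2]; apply: H; rewrite !ltW.
  + exact: (@is_derive_within _ f f').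
  + by exists c.
- have [||c cab E] := @MVT_segment R f f' y x yx.
  + by move=> c; rewrite in_itv/= => /andP[c1 c2]; apply: H; rewrite !ltW.
  + exact: (@is_derive_within _ f f').
  + by exists c => //; rewrite -opprB E -mulrN opprB.
Qed.

Lemma between_dist (x y c : R) :
  Num.min x y <= c <= Num.max x y -> `|c - x| <= `|y - x|.
Proof.
have [xy|yx] := leP x y => /andP[c1 c2].
  by rewrite !ger0_norm; lra.
by rewrite !ler0_norm; lra.
Qed.

Lemma MVT_dist (f f' : R -> R) (x y : R) :
  (forall c, `|c - x| <= `|y - x| -> is_derive c 1 f (f' c)) ->
  exists2 c : R, `|c - x| <= `|y - x| & f y - f x = f' c * (y - x).
Proof.
move=> H; have [c cxy|c cxy E] := @MVT_between f f' x y.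
  exact/H/between_dist.
by exists c => //; exact: between_dist.
Qed.

Lemma is_derive_cst_between (f : R -> R) a b :
  (forall x : R, Num.min a b <= x <= Num.max a b -> is_derive x 1 f 0) -> f b = f a.
Proof.
by move=> /(@MVT_between f (fun=> 0))[c _]; rewrite mul0r => /eqP; rewrite subr_eq0 => /eqP.
Qed.

Lemma continuous_at_eps (g : R * R -> R) (t r : R) : {for (t, r), continuous g} ->
  forall e : R, 0 < e -> exists2 d : R, 0 < d &
    forall s x : R, `|s - t| < d -> `|x - r| < d -> `|g (s, x) - g (t, r)| < e.
Proof.
move=> gc e e0; have /cvgrPdist_lt/(_ e e0) := gc.
move=> /nbhs_ballP[d /= d0 H]; exists d => // s x st xr.
by rewrite distrC; apply: H; split; rewrite /ball/= distrC.
Qed.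

Lemma derivable_is_derive1 (f : R -> R) (x : R) :
  derivable f x 1 -> is_derive x 1 f (derive1 f x).
Proof. by move=> fx; constructor; [exact: fx|rewrite derive1E]. Qed.

Lemma C1_dt w t r : C1 w -> 1 < r -> is_derive t 1 (fun s => w s r) (dt w t r).
Proof. by move=> /(_ t r) h /h[h1 _ _ _]; split => //; rewrite /dt derive1E. Qed.

Lemma C1_dr w t r : C1 w -> 1 < r -> is_derive r 1 (w t) (dr w t r).
Proof. by move=> /(_ t r) h /h[_ h1 _ _]; split => //; rewrite /dr derive1E. Qed.

Opaque dt dr.

Lemma is_deriveP (f : R -> R) x df : is_derive x 1 f df <->
  forall e : R, 0 < e -> exists2 d : R, 0 < d &
    forall h : R, `|h| < d -> h != 0 -> `|(f (x + h) - f x) / h - df| <= e.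
Proof.
have E (h : R) : h^-1 *: ((f \o shift x) (h *: (1:R)) - f x) = (f (x + h) - f x) / h.
  by rewrite /= /GRing.scale/= mulr1 mulrC (addrC h).
split.
- move=> [dfx <-] e e0.
  have /cvgrPdist_le/(_ e e0) : h^-1 *: ((f \o shift x) (h *: (1:R)) - f x) @[h --> 0^'] --> 'D_1 f x by [].
  move=> /nbhs_ballP[d /= d0 H]; exists d => // h hd h0.
  by rewrite distrC -E; apply: H => //; rewrite /ball/= sub0r normrN.
- move=> H.
  have C : h^-1 *: ((f \o shift x) (h *: (1:R)) - f x) @[h --> 0^'] --> df.
    apply/cvgrPdist_le => e e0; have [d d0 Hd] := H e e0.
    apply/nbhs_ballP; exists d => //= h; rewrite /ball/= sub0r normrN => hd h0.
    by rewrite E distrC; exact: Hd.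
  split; first by apply/cvg_ex; exists df.
  by apply/cvg_lim.
Qed.

Lemma is_derive_affine (c k z : R) : is_derive z 1 (fun y : R => c + k * y) k.
Proof.
have := is_deriveD (is_derive_cst c z 1) (is_deriveZ k (is_derive_id z 1)).
by rewrite add0r /GRing.scale/= mulr1.
Qed.

Lemma is_derive_comp_affine (f : R -> R) (c k z d : R) :
  is_derive (c + k * z) 1 f d -> is_derive z 1 (fun y : R => f (c + k * y)) (k * d).
Proof.
move=> fd; have := is_derive_affine c k z => da; rewrite mulrC.
exact: (@is_derive1_comp R f (fun y : R => c + k * y) z _ _ fd da).
Qed.

(** Chain rule from partial derivatives alone: the increment is split at time [T]. The [r] part is
    differentiated at fixed [T]; the [t] part is a mean value, controlled by the joint continuity of
    [dt w]. *)
Lemma C1_line w (t r a b s : R) : C1 w -> 1 < r + b * s ->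
  is_derive s 1 (fun z : R => w (t + a * z) (r + b * z))
    (a * dt w (t + a * s) (r + b * s) + b * dr w (t + a * s) (r + b * s)).
Proof.
move=> w1 r1; set T := t + a * s; set X := r + b * s.
have d2 : is_derive s 1 (fun z : R => w T (r + b * z)) (b * dr w T X).
  by apply: is_derive_comp_affine; exact: C1_dr.
apply/is_deriveP => e e0.
have /is_deriveP/(_ (e/2) ltac:(by rewrite divr_gt0))[d1 d10 D1] := d2.
have [_ _ /continuous_at_eps c1 _] := w1 T X r1.
pose A := `|a| + `|b| + 1.
have A0 : 0 < A by rewrite ltr_wpDl// addr_ge0.
have [d3 d30 D3] := c1 (e / 2 / A) ltac:(by rewrite !divr_gt0).
(* [d3 / A] keeps the shifts [a h] and [b h] where [dt w] is controlled; [(X - 1) / A] keeps the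
   points in [r > 1]. *)
exists (Num.min d1 (Num.min (d3 / A) ((X - 1) / A))).
  by rewrite !lt_min d10 !divr_gt0// subr_gt0.
move=> h; rewrite !lt_min => /and3P[h1 h2 h3] h0.
have hb (k : R) : `|k| <= A -> `|k * h| < d3 /\ `|k * h| < X - 1.
  move=> kA; move: h2 h3; rewrite !ltr_pdivlMr// => h2 h3.
  have : `|k * h| <= `|h| * A by rewrite normrM mulrC ler_wpM2l.
  lra.
have aA : `|a| <= A by rewrite /A; have := normr_ge0 b; lra.
have bA : `|b| <= A by rewrite /A; have := normr_ge0 a; lra.
have [b3 bX] := hb b bA; have [a3 aX] := hb a aA.
have [|c cT Ec] := @MVT_dist (fun z => w z (X + b * h)) (fun z => dt w z (X + b * h)) T (T + a * h).
  move=> c _; apply: C1_dt => //; move: bX; rewrite ltr_norml; lra.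
have E1 : t + a * (s + h) = T + a * h by rewrite /T; ring.
have E2 : r + b * (s + h) = X + b * h by rewrite /X; ring.
have {D1} := D1 h h1 h0; rewrite E1 E2.
have -> : (w (T + a * h) (X + b * h) - w T X) / h - (a * dt w T X + b * dr w T X)
  = a * (dt w c (X + b * h) - dt w T X) + ((w T (X + b * h) - w T X) / h - b * dr w T X).
  have -> : w (T + a * h) (X + b * h) = w T (X + b * h) + dt w c (X + b * h) * (a * h).
    by move: Ec; rewrite (addrC T) addrK => <-; ring.
  by field.
move=> D1; apply: le_trans (ler_normD _ _) _.
have D3' : `|dt w c (X + b * h) - dt w T X| < e / 2 / A.
  apply: (D3 c (X + b * h)).
    by apply: le_lt_trans cT _; rewrite (addrC T) addrK.
  by rewrite (addrC X) addrK.
have : `|a * (dt w c (X + b * h) - dt w T X)| <= A * (e / 2 / A).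
  by rewrite normrM ler_pM// ltW.
rewrite mulrCA divff ?gt_eqF// mulr1; lra.
Qed.

(** Schwarz's theorem: the second difference over a small square of side [h] is evaluated by two
    mean values, in either order, and both mixed derivatives are continuous at [(t, r)]. *)
Lemma C2_clairaut w t r : C2 w -> 1 < r -> dt (dr w) t r = dr (dt w) t r.
Proof.
move=> [w1 wt wr] r1.
have [_ _ /continuous_at_eps c1 _] := wr t r r1.
have [_ _ _ /continuous_at_eps c2] := wt t r r1.
apply/eqP; rewrite -subr_eq0 -normr_le0; apply/ler_addgt0Pr => /= e e0; rewrite add0r.
have e20 : 0 < e / 2 by rewrite divr_gt0.
have [d1 d10 D1] := c1 _ e20; have [d2 d20 D2] := c2 _ e20.
pose h := Num.min (Num.min d1 d2) (r - 1) / 2.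
have m0 : 0 < Num.min (Num.min d1 d2) (r - 1) by rewrite !lt_min d10 d20 subr_gt0.
have h0 : 0 < h by rewrite divr_gt0.
have hh : h < Num.min (Num.min d1 d2) (r - 1) by rewrite /h; lra.
move: hh; rewrite !lt_min => /andP[/andP[hd1 hd2] hr].
have near_r (x : R) : `|x - r| <= h -> 1 < x by rewrite ler_norml; lra.
have [|c cT Ec] := @MVT_dist (fun z => w z (r + h) - w z r)
    (fun z => dt w z (r + h) - dt w z r) t (t + h).
  move=> c _; apply: is_deriveB; apply: C1_dt => //; lra.
have [|d dT Ed] := @MVT_dist (dt w c) (dr (dt w) c) r (r + h).
  move=> d; rewrite (addrC r) addrK (ger0_norm (ltW h0)) => drh.
  by apply: C1_dr => //; exact: near_r.
have [|c' cT' Ec'] := @MVT_dist (fun z => w (t + h) z - w t z)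
    (fun z => dr w (t + h) z - dr w t z) r (r + h).
  move=> d'; rewrite (addrC r) addrK (ger0_norm (ltW h0)) => drh.
  by apply: is_deriveB; apply: C1_dr => //; exact: near_r.
move: (cT') ; rewrite (addrC r) addrK (ger0_norm (ltW h0)) => cT''.
have [|d' dT' Ed'] := @MVT_dist (fun s => dr w s c') (fun s => dt (dr w) s c') t (t + h).
  by move=> d' _; apply: C1_dt => //; exact: near_r.
move: cT dT dT' Ec Ed Ec' Ed'; rewrite (addrC t) (addrC r) !addrK (ger0_norm (ltW h0)).
move=> cT dT dT' Ec Ed Ec' Ed'.
rewrite ?(addrC h) in Ec Ed Ec' Ed'.
have EE : dr (dt w) c d * h * h = dt (dr w) d' c' * h * h.
  move: Ec Ed Ec' Ed'.
  move: (w (t + h) (r + h)) (w (t + h) r) (w t (r + h)) (w t r) => A B C D.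
  move: (dt w c (r + h)) (dt w c r) (dr w (t + h) c') (dr w t c') => A' B' C' D'.
  move: (dr (dt w) c d) (dt (dr w) d' c') => X Y; clear => h1 h2 h3 h4.
  by rewrite -h2 -h1 -h4 -h3; ring.
have {}EE : dr (dt w) c d = dt (dr w) d' c'.
  by apply: (mulIf (lt0r_neq0 h0)); apply: (mulIf (lt0r_neq0 h0)).
have := D1 d' c' (le_lt_trans dT' hd1) (le_lt_trans cT'' hd1).
have := D2 c d (le_lt_trans cT hd2) (le_lt_trans dT hd2).
rewrite EE /=; move: (dt (dr w) d' c') (dt (dr w) t r) (dr (dt w) t r) => A B C.
by clear; rewrite !ltr_norml ler_norml; lra.
Qed.


Definition oprim (f : R -> R) (a b : R) : R := prim f b - prim f a.

(** [r w] solves the one-dimensional wave equation. The conditions on [r - t] and [r + t] keep the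
    characteristics in [r > 1], so no reflection from the boundary enters. *)
Lemma classical_dalembert w : classical_wave w ->
  forall t r : R, 1 < r - t -> 1 < r + t ->
  r * w t r = ((r + t) * w 0 (r + t) + (r - t) * w 0 (r - t)) / 2
            + oprim (fun s => s * dt w 0 s) (r - t) (r + t) / 2.
Proof.
move=> [w2 [weq [_ [_ [_ tdw]]]]] t r xi1 eta1.
have [w1 wt wr] := w2.
have cV : continuous (fun s : R => s * dt w 0 s).
  move=> s; apply: cvgM; first exact: cvg_id.
  apply: (@is_derive_continuous _ (dt w 0) s (derive1 (dt w 0) s)).
  by have [/(_ 0%N s) ds _] := tdw; exact: derivable_is_derive1.
(* [P] is [(d_t + d_r)(r w)]. It is constant along the incoming lines [r + t = c] because
   [(d_t - d_r)(d_t + d_r)(r w) = 0]. *)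
pose P (s x : R) := x * dt w s x + (w s x + x * dr w s x).
have Pcst (c s : R) : 1 < c -> 1 < c - s -> P s (c - s) = P 0 c.
  move=> c1 cs1.
  rewrite -{2}[c]subr0; pose p (z : R) := P (0 + 1 * z) (c + -1 * z).
  have -> : P s (c - s) = p s by rewrite /p mulN1r mul1r add0r.
  have -> : P 0 (c - 0) = p 0 by rewrite /p !mulr0 !addr0 subr0.
  apply: is_derive_cst_between => x xs.
  have x1 : 1 < c + -1 * x.
    by move: xs; case: (leP 0 s) => s0; lra.
  have d1 := C1_line 0 1 w1 x1; have d2 := C1_line 0 1 wt x1; have d3 := C1_line 0 1 wr x1.
  have d4 : is_derive x 1 (fun z : R => c + -1 * z) (-1) := is_derive_affine _ _ _.
  have D := is_deriveD (is_deriveM d4 d2) (is_deriveD d1 (is_deriveM d4 d3)).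
  apply: (is_derive_eq D); rewrite /GRing.scale/= -(C2_clairaut _ w2 x1).
  have := weq (0 + 1 * x) (c + -1 * x) x1.
  set X := c + -1 * x in x1 *; set T := 0 + 1 * x.
  move=> E; have {}E : dt (dt w) T X = dr (dr w) T X + 2 / X * dr w T X by lra.
  rewrite E; field; lra.
pose V := prim (fun s : R => s * dt w 0 s).
pose xi := r - t.
(* Along the outgoing line [r = xi + s], the derivative of [r w] is [P s (xi + s) = P 0 (xi + 2 s)].
   This is half the [s]-derivative of [y w(0, y) + V y] at [y = xi + 2 s], so [E] is constant. *)
pose E (s : R) := (xi + 1 * s) * w (0 + 1 * s) (xi + 1 * s)
   - ((xi + 2 * s) * w (0 + 0 * s) (xi + 2 * s) + V (xi + 2 * s)) / 2.
have : E t = E 0.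
  apply: is_derive_cst_between => s st.
  have s1 : 1 < xi + 2 * s.
    by rewrite /xi; move: st; case: (leP 0 t) => t0; lra.
  have s2 : 1 < xi + 1 * s by rewrite /xi; rewrite /xi in s1; lra.
  have d1 := C1_line 0 1 w1 s2; have d2 := C1_line 0 0 w1 s1.
  have d3 := is_derive_affine xi 1 s; have d4 := is_derive_affine xi 2 s.
  have d5 := is_derive_comp_affine (is_derive_prim (xi + 2 * s) cV).
  have D := is_deriveB (is_deriveM d3 d1) (is_deriveZ (2^-1) (is_deriveD (is_deriveM d4 d2) d5)).
  have -> : E = (fun z : R => xi + 1 * z) * (fun z : R => w (0 + 1 * z) (xi + 1 * z))
    - 2^-1 *: ((fun z : R => xi + 2 * z) * (fun z : R => w (0 + 0 * z) (xi + 2 * z)) + (fun z : R => V (xi + 2 * z))).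
    by apply/funext => z; rewrite /E !fctE /GRing.scale/= mulrC [in RHS](mulrC 2^-1).
  apply: (is_derive_eq D); rewrite /GRing.scale/=.
  have := Pcst (xi + 2 * s) s s1; have -> : xi + 2 * s - s = xi + 1 * s by ring.
  move=> /(_ s2); rewrite /P !mul0r !addr0 !add0r !mul1r; lra.
rewrite /E /xi /oprim -/V !mulr0 !mul1r !mul0r !addr0 !add0r.
have -> : r - t + t = r by ring.
have -> : r - t + 2 * t = r + t by ring.
lra.
Qed.

End DAlembert.

(** * Weighted square-integrable functions on the half-line *)

Section WeightedL2.
Context {R : realType}.
Implicit Types (D : set R) (h k p q : R -> R) (a b A B r : R).
Local Notation mu := (@lebesgue_measure R).

(** The optimal weight is [l = x / A]. If [A = 0] and [x > 0], the weight [(B + 1) / x] gives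
    [2 x < x], a contradiction. *)
Lemma sq_le_of_amgm (x A B : R) : 0 <= x -> 0 <= A -> 0 <= B ->
  (forall l : R, 0 < l -> 2 * x <= l * A + l^-1 * B) -> x ^+ 2 <= A * B.
Proof.
move=> x0 A0 B0 H; have [->|xn0] := eqVneq x 0.
  by rewrite expr0n/= mulr_ge0.
have {xn0}x0 : 0 < x by rewrite lt_neqAle eq_sym xn0.
have [A_eq0|An0] := eqVneq A 0.
  have l0 : 0 < (B + 1) / x by rewrite divr_gt0//; lra.
  have := H _ l0; rewrite A_eq0 mulr0 add0r invf_div => E.
  have : x / (B + 1) * B < x.
    rewrite mulrAC ltr_pdivrMr; last lra.
    by rewrite ltr_pM2l//; lra.
  lra.
have {}A0 : 0 < A by rewrite lt_neqAle eq_sym An0.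
have := H _ (divr_gt0 x0 A0); rewrite mulfVK// invf_div => E.
have : x <= A / x * B by lra.
by rewrite mulrAC ler_pdivlMr// expr2.
Qed.

(** Integrate [|p q| <= (l p^2 + q^2 / l) / 2] and optimise in [l]. The case [l = 1] already gives
    the integrability of the product. *)
Lemma cauchy_schwarz D p q A B : measurable D ->
  measurable_fun D p -> measurable_fun D q ->
  (\int[mu]_(r in D) (p r ^+ 2)%:E <= A%:E)%E ->
  (\int[mu]_(r in D) (q r ^+ 2)%:E <= B%:E)%E ->
  mu.-integrable D (EFin \o (fun r => p r * q r)) /\
  (\int[mu]_(r in D) `|p r * q r|) ^+ 2 <= A * B.
Proof.
move=> mD mp mq pA qB.
have mpq : measurable_fun D (fun r => p r * q r) by exact: measurable_funM.
have mp2 : measurable_fun D (fun r => (p r ^+ 2)%:E).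
  by apply/measurable_EFinP; exact: measurable_funX.
have mq2 : measurable_fun D (fun r => (q r ^+ 2)%:E).
  by apply/measurable_EFinP; exact: measurable_funX.
have A0 : 0 <= A.
  by rewrite -lee_fin; apply: le_trans pA; apply: integral_ge0 => r _; rewrite lee_fin sqr_ge0.
have B0 : 0 <= B.
  by rewrite -lee_fin; apply: le_trans qB; apply: integral_ge0 => r _; rewrite lee_fin sqr_ge0.
have key (l : R) : 0 < l ->
    (\int[mu]_(r in D) `|p r * q r|%:E <= ((l * A + l^-1 * B) / 2)%:E)%E.
  move=> l0; have li0 : 0 < l^-1 by rewrite invr_gt0.
  apply: (@le_trans _ _ (\int[mu]_(r in D) ((l / 2)%:E * (p r ^+ 2)%:E + (l^-1 / 2)%:E * (q r ^+ 2)%:E))%E).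
    apply: ge0_le_integral => //.
    - by apply/measurable_EFinP; exact: measurableT_comp.
    - by apply: emeasurable_funD; exact: measurable_funeM.
    - move=> r _; rewrite -!EFinM -EFinD lee_fin.
      have E : l / 2 * p r ^+ 2 + l^-1 / 2 * q r ^+ 2 - `|p r * q r| = (l * `|p r| - `|q r|) ^+ 2 * (l^-1 / 2).
        rewrite normrM -(real_normK (num_real (p r))) -(real_normK (num_real (q r))).
        by field; rewrite gt_eqF.
      by rewrite -subr_ge0 E mulr_ge0// ?sqr_ge0// divr_ge0// ltW.
  rewrite ge0_integralD//; last 4 first.
  - by move=> r _; rewrite -EFinM lee_fin mulr_ge0 ?sqr_ge0// divr_ge0// ltW.
  - exact: measurable_funeM.
  - by move=> r _; rewrite -EFinM lee_fin mulr_ge0 ?sqr_ge0// divr_ge0// ltW.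
  - exact: measurable_funeM.
  have p2 r : D r -> (0%E <= (p r ^+ 2)%:E)%E by move=> _; rewrite lee_fin sqr_ge0.
  have q2 r : D r -> (0%E <= (q r ^+ 2)%:E)%E by move=> _; rewrite lee_fin sqr_ge0.
  have l2 : 0 <= l / 2 by rewrite divr_ge0// ltW.
  have li2 : 0 <= l^-1 / 2 by rewrite divr_ge0// ltW.
  rewrite (ge0_integralZl_EFin mu mD p2 mp2 l2) (ge0_integralZl_EFin mu mD q2 mq2 li2).
  have -> : ((l * A + l^-1 * B) / 2)%:E = ((l / 2)%:E * A%:E + (l^-1 / 2)%:E * B%:E)%E.
    by rewrite -!EFinM -EFinD; congr EFin; field; rewrite gt_eqF.
  by apply: leeD; apply: lee_wpmul2l => //; rewrite lee_fin divr_ge0// ltW.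
have ipq : mu.-integrable D (EFin \o (fun r => p r * q r)).
  apply/integrableP; split; first exact/measurable_EFinP.
  by apply: le_lt_trans (key 1 ltr01) _; rewrite ltry.
split => //.
apply: sq_le_of_amgm => //; first exact: Rintegral_ge0.
move=> l l0; have := key l l0.
have -> : (\int[mu]_(r in D) `|p r * q r|%:E)%E = (\int[mu]_(r in D) `|p r * q r|)%:E.
  rewrite /Rintegral fineK//; apply: integrable_fin_num => //.
  exact: integrable_norm.
rewrite lee_fin; lra.
Qed.

Definition wnorm2 D h : \bar R := (\int[mu]_(r in D) (h r ^+ 2 * r ^+ 2)%:E)%E.

Lemma wnorm2_ge0 D h : (0 <= wnorm2 D h)%E.
Proof. by apply: integral_ge0 => r _; rewrite lee_fin mulr_ge0 ?sqr_ge0. Qed.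

Lemma measurable_wsq D h : measurable_fun D h ->
  measurable_fun D (fun r : R => (h r ^+ 2 * r ^+ 2)%:E : \bar R).
Proof.
move=> mh; apply/measurable_EFinP; apply: measurable_funM; first exact: measurable_funX.
by apply: measurable_funX; exact: measurable_id.
Qed.

Lemma wnorm2_subset D1 D2 h : measurable D1 -> measurable D2 -> measurable_fun D2 h ->
  D1 `<=` D2 -> (wnorm2 D1 h <= wnorm2 D2 h)%E.
Proof.
move=> m1 m2 mh s; apply: ge0_subset_integral => //; first exact: measurable_wsq.
by move=> r _; rewrite lee_fin mulr_ge0 ?sqr_ge0.
Qed.

Lemma wnorm2_add D h k : measurable D -> measurable_fun D h -> measurable_fun D k ->
  (wnorm2 D (fun r => (h r + k r)%R) <= 2%:E * wnorm2 D h + 2%:E * wnorm2 D k)%E.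
Proof.
move=> mD mh mk; rewrite /wnorm2 -!ge0_integralZl_EFin//; last 4 first.
- by move=> r _; rewrite lee_fin mulr_ge0 ?sqr_ge0.
- exact: measurable_wsq.
- by move=> r _; rewrite lee_fin mulr_ge0 ?sqr_ge0.
- exact: measurable_wsq.
have p0 (f : R -> R) (r : R) : (0 <= 2%:E * (f r ^+ 2 * r ^+ 2)%:E)%E.
  by rewrite -EFinM lee_fin; apply: mulr_ge0 => //; apply: mulr_ge0; exact: sqr_ge0.
rewrite -ge0_integralD//; last 2 first.
- by apply: measurable_funeM; exact: measurable_wsq.
- by apply: measurable_funeM; exact: measurable_wsq.
apply: ge0_le_integral => //.
- by move=> r _; rewrite lee_fin mulr_ge0 ?sqr_ge0.
- by apply: measurable_wsq; exact: measurable_funD.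
- by apply: emeasurable_funD; apply: measurable_funeM; exact: measurable_wsq.
- move=> r _; rewrite -!EFinM -EFinD lee_fin.
  have E : 2 * (h r ^+ 2 * r ^+ 2) + 2 * (k r ^+ 2 * r ^+ 2) - (h r + k r) ^+ 2 * r ^+ 2
      = (h r - k r) ^+ 2 * r ^+ 2 by ring.
  by rewrite -subr_ge0 E; apply: mulr_ge0; exact: sqr_ge0.
Qed.

Lemma int3_wnorm2 D h : int3 D (fun r => h r ^+ 2) = ((4 * pi)%:E * wnorm2 D h)%E.
Proof. by []. Qed.

Lemma pi4_gt0 : 0 < 4 * pi :> R.
Proof. by rewrite mulr_gt0// pi_gt0. Qed.

Lemma cvge0_le T (F : set_system T) {FF : Filter F} (u : T -> \bar R) (e : R) :
  u n @[n --> F] --> 0%E -> 0 < e -> \forall n \near F, (u n <= e%:E)%E.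
Proof.
move=> u0 e0; have : nbhs (0%E : \bar R) [set y | (y < e%:E)%E].
  by apply: open_nbhs_nbhs; split; [exact: open_ereal_lt_ereal|rewrite /= lte_fin].
by move=> /u0; rewrite nbhs_simpl/=; apply: filterS => n /= /ltW.
Qed.

Lemma measurable_Omega : measurable (@Omega R). Proof. exact: measurable_itv. Qed.

Lemma measurable_ray a : measurable (`[a, +oo[ : set R). Proof. exact: measurable_itv. Qed.

Lemma ray_Omega a : 1 <= a -> `[a, +oo[ `<=` @Omega R.
Proof. by move=> a1 r /=; rewrite /Omega/= !in_itv/= !andbT; exact: le_trans. Qed.

Lemma wint_bound a b h N : 0 <= a -> a <= b -> measurable_fun `[a, b] h ->
  (wnorm2 `[a, b] h <= N%:E)%E ->
  mu.-integrable `[a, b] (EFin \o (fun r => r * h r)) /\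
  (\int[mu]_(r in `[a, b]) (r * h r)) ^+ 2 <= N * (b - a).
Proof.
move=> a0 ab mh hN.
have mr : measurable_fun `[a, b] (fun r : R => r * h r).
  by apply: measurable_funM => //; exact: measurable_id.
have hN' : (\int[mu]_(r in `[a, b]) ((r * h r) ^+ 2)%:E <= N%:E)%E.
  by apply: le_trans hN; rewrite /wnorm2; under eq_integral do rewrite exprMn mulrC.
have h1 : (\int[mu]_(r in `[a, b]) ((cst 1 r : R) ^+ 2)%:E <= (b - a)%:E)%E.
  have -> : (\int[mu]_(r in `[a, b]) ((cst 1 r : R) ^+ 2)%:E)%E = mu `[a, b].
    rewrite -[RHS]mul1e -integral_cst//.
    by apply: eq_integral => r _; rewrite /= expr1n.
  rewrite lebesgue_measure_itv/= lte_fin; case: ltP => // ba.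
  by rewrite lee_fin subr_ge0.
have m1 : measurable_fun `[a, b] (cst 1 : R -> R) by exact: measurable_cst.
have [i C] := cauchy_schwarz (measurable_itv _) mr m1 hN' h1.
have E : (fun r : R => r * h r * cst 1 r) = (fun r => r * h r) by apply/funext => r; rewrite /= mulr1.
rewrite E in i; split => //.
apply: le_trans C; rewrite -(real_normK (num_real (\int[mu]_(r in _) _))).
rewrite ler_sqr ?nnegrE ?Rintegral_ge0//.
under [leRHS]eq_Rintegral do rewrite mulr1.
exact: le_normr_Rintegral.
Qed.

End WeightedL2.

(** * Radial functions of finite energy *)

Section Radial.
Context {R : realType}.
Implicit Types (D : set R) (f g h k p q phi psi : R -> R) (a b c e A B N r x t : R) (d : data R).
Local Notation mu := (@lebesgue_measure R).

Lemma EFin_Rint f a b : continuous f ->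
  (\int[mu]_(r in `[a, b]) (f r)%:E)%E = (\int[mu]_(r in `[a, b]) f r)%:E.
Proof.
move=> cf; rewrite /Rintegral fineK//; apply: integrable_fin_num => //.
exact: continuous_integrable.
Qed.

Lemma test_is_derive phi x : test_function phi -> is_derive x 1 phi (derive1 phi x).
Proof. by move=> [/(_ 0%N x) h _]; exact: derivable_is_derive1. Qed.

Lemma test_continuous phi : test_function phi -> continuous phi.
Proof. by move=> h x; exact: is_derive_continuous (test_is_derive x h). Qed.

Lemma test_derive_continuous phi : test_function phi -> continuous (derive1 phi).
Proof.
move=> [/(_ 1%N) h _] x.
exact: is_derive_continuous (derivable_is_derive1 (h x)).
Qed.

Lemma continuous_measurable_on D f : measurable D -> continuous f -> measurable_fun D f.
Proof.
move=> mD cf; apply: (measurable_funS measurableT) => //.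
exact: continuous_measurable_fun.
Qed.

(** Cauchy-Schwarz for [phi' = (r phi') (1 / r)]: the integral of [r^(-2)] over [[a, b]] is
    [1 / a - 1 / b]. Only the energy beyond [a] enters, which is what lets exterior energy control
    exterior values. *)
Lemma test_increment phi a b N : test_function phi -> 1 <= a -> a <= b ->
  (wnorm2 `[a, +oo[ (derive1 phi) <= N%:E)%E ->
  (phi b - phi a) ^+ 2 <= N * (a^-1 - b^-1).
Proof.
move=> tphi a1 ab hN.
have cphi' := test_derive_continuous tphi.
(* Equal to [1 / r] on [[a, b]], but continuous on the whole line. *)
pose q (r : R) := (Num.max r 1)^-1.
have cq : continuous q.
  move=> x; apply: cvgV; first by rewrite gt_eqF// lt_max ltr01 orbT.
  by apply: continuous_max; [exact: cvg_id|exact: cvg_cst].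
have mp : measurable_fun `[a, b] (fun r : R => r * derive1 phi r).
  by apply: measurable_funM; [exact: measurable_id|exact: continuous_measurable_on].
have mq : measurable_fun `[a, b] q by exact: continuous_measurable_on.
have hp : (\int[mu]_(r in `[a, b]) ((r * derive1 phi r) ^+ 2)%:E <= N%:E)%E.
  have sub : (wnorm2 `[a, b] (derive1 phi) <= wnorm2 `[a, +oo[ (derive1 phi))%E.
    apply: wnorm2_subset => //; first exact: continuous_measurable_on.
    by move=> r /=; rewrite !in_itv/= andbT => /andP[].
  apply: le_trans (le_trans sub hN); rewrite /wnorm2.
  by under eq_integral do rewrite exprMn mulrC.
have hq : (\int[mu]_(r in `[a, b]) (q r ^+ 2)%:E <= (a^-1 - b^-1)%:E)%E.
  have cq2 : continuous (fun r => q r ^+ 2).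
    by move=> x; exact: (cvgM (cq x) (cq x)).
  rewrite (EFin_Rint _ _ cq2) lee_fin.
  have -> : \int[mu]_(r in `[a, b]) (q r ^+ 2) = - b^-1 - - a^-1; last by rewrite opprK addrC.
  apply: (@Rint_FTC _ (fun r => q r ^+ 2) (fun r : R => - r^-1)) => // x /andP[ax xb]; have x0 : 0 < x by lra.
  have xn0 : x != 0 by rewrite gt_eqF.
  have D := is_deriveN (is_deriveV xn0 (is_derive_id x 1)).
  apply: (is_derive_eq D); rewrite /q max_l; last lra.
  by rewrite /GRing.scale/= mulr1 opprK exprVn.
have [i C] := cauchy_schwarz (measurable_itv _) mp mq hp hq.
have E : phi b - phi a = \int[mu]_(r in `[a, b]) (r * derive1 phi r * q r).
  have <- : \int[mu]_(r in `[a, b]) derive1 phi r = phi b - phi a.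
    by apply: Rint_FTC => // x _; exact: test_is_derive.
  apply: eq_Rintegral => x; rewrite inE/= in_itv/= => /andP[ax xb].
  rewrite /q max_l; last lra.
  by field; rewrite gt_eqF//; lra.
rewrite -(real_normK (num_real (phi b - phi a))) E.
apply: le_trans C; rewrite ler_sqr ?nnegrE ?Rintegral_ge0//.
exact: le_normr_Rintegral.
Qed.

(** Take the far end of the increment beyond the support of [phi]. *)
Lemma test_value phi a N : test_function phi -> 1 <= a -> 0 <= N ->
  (wnorm2 `[a, +oo[ (derive1 phi) <= N%:E)%E -> phi a ^+ 2 <= N * a^-1.
Proof.
move=> tphi a1 N0 hN; have [_ [c [b [_ hb]]]] := tphi.
have := @test_increment phi a (Num.max a b + 1) N tphi a1 _ hN.
have ab : a <= Num.max a b + 1.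
  by have : a <= Num.max a b by [rewrite le_max lexx]; lra.
have bb : b < Num.max a b + 1.
  by have : b <= Num.max a b by [rewrite le_max lexx orbT]; lra.
move=> /(_ ab); rewrite hb; last by rewrite negb_and -!ltNge bb orbT.
rewrite sub0r sqrrN => h; apply: le_trans h _.
rewrite ler_wpM2l// gerBl invr_ge0; lra.
Qed.

Lemma cvg_sqr (u : nat -> R) (l : R) :
  u n @[n --> \oo] --> l -> (u n) ^+ 2 @[n --> \oo] --> l ^+ 2.
Proof.
move=> ul; have -> : (fun n => u n ^+ 2) = (fun n => u n * u n).
  by apply/funext => n; rewrite expr2.
by rewrite expr2; exact: cvgM.
Qed.

Lemma cvg_le_eventually (u : nat -> R) (l B : R) :
  u n @[n --> \oo] --> l -> (\forall n \near \oo, u n <= B) -> l <= B.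
Proof. by move=> ul uB; apply: (closed_cvg (fun x => x <= B)) ul => //; exact: closed_le. Qed.

(** The factor [2] comes from [(x + y)^2 <= 2 x^2 + 2 y^2]. This loss keeps the energy localised on
    the ray [[a, +oo[] and is harmless in all later estimates. *)
Lemma grad_approx f g a N e : is_radial_grad f g -> 1 <= a -> 0 < e ->
  (wnorm2 `[a, +oo[ g <= N%:E)%E ->
  exists phi : nat -> R -> R,
  [/\ forall n, test_function (phi n),
      forall r, 1 <= r -> phi n r @[n --> \oo] --> f r
    & \forall n \near \oo, (wnorm2 `[a, +oo[ (derive1 (phi n)) <= (2 * N + e)%:E)%E].
Proof.
move=> [mg [phi [tphi L phif]]] a1 e0 hN; exists phi; split => //.
have e1 : 0 < e / 2 * (4 * pi) by rewrite mulr_gt0 ?pi4_gt0// divr_gt0.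
have L1 : \forall n \near \oo, (L2norm2 ((phi n)^`()%classic - g)%R <= (e / 2 * (4 * pi))%:E)%E.
  exact: cvge0_le L e1.
near=> n.
have : (L2norm2 ((phi n)^`()%classic - g)%R <= (e / 2 * (4 * pi))%:E)%E by near: n.
rewrite /L2norm2 int3_wnorm2 (mulrC (e / 2)) (EFinM (4 * pi)) lee_pmul2l ?lte_fin ?pi4_gt0// => Hn.
have mr := measurable_ray a; have ra := ray_Omega a1.
have mphi : measurable_fun (@Omega R) (derive1 (phi n)).
  by apply: continuous_measurable_on; [exact: measurable_Omega|exact: test_derive_continuous].
have mO := @measurable_Omega R.
have E : derive1 (phi n) = (fun r => (g r + (derive1 (phi n) - g) r)%R).
  by apply/funext => r; rewrite !fctE; ring.
rewrite {1}E; apply: le_trans (wnorm2_add _ _ _) _ => //.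
- exact: measurable_funS ra mg.
- by apply: (measurable_funS _ ra) => //; apply: measurable_funB.
rewrite (EFinD (2 * N)) (EFinM 2); apply: leeD; first by apply: lee_wpmul2l => //; rewrite lee_fin.
have -> : e%:E = (2%:E * (e / 2)%:E)%E by rewrite -EFinM; congr EFin; field.
apply: lee_wpmul2l; first by rewrite lee_fin.
by apply: le_trans Hn; apply: wnorm2_subset => //; exact: measurable_funB.
Unshelve. all: end_near. Qed.

Lemma radial_increment f g a b N : is_radial_grad f g -> 1 <= a -> a <= b ->
  (wnorm2 `[a, +oo[ g <= N%:E)%E -> (f b - f a) ^+ 2 <= 2 * N * (a^-1 - b^-1).
Proof.
move=> fg a1 ab hN; set c := a^-1 - b^-1.
have c0 : 0 <= c by rewrite subr_ge0 lef_pV2 ?posrE; lra.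
apply/ler_addgt0Pr => /= e e0.
have e1 : 0 < e / (c + 1) by rewrite divr_gt0//; lra.
have [phi [tphi phif L]] := grad_approx fg a1 e1 hN.
have C : (phi n b - phi n a) ^+ 2 @[n --> \oo] --> (f b - f a) ^+ 2.
  have b1 : 1 <= b by lra.
  by apply: (@cvg_sqr (fun n => phi n b - phi n a)); apply: cvgB; exact: phif.
apply: (cvg_le_eventually C); apply: filterS L => n L.
apply: le_trans (test_increment (tphi n) a1 ab L) _.
rewrite -/c mulrDl lerD2l mulrAC ler_pdivrMr; last lra.
by rewrite ler_wpM2l//; lra.
Qed.

Lemma radial_value f g a N : is_radial_grad f g -> 1 <= a ->
  (wnorm2 `[a, +oo[ g <= N%:E)%E -> f a ^+ 2 <= 2 * N * a^-1.
Proof.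
move=> fg a1 hN.
have N0 : 0 <= N by rewrite -lee_fin; exact: le_trans (wnorm2_ge0 _ _) hN.
apply/ler_addgt0Pr => /= e e0.
have [phi [tphi phif L]] := grad_approx fg a1 e0 hN.
have C : (phi n a) ^+ 2 @[n --> \oo] --> (f a) ^+ 2.
  by have := phif a a1 => h; exact: (cvg_sqr h).
apply: (cvg_le_eventually C); apply: filterS L => n L.
have N1 : 0 <= 2 * N + e by lra.
apply: le_trans (test_value (tphi n) a1 N1 L) _.
rewrite mulrDl lerD2l ler_pdivrMr; last lra.
by rewrite ler_peMr//; lra.
Qed.

Lemma derive1n_sub phi psi n : test_function phi -> test_function psi ->
  derive1n n (phi - psi) = derive1n n phi - derive1n n psi.
Proof.
move=> [hp _] [hq _]; elim: n => // n IH.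
rewrite !derive1nS IH; apply/funext => r.
by rewrite derive1E (deriveB (hp n r) (hq n r)) -!derive1E.
Qed.

Lemma test_function_sub phi psi : test_function phi -> test_function psi ->
  test_function (phi - psi).
Proof.
move=> tp tq; split.
  move=> n r; rewrite derive1n_sub//; apply: derivableB; [exact: tp.1|exact: tq.1].
have [_ [a [b [a1 hab]]]] := tp; have [_ [a' [b' [a1' hab']]]] := tq.
exists (Num.min a a'), (Num.max b b'); split; first by rewrite lt_min a1.
move=> r hr.
have h1 : ~~ (a <= r <= b).
  by apply/negP => /andP[h1 h2]; move/negP: hr; apply; rewrite ge_min le_max h1 h2.
have h2 : ~~ (a' <= r <= b').
  by apply/negP => /andP[h2 h3]; move/negP: hr; apply; rewrite ge_min le_max h2 h3 !orbT.
by rewrite !fctE hab// hab'// subrr.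
Qed.

Lemma wnorm2N D h : wnorm2 D (- h) = wnorm2 D h.
Proof. by rewrite /wnorm2; apply: eq_integral => r _; rewrite fctE sqrrN. Qed.

Lemma is_radial_grad_sub f g f' g' : is_radial_grad f g -> is_radial_grad f' g' ->
  is_radial_grad (f - f') (g - g').
Proof.
move=> [mg [phi [tphi L phif]]] [mg' [phi' [tphi' L' phif']]].
split; first exact: measurable_funB.
exists (fun n => phi n - phi' n); split.
- by move=> n; exact: test_function_sub.
- have Z : (fun n => 2%:E * L2norm2 (derive1 (phi n) - g)%R + 2%:E * L2norm2 (derive1 (phi' n) - g')%R)%E
     @ \oo --> 0%E.
    have -> : 0%E = (2%:E * 0 + 2%:E * 0 : \bar R)%E by rewrite mule0 adde0.
    by apply: cvgeD; [rewrite mule0|exact: cvgeZl|exact: cvgeZl].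
  apply: (squeeze_cvge _ (cvg_cst 0%E) Z); apply: nearW => n; apply/andP; split.
    by rewrite /L2norm2 int3_wnorm2 mule_ge0 ?wnorm2_ge0// lee_fin ltW// pi4_gt0.
  rewrite /L2norm2 !int3_wnorm2 !(muleCA 2%:E) -muleDr//; last first.
    by rewrite ge0_adde_def// inE mule_ge0// ?wnorm2_ge0// lee_fin.
  apply: lee_wpmul2l; first by rewrite lee_fin ltW// pi4_gt0.
  have mO := @measurable_Omega R.
  have md psi : test_function psi -> measurable_fun (@Omega R) (derive1 psi).
    by move=> tpsi; apply: continuous_measurable_on => //; exact: test_derive_continuous.
  have mgn : measurable_fun (@Omega R) (g' - derive1 (phi' n)).
    by apply: measurable_funB => //; exact: md.
  have E : derive1 (phi n - phi' n) - (g - g') =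
     (fun r => ((derive1 (phi n) - g) r + (g' - derive1 (phi' n)) r)%R).
    have := @derive1n_sub (phi n) (phi' n) 1 (tphi n) (tphi' n); rewrite !derive1n1 => ->.
    by apply/funext => r; rewrite !fctE; ring.
  rewrite E; apply: le_trans (wnorm2_add _ _ _) _ => //.
    by apply: measurable_funB => //; exact: md.
  rewrite leeD2l// lee_wpmul2l//.
  have -> : g' - derive1 (phi' n) = - (derive1 (phi' n) - g') by rewrite opprB.
  by rewrite wnorm2N.
- by move=> r r1; apply: cvgB; [exact: phif|exact: phif'].
Qed.

Lemma grad_spec f : inHdot10 f -> is_radial_grad f (grad f).
Proof. by move=> [g fg]; rewrite /grad; exact: (@xgetPex _ 0 [set g | is_radial_grad f g] (ex_intro _ g fg)). Qed.

Lemma inL2_sub h k : inL2 h -> inL2 k -> inL2 (h - k).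
Proof.
move=> [mh hoo] [mk koo]; split; first exact: measurable_funB.
have mO := @measurable_Omega R; have p4 := @pi4_gt0 R.
move: hoo koo; rewrite /L2norm2 !int3_wnorm2 => hoo koo.
have mk' : measurable_fun (@Omega R) (- k) by exact: measurable_funN.
have := wnorm2_add mO mh mk'.
rewrite wnorm2N.
have fin u : ((4 * pi)%:E * wnorm2 (@Omega R) u < +oo)%E -> (wnorm2 (@Omega R) u < +oo)%E.
  rewrite !ltey; apply: contra => /eqP ->; rewrite mulry gtr0_sg// mul1e//.
move=> H; rewrite lte_mul_pinfty ?lee_fin ?ltW//.
apply: le_lt_trans H _; rewrite lte_add_pinfty// lte_mul_pinfty ?lee_fin//; exact: fin.
Qed.

(** The norm of a difference involves [grad (d1.1 - d2.1)], chosen independently of [grad d1.1] and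
    [grad d2.1]. Estimates are thus applied to the difference as an element of the space in its own
    right. *)
Lemma inH_sub (d1 d2 : data R) : inH d1 -> inH d2 -> inH (d1 - d2).
Proof.
move=> [h1 l1] [h2 l2]; split; last exact: inL2_sub.
exists (grad d1.1 - grad d2.1); apply: is_radial_grad_sub; exact: grad_spec.
Qed.

(** [8 <= 4 pi], from [2 <= pi], removes [pi] from all later constants. *)
Lemma int3_sum_le D g h e : measurable D -> measurable_fun D g -> measurable_fun D h ->
  (int3 D (fun r => g r ^+ 2 + h r ^+ 2)%R <= e%:E)%E ->
  (wnorm2 D g <= (e / 8)%:E)%E /\ (wnorm2 D h <= (e / 8)%:E)%E.
Proof.
move=> mD mg mh; rewrite /int3.
have -> : (\int[mu]_(r in D) ((g r ^+ 2 + h r ^+ 2) * r ^+ 2)%:E = wnorm2 D g + wnorm2 D h)%E.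
  rewrite /wnorm2 -ge0_integralD//; last 4 first.
  - by move=> r _; rewrite lee_fin mulr_ge0 ?sqr_ge0.
  - exact: measurable_wsq.
  - by move=> r _; rewrite lee_fin mulr_ge0 ?sqr_ge0.
  - exact: measurable_wsq.
  by apply: eq_integral => r _; rewrite mulrDl.
move=> H; have g0 := wnorm2_ge0 D g; have h0 := wnorm2_ge0 D h.
have {}H : (8%:E * (wnorm2 D g + wnorm2 D h) <= e%:E)%E.
  apply: le_trans H; apply: lee_wpmul2r; first exact: adde_ge0.
  by rewrite lee_fin; have := @pi_ge2 R; lra.
have K u v : (0 <= u)%E -> (0 <= v)%E -> (8%:E * (u + v) <= e%:E)%E -> (u <= (e / 8)%:E)%E.
  move=> u0 v0 uv; rewrite -(@lee_pmul2l _ 8%:E)// ?lte_fin// -EFinM mulrC divfK//.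
  by apply: le_trans uv; rewrite lee_pmul2l ?lte_fin// leeDl.
split; [exact: (K _ _ g0 h0)|apply: (K _ _ h0 g0)]; by rewrite // addeC.
Qed.

Lemma Hnorm2_bounds d e : inH d -> (Hnorm2 d <= e%:E)%E ->
  (wnorm2 (@Omega R) (grad d.1) <= (e / 8)%:E)%E /\ (wnorm2 (@Omega R) d.2 <= (e / 8)%:E)%E.
Proof.
move=> [hd ld] He; apply: int3_sum_le He; first exact: measurable_Omega.
  exact: (grad_spec hd).1.
exact: ld.1.
Qed.

(** Makes evaluation continuous on the energy space, uniformly in [r >= 1]; norm limits become
    pointwise limits. *)
Lemma Hnorm2_value d e r : inH d -> (Hnorm2 d <= e%:E)%E -> 1 <= r ->
  d.1 r ^+ 2 * r <= e.
Proof.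
move=> hd He r1; have [hg _] := Hnorm2_bounds hd He.
have fg := grad_spec hd.1.
have : (wnorm2 `[r, +oo[ (grad d.1) <= (e / 8)%:E)%E.
  apply: le_trans hg; apply: wnorm2_subset => //; [exact: measurable_Omega|exact: fg.1|exact: ray_Omega].
have e0 : 0 <= e / 8 by rewrite -lee_fin; exact: le_trans (wnorm2_ge0 _ _) hg.
move=> /(radial_value fg r1) H; rewrite -ler_pdivlMr; last lra.
apply: le_trans H _; have e2 : 2 * (e / 8) <= e by lra.
by rewrite ler_wpM2r ?invr_ge0//; lra.
Qed.

End Radial.

(** * Free waves with finite-energy data *)

Section FreeWave.
Context {R : realType}.
Implicit Types (f g h k p q phi psi : R -> R) (a b c e A B N r x t : R) (d : data R).
Local Notation mu := (@lebesgue_measure R).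

Lemma oint_ge a b f : a <= b -> oint a b f = \int[mu]_(s in `[a, b]) f s.
Proof. by rewrite /oint => ->. Qed.

Lemma oint_le a b f : b <= a -> oint a b f = - \int[mu]_(s in `[b, a]) f s.
Proof.
rewrite /oint; case: (leP a b) => // ab ba.
have -> : a = b by apply/eqP; rewrite eq_le ab.
by rewrite !Rint_point oppr0.
Qed.

(** Cauchy-Schwarz gives [N] times the square root of [|b - a|]; the larger [1 + |b - a|] avoids the
    root. *)
Lemma oint_sub_bound a b h k N : 1 <= a -> 1 <= b ->
  measurable_fun (@Omega R) h -> measurable_fun (@Omega R) k ->
  (wnorm2 (@Omega R) h < +oo)%E -> (wnorm2 (@Omega R) k < +oo)%E ->
  (wnorm2 (@Omega R) (h - k)%R <= (N ^+ 2)%:E)%E -> 0 <= N ->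
  `|oint a b (fun s => s * h s) - oint a b (fun s => s * k s)| <= N * (1 + `|b - a|).
Proof.
move=> a1 b1 mh mk hoo koo hk N0.
wlog ab : a b a1 b1 / a <= b.
  move=> H; have [|/ltW ba] := leP a b; first exact: H.
  rewrite !oint_le// -opprD normrN distrC.
  by have := H b a b1 a1 ba; rewrite !oint_ge// (distrC a b) => Hba; rewrite distrC.
rewrite !oint_ge//.
have sub : `[a, b] `<=` @Omega R.
  by move=> r /=; rewrite /Omega /= !in_itv/= andbT => /andP[? _]; lra.
have mO := @measurable_Omega R.
have a0 : 0 <= a by lra.
have w u M : measurable_fun (@Omega R) u -> (wnorm2 (@Omega R) u <= M%:E)%E ->
   mu.-integrable `[a, b] (EFin \o (fun r => r * u r)) /\
   (\int[mu]_(r in `[a, b]) (r * u r)) ^+ 2 <= M * (b - a).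
  move=> mu' uM; apply: wint_bound => //; first exact: measurable_funS sub mu'.
  by apply: le_trans uM; exact: wnorm2_subset.
have w' u : measurable_fun (@Omega R) u -> (wnorm2 (@Omega R) u < +oo)%E ->
   mu.-integrable `[a, b] (EFin \o (fun r => r * u r)).
  move=> mu' uoo; have fu : wnorm2 (@Omega R) u \is a fin_num by rewrite ge0_fin_numE ?wnorm2_ge0.
  by have [] := w u (fine (wnorm2 (@Omega R) u)) mu' _; rewrite ?fineK.
have ih := w' h mh hoo; have ik := w' k mk koo.
rewrite -RintegralB//.
under eq_Rintegral do rewrite -mulrBr.
have [|_ C] := w (h - k) (N ^+ 2) _ hk; first exact: measurable_funB.
rewrite -ler_sqr ?nnegrE//; last by rewrite mulr_ge0// addr_ge0.
rewrite (real_normK (num_real _)); apply: le_trans C _.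
rewrite exprMn ler_wpM2l ?sqr_ge0// ger0_norm ?subr_ge0//.
have : 0 <= b - a by lra.
move: (b - a) => z z0; rewrite -subr_ge0.
have -> : (1 + z) ^+ 2 - z = 1 + z + z ^+ 2 by ring.
by rewrite !addr_ge0// sqr_ge0.
Qed.

Lemma oprim_oint a b f : continuous f -> oprim f a b = oint a b f.
Proof.
move=> cf; rewrite /oprim; have [ab|/ltW ba] := leP a b.
  by rewrite oint_ge// prim_sub.
by rewrite oint_le// prim_sub// opprB.
Qed.

Lemma inL2_fin h : inL2 h -> (wnorm2 (@Omega R) h < +oo)%E.
Proof.
move=> [_]; rewrite /L2norm2 int3_wnorm2 !ltey; apply: contra => /eqP ->.
by rewrite mulry gtr0_sg ?pi4_gt0// mul1e.
Qed.

Lemma small_le (x K : R) : 0 <= K -> (forall e : R, 0 < e -> e <= 1 -> `|x| <= K * e) -> x = 0.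
Proof.
move=> K0 H; apply/eqP; rewrite -normr_le0; apply/ler_addgt0Pr => /= e e0; rewrite add0r.
pose e' := Num.min 1 (e / (K + 1)).
have q0 : 0 < e / (K + 1) by rewrite divr_gt0//; lra.
have e'0 : 0 < e' by rewrite lt_min ltr01.
apply: le_trans (H e' e'0 _) _; first by rewrite ge_min lexx.
apply: (@le_trans _ _ (K * (e / (K + 1)))).
  by rewrite ler_wpM2l// ge_min lexx orbT.
by rewrite mulrCA ger_pMr// ler_pdivrMr; lra.
Qed.

(** Every term of d'Alembert's formula is continuous for the energy norm: point values by
    [Hnorm2_value], the velocity integral by [oint_sub_bound]. The classical formula therefore
    passes to the limit. [v 0] and [d] agree at every [r >= 1] in the first component, but only in
    norm in the second. *)
Lemma free_wave_dalembert d (v : R -> data R) : free_wave d v ->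
  forall t r : R, 1 < r - t -> 1 < r + t ->
  r * (v t).1 r = ((r + t) * d.1 (r + t) + (r - t) * d.1 (r - t)) / 2
            + oint (r - t) (r + t) (fun s => s * d.2 s) / 2.
Proof.
move=> [Hd [Hv [v0 [wn [cw L]]]]] t r xi1 eta1.
have cwH n s : inH (wn n s, dt (wn n) s) by have [_ [_ [_ [h _]]]] := cw n; exact: h.
have v0H : inH (v 0 - d) by exact: inH_sub.
have v01 x : 1 <= x -> (v 0).1 x = d.1 x.
  move=> x1; have := @Hnorm2_value R (v 0 - d) 0 x v0H; rewrite v0 => /(_ (lexx _) x1).
  rewrite /= => H; apply/eqP; rewrite -subr_eq0 -sqrf_eq0; rewrite eq_le sqr_ge0 andbT.
  have : ((v 0).1 x - d.1 x) ^+ 2 * x <= 0 by [].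
  by rewrite pmulr_lle0//; lra.
have [_ v02] := @Hnorm2_bounds R (v 0 - d) 0 v0H ltac:(by rewrite v0).
(* A generous sum of the weights with which the errors enter: [r], [r + t], [r - t] for the point
   values and the length factor for the integral. *)
pose K := 4 + (r + t) + (r - t) + r + 4 * (1 + `|r + t - (r - t)|).
have K0 : 0 <= K by have := normr_ge0 (r + t - (r - t)); rewrite /K; lra.
apply/eqP; rewrite -subr_eq0; apply/eqP; apply: (@small_le _ K K0) => e e0 e1.
have e2 : 0 < e ^+ 2 by rewrite exprn_gt0.
have [n Ht H0] : exists2 n, (Hnorm2 ((wn n t, dt (wn n) t) - v t)%R <= (e ^+ 2)%:E)%E &
    (Hnorm2 ((wn n 0, dt (wn n) 0) - v 0)%R <= (e ^+ 2)%:E)%E.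
  have Lt : \forall n \near \oo, (Hnorm2 ((wn n t, dt (wn n) t) - v t)%R <= (e ^+ 2)%:E)%E.
    exact: cvge0_le (L t) e2.
  have L0 : \forall n \near \oo, (Hnorm2 ((wn n 0, dt (wn n) 0) - v 0)%R <= (e ^+ 2)%:E)%E.
    exact: cvge0_le (L 0) e2.
  by have [n [h1 h2]] := filter_ex (filterI Lt L0); exists n.
have value s x : (Hnorm2 ((wn n s, dt (wn n) s) - v s)%R <= (e ^+ 2)%:E)%E -> 1 <= x ->
    `|wn n s x - (v s).1 x| <= e.
  move=> He x1; have := Hnorm2_value (inH_sub (cwH n s) (Hv s)) He x1.
  rewrite /= => E; have {}E : (wn n s x - (v s).1 x) ^+ 2 * x <= e ^+ 2 by [].
  rewrite -ler_sqr ?nnegrE//; last exact: ltW.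
  rewrite (real_normK (num_real _)).
  by apply: le_trans E; rewrite ler_peMr ?sqr_ge0.
have V1 := value t r Ht ltac:(lra).
have V2 := value 0 (r + t) H0 ltac:(lra).
have V3 := value 0 (r - t) H0 ltac:(lra).
rewrite !v01 in V2 V3; [|lra|lra].
have [_ W0] := Hnorm2_bounds (inH_sub (cwH n 0) (Hv 0)) H0.
have mO := @measurable_Omega R.
have mdt := (cwH n 0).2.1; have mv0 := (Hv 0).2.1; have md := Hd.2.1.
have hk : (wnorm2 (@Omega R) (dt (wn n) 0 - d.2)%R <= (e ^+ 2)%:E)%E.
  have -> : dt (wn n) 0 - d.2 = (fun x => (((wn n 0, dt (wn n) 0) - v 0).2 x + (v 0 - d).2 x)%R).
    by apply/funext => x; rewrite /= !fctE; ring.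
  have := wnorm2_add mO (inH_sub (cwH n 0) (Hv 0)).2.1 v0H.2.1.
  move=> /le_trans; apply.
  apply: (@le_trans _ _ (2%:E * (e ^+ 2 / 8)%:E + 2%:E * (0 / 8)%:E)%E).
    by apply: leeD; apply: lee_wpmul2l; rewrite ?lee_fin.
  by rewrite -!EFinM -EFinD lee_fin; lra.
have := classical_dalembert (cw n) xi1 eta1.
rewrite oprim_oint; last first.
  move=> s; apply: cvgM; first exact: cvg_id.
  by have [_ [_ [_ [_ [_ tdw]]]]] := cw n; exact: test_continuous.
have := oint_sub_bound (ltW xi1) (ltW eta1) mdt md (inL2_fin (cwH n 0).2) (inL2_fin Hd.2) hk (ltW e0).
set I1 := oint _ _ _; set I2 := oint _ _ _.
set M := 1 + `|r + t - (r - t)|.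
have M0 : 0 <= M by rewrite /M addr_ge0.
rewrite /K -/M; clear K K0; move: V1 V2 V3.
move: (wn n t r) (wn n 0 (r + t)) (wn n 0 (r - t)) ((v t).1 r) (d.1 (r + t)) (d.1 (r - t)) => a1 a2 a3 b1 b2 b3.
clearbody I1 I2 M => V1 V2 V3 V4 E.
have {}E : r * b1 - (((r + t) * b2 + (r - t) * b3) / 2 + I2 / 2) =
  - (r * (a1 - b1)) + ((r + t) * (a2 - b2) / 2 + ((r - t) * (a3 - b3) / 2 + (I1 - I2) / 2)) by lra.
rewrite E.
have N1 : `|r * (a1 - b1)| <= r * e by rewrite normrM ger0_norm ?ler_wpM2l//; lra.
have half (p x : R) : 0 <= p -> `|x| <= e -> `|p * x / 2| <= p * e.
  move=> p0 xe; rewrite !normrM (ger0_norm p0) (ger0_norm (_ : 0 <= 2^-1))//.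
  rewrite -mulrA ler_wpM2l//; apply: le_trans xe.
  by rewrite ler_piMr// invf_le1// ler1n.
have rt0 : 0 <= r + t by lra.
have rt1 : 0 <= r - t by lra.
have N2 := half _ _ rt0 V2; have N3 := half _ _ rt1 V3.
have N4 : `|(I1 - I2) / 2| <= e * M.
  apply: le_trans V4; rewrite normrM (ger0_norm (_ : 0 <= 2^-1))//.
  by rewrite ler_piMr// invf_le1// ler1n.
have eM : 0 <= e * M by rewrite mulr_ge0// ltW.
apply: le_trans (ler_normD _ _) _; rewrite normrN.
apply: le_trans (lerD N1 (le_trans (ler_normD _ _) (lerD N2 (le_trans (ler_normD _ _) (lerD N3 N4))))) _.
rewrite !mulrDl; lra.
Qed.

End FreeWave.

(** * Tails and regularity of finite-energy functions *)

Section Tails.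
Context {R : realType}.
Implicit Types (f g h k p q phi psi : R -> R) (a b c e A B N r x t : R) (d : data R).
Local Notation mu := (@lebesgue_measure R).

(** Dominated convergence for the restrictions to [[n + 1, +oo[]. *)
Lemma wnorm2_tail h e : measurable_fun (@Omega R) h -> (wnorm2 (@Omega R) h < +oo)%E ->
  0 < e -> exists2 a : R, 1 <= a & (wnorm2 `[a, +oo[ h <= e%:E)%E.
Proof.
move=> mh hoo e0; pose F (r : R) : \bar R := (h r ^+ 2 * r ^+ 2)%:E.
have mO := @measurable_Omega R.
have mF : measurable_fun (@Omega R) F by exact: measurable_wsq.
have F0 r : (0 <= F r)%E by rewrite lee_fin mulr_ge0 ?sqr_ge0.
pose S (n : nat) : set R := `[n.+1%:R, +oo[%classic.
have mS n : measurable (S n) by exact: measurable_itv.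
have iF : mu.-integrable (@Omega R) F.
  apply/integrableP; split => //.
  by under eq_integral do rewrite gee0_abs//.
have := @dominated_convergence _ _ R mu (@Omega R) mO (fun n => F \_ (S n)) (cst 0%E) F _ _ _ iF _.
move=> [].
- move=> n; apply/(measurable_restrict _ (mS n) mO).
  by apply: measurable_funS mF => //; exact: subIsetl.
- exact: measurable_cst.
- apply: aeW => r _; apply: cvg_near_cst.
  near=> n; rewrite patchE memNset// /S /= in_itv/= andbT; apply/negP; rewrite -ltNge.
  apply: lt_le_trans (_ : n%:R <= _); last by rewrite ler_nat.
  near: n; exact: nbhs_infty_gtr.
- apply: aeW => r n _; rewrite patchE; case: ifPn => _; first by rewrite gee0_abs.
  by rewrite abse0.
move=> _ _; rewrite integral0 => C.
have [n Hn] : exists n : nat, (\int[mu]_(x in @Omega R) (F \_ (S n)) x <= e%:E)%E.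
  have : \forall n \near \oo, (\int[mu]_(x in @Omega R) (F \_ (S n)) x <= e%:E)%E.
    exact: cvge0_le C e0.
  by move=> /filter_ex.
exists n.+1%:R; first by rewrite ler1n.
move: Hn; rewrite -integral_mkcondr; have -> : @Omega R `&` S n = S n; last by [].
by apply: setIidr; apply: ray_Omega; rewrite ler1n.
Unshelve. all: end_near. Qed.

Lemma test_derive_supp phi b r : (forall x, b < x -> phi x = 0) -> b < r -> derive1 phi r = 0.
Proof.
move=> H br; rewrite derive1E (@near_eq_derive _ _ _ phi (cst 0)) ?derive_cst//.
near=> x; rewrite /= H//; near: x; exact: lt_nbhsr.
Unshelve. all: end_near. Qed.

Lemma continuous_mul f g : continuous f -> continuous g -> continuous (fun r => f r * g r).
Proof. by move=> cf cg x; apply: cvgM; [exact: cf|exact: cg]. Qed.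

Lemma continuous_pow f n : continuous f -> continuous (fun r => f r ^+ n).
Proof.
move=> cf; elim: n => [|n IH]; first by move=> x; exact: cvg_cst.
have -> : (fun r => f r ^+ n.+1) = (fun r => f r * f r ^+ n) by apply/funext => r; rewrite exprS.
exact: continuous_mul.
Qed.

Lemma test_wnorm2_fin phi : test_function phi -> (wnorm2 (@Omega R) (derive1 phi) < +oo)%E.
Proof.
move=> tphi; have [_ [a [b [_ hb]]]] := tphi.
have cphi := test_derive_continuous tphi.
have hb' x : b < x -> phi x = 0.
  by move=> bx; apply: hb; rewrite negb_and -!ltNge bx orbT.
have -> : wnorm2 (@Omega R) (derive1 phi) = wnorm2 (@Omega R `&` `[1, b]) (derive1 phi).
  rewrite /wnorm2 integral_mkcondr; apply: eq_integral => r.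
  rewrite inE /Omega /= in_itv/= andbT => r1; rewrite patchE.
  case: ifPn => //; rewrite notin_setE /= in_itv/= r1/= => /negP; rewrite -ltNge => br.
  by rewrite (test_derive_supp hb' br) expr0n/= mul0r.
have mO := @measurable_Omega R.
apply: (@le_lt_trans _ _ (wnorm2 `[1, b] (derive1 phi))).
  apply: wnorm2_subset => //; first exact: measurableI.
  exact: continuous_measurable_on.
rewrite /wnorm2 EFin_Rint ?ltry//.
by apply: continuous_mul; apply: continuous_pow => // x; exact: cvg_id.
Qed.

Lemma grad_fin f g : is_radial_grad f g -> (wnorm2 (@Omega R) g < +oo)%E.
Proof.
move=> [mg [phi [tphi L _]]]; have mO := @measurable_Omega R.
have e1 : 0 < 4 * pi :> R := pi4_gt0.
have [n] : exists n, (L2norm2 (derive1 (phi n) - g)%R <= (4 * pi)%:E)%E.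
  have : \forall n \near \oo, (L2norm2 (derive1 (phi n) - g)%R <= (4 * pi)%:E)%E.
    exact: cvge0_le L e1.
  by move=> /filter_ex.
rewrite /L2norm2 int3_wnorm2 -[leRHS]mule1 lee_pmul2l ?lte_fin// => Hn.
have mphi : measurable_fun (@Omega R) (derive1 (phi n)).
  by apply: continuous_measurable_on => //; exact: test_derive_continuous.
have E : g = (fun r => (derive1 (phi n) r + (- (derive1 (phi n) - g)) r)%R).
  by apply/funext => r; rewrite !fctE; ring.
rewrite E; apply: le_lt_trans (wnorm2_add _ _ _) _ => //.
  by apply: measurable_funN; exact: measurable_funB.
rewrite wnorm2N lte_add_pinfty// lte_mul_pinfty ?lee_fin//.
  exact: test_wnorm2_fin.
exact: le_lt_trans Hn (ltry _).
Qed.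

(** Split as [a (f b - f a) + (b - a) f b]. The weight [a] is compensated by
    [a^2 (1 / a - 1 / b) <= b - a], so the bound depends on [a] only through the energy beyond [a];
    this makes [r u] almost constant over fixed distances far out. *)
Lemma radial_weighted_increment f g a b N : is_radial_grad f g -> 1 <= a -> a <= b ->
  (wnorm2 `[a, +oo[ g <= N%:E)%E ->
  (b * f b - a * f a) ^+ 2 <= 4 * N * ((b - a) + (b - a) ^+ 2).
Proof.
move=> fg a1 ab hN; have b1 : 1 <= b by lra.
have mg := fg.1.
have N0 : 0 <= N by rewrite -lee_fin; exact: le_trans (wnorm2_ge0 _ _) hN.
have I := radial_increment fg a1 ab hN.
have V : f b ^+ 2 <= 2 * N * b^-1.
  apply: radial_value fg b1 _; apply: le_trans hN; apply: wnorm2_subset => //.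
  - by apply: measurable_funS mg => //; [exact: measurable_Omega|exact: ray_Omega].
  - by move=> r /=; rewrite !in_itv/= !andbT; exact: le_trans.
have I' : (a * (f b - f a)) ^+ 2 <= 2 * N * (b - a).
  rewrite exprMn; apply: (@le_trans _ _ (a ^+ 2 * (2 * N * (a^-1 - b^-1)))).
    by rewrite ler_wpM2l// sqr_ge0.
  have -> : a ^+ 2 * (2 * N * (a^-1 - b^-1)) = 2 * N * ((b - a) * (a / b)).
    by field; rewrite !gt_eqF//; lra.
  rewrite ler_wpM2l//; first by lra.
  by rewrite ler_piMr ?subr_ge0// ler_pdivrMr ?mul1r//; lra.
have V' : ((b - a) * f b) ^+ 2 <= 2 * N * (b - a) ^+ 2.
  rewrite exprMn mulrC ler_wpM2r ?sqr_ge0//; apply: le_trans V _.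
  by rewrite ler_piMr ?mulr_ge0// invf_le1//; lra.
have -> : b * f b - a * f a = a * (f b - f a) + (b - a) * f b by ring.
move: (a * (f b - f a)) ((b - a) * f b) I' V' => x y; move: (b - a) => z; clear.
move=> Hx Hy; have : (x + y) ^+ 2 = 2 * x ^+ 2 + 2 * y ^+ 2 - (x - y) ^+ 2 by ring.
have := sqr_ge0 (x - y); lra.
Qed.

(** Hoelder continuity of order [1/2]. A profile has no meaning below [r = 1], hence the extension
    through [Num.max r 1]. *)
Lemma radial_continuous f g : is_radial_grad f g -> continuous (fun r => f (Num.max r 1)).
Proof.
move=> fg; have /= := grad_fin fg; have mO := @measurable_Omega R.
rewrite -ge0_fin_numE ?wnorm2_ge0// => /fineK; set N := fine _ => NE.
have N0 : 0 <= N by rewrite -lee_fin NE; exact: wnorm2_ge0.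
have inc a b : 1 <= a -> 1 <= b -> (f b - f a) ^+ 2 <= 2 * N * `|b - a|.
  wlog ab : a b / a <= b.
    move=> H a1 b1; have [|/ltW ba] := leP a b; first by move=> /H; exact.
    by rewrite distrC -sqrrN opprB; exact: H.
  move=> a1 b1; rewrite ger0_norm ?subr_ge0//.
  have Hr : (wnorm2 `[a, +oo[ g <= N%:E)%E.
    by rewrite NE; apply: wnorm2_subset => //; [exact: fg.1|exact: ray_Omega].
  apply: le_trans (radial_increment fg a1 ab Hr) _.
  rewrite ler_wpM2l//; first by lra.
  have -> : a^-1 - b^-1 = (b - a) * (a^-1 * b^-1) by field; rewrite !gt_eqF//; lra.
  by rewrite ler_piMr ?subr_ge0// mulr_ile1 ?invr_ge0 ?invf_le1//; lra.
move=> x; apply/cvgrPdist_le => e e0.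
have d0 : 0 < e ^+ 2 / (2 * N + 1) by rewrite divr_gt0 ?exprn_gt0//; lra.
near=> y.
have xy : `|y - x| <= e ^+ 2 / (2 * N + 1).
  by rewrite distrC; near: y; exact: cvgr_dist_le.
rewrite -ler_sqr ?nnegrE//; last exact: ltW.
rewrite real_normK ?num_real//.
have y1 : 1 <= Num.max y 1 by rewrite le_max lexx orbT.
have x1 : 1 <= Num.max x 1 by rewrite le_max lexx orbT.
apply: le_trans (inc _ _ y1 x1) _.
have mm : `|Num.max x 1 - Num.max y 1| <= `|y - x|.
  rewrite (distrC y); have [h1|h1] := leP x 1; have [h2|h2] := leP y 1.
  - by rewrite subrr normr0.
  - by rewrite !ler0_norm; lra.
  - by rewrite !ger0_norm; lra.
  - by [].
have N1 : 0 < 2 * N + 1 by lra.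
apply: (@le_trans _ _ ((2 * N + 1) * (e ^+ 2 / (2 * N + 1)))).
  apply: ler_pM => //; [lra|lra|exact: le_trans mm xy].
by rewrite mulrC divfK ?gt_eqF.
Unshelve. all: end_near. Qed.

End Tails.

(** * Bounds in the exterior region *)

Lemma near_fst T1 T2 (F : set_system T1) (G : set_system T2) (P : T1 -> Prop) :
  Filter G -> (\forall x \near F, P x) -> \forall p \near filter_prod F G, P p.1.
Proof. by move=> FG FP; exists (P, setT); [split => //; exact: filterT|case=> x y []]. Qed.

Lemma near_snd T1 T2 (F : set_system T1) (G : set_system T2) (P : T2 -> Prop) :
  Filter F -> (\forall x \near G, P x) -> \forall p \near filter_prod F G, P p.2.
Proof. by move=> FF GP; exists (setT, P); [split => //; exact: filterT|case=> x y []]. Qed.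

Section NLWBounds.
Context {R : realType} (m : nat) (rho0 : R) (rho1 : 1 < rho0) (d : data R) (U : R -> data R)
  (hU : nlw_solution m rho0 d U).
Local Notation mu := (@lebesgue_measure R).

(** The neighbourhood of [t] is independent of [r]; this gives joint continuity and the bound on
    compact time intervals. *)
Lemma nlw_near (t e : R) : 0 < e ->
  \forall s \near t, forall r : R, 1 <= r -> ((U s).1 r - (U t).1 r) ^+ 2 * r <= e.
Proof.
move=> e0; have C : \forall s \near t, (Hnorm2 (U s - U t)%R <= e%:E)%E.
  exact: cvge0_le (nlw_continuous hU t) e0.
near=> s => r r1.
have Hs : (Hnorm2 (U s - U t)%R <= e%:E)%E by near: s.
exact: Hnorm2_value (inH_sub (nlw_inH hU s) (nlw_inH hU t)) Hs r1.
Unshelve. all: end_near. Qed.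

Lemma nlw_slice_continuous (t : R) : continuous (fun r : R => (U t).1 (Num.max r 1)).
Proof. exact: radial_continuous (grad_spec (nlw_inH hU t).1). Qed.

Lemma nlw_joint_continuous :
  continuous (fun p : R * R => (U p.1).1 (Num.max p.2 1)).
Proof.
move=> [t r]; apply/cvgrPdist_le => e e0 /=.
have e1 : 0 < (e / 2) ^+ 2 by rewrite exprn_gt0// divr_gt0.
have e2 : 0 < e / 2 by rewrite divr_gt0.
have /cvgrPdist_le/(_ _ e2) N := @nlw_slice_continuous t r.
near=> p.
have A : forall x : R, 1 <= x -> ((U p.1).1 x - (U t).1 x) ^+ 2 * x <= (e / 2) ^+ 2.
  by near: p; exact: (@near_fst _ _ _ (nbhs r) _ _ (nlw_near t e1)).
have B : `|(U t).1 (Num.max r 1) - (U t).1 (Num.max p.2 1)| <= e / 2.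
    by near: p; exact: (@near_snd _ _ (nbhs t) _ _ _ N).
have x1 : 1 <= Num.max p.2 1 by rewrite le_max lexx orbT.
have {}A : `|(U t).1 (Num.max p.2 1) - (U p.1).1 (Num.max p.2 1)| <= e / 2.
  rewrite distrC -ler_sqr ?nnegrE//; last exact: ltW.
  rewrite real_normK ?num_real//; apply: le_trans (A _ x1).
  by rewrite ler_peMr ?sqr_ge0.
rewrite (le_trans (ler_distD ((U t).1 (Num.max p.2 1)) _ _))//.
by rewrite (le_trans (lerD B A))//; lra.
Unshelve. all: end_near. Qed.

Lemma nlw_bound_at (t : R) : exists C : R, forall r : R, 1 <= r -> (U t).1 r ^+ 2 * r <= C.
Proof.
have fg := grad_spec (nlw_inH hU t).1.
have mg := fg.1.
have := grad_fin fg; rewrite -ge0_fin_numE ?wnorm2_ge0// => /fineK; set N := fine _ => NE.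
exists (2 * N) => r r1; rewrite -ler_pdivlMr; last lra.
apply: (radial_value fg r1); rewrite NE; apply: wnorm2_subset => //.
- exact: measurable_Omega.
- exact: ray_Omega.
Qed.

Lemma nlw_bound_compact (T : R) : exists C : R, forall t : R, `|t| <= T ->
  forall r : R, 1 <= r -> (U t).1 r ^+ 2 * r <= C.
Proof.
have /compact_near_coveringP cK : compact (`[- T, T]%classic : set R) by exact: segment_compact.
pose P (C s : R) := forall r : R, 1 <= r -> (U s).1 r ^+ 2 * r <= C.
have : \forall C \near +oo, `[- T, T]%classic `<=` P C.
  apply: cK => t _; have [Ct HCt] := nlw_bound_at t.
  near=> p.
  have A : forall x : R, 1 <= x -> ((U p.1).1 x - (U t).1 x) ^+ 2 * x <= 1.
    by near: p; exact: (@near_fst _ _ _ (+oo) _ _ (nlw_near t ltr01)).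
  have B : 2 * Ct + 2 <= p.2.
    by near: p; exact: (@near_snd _ _ (nbhs t) _ _ _ (nbhs_pinfty_ge (num_real _))).
  move=> r r1; have := A r r1; have := HCt r r1; move: B.
  move: ((U p.1).1 r) ((U t).1 r) p.2 => x y C; clear A HCt => B h1 h2.
  have : x ^+ 2 * r = 2 * (y ^+ 2 * r) + 2 * ((x - y) ^+ 2 * r) - (x - 2 * y) ^+ 2 * r by ring.
  have : 0 <= (x - 2 * y) ^+ 2 * r by rewrite mulr_ge0 ?sqr_ge0//; lra.
  lra.
move=> /filter_ex[C HC]; exists C => t tT; apply: HC.
by rewrite /= in_itv/= -ler_norml.
Unshelve. all: end_near. Qed.

Context (Ep Em : \bar R)
    (hEp : exterior_energy rho0 U t @[t --> +oo] --> Ep)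
    (hEm : exterior_energy rho0 U t @[t --> -oo] --> Em)
    (hE : (Ep + Em = 0)%E).

Lemma exterior_energy_ge0 (t : R) : (0 <= exterior_energy rho0 U t)%E.
Proof.
rewrite /exterior_energy /int3 mule_ge0//; first by rewrite lee_fin ltW// pi4_gt0.
by apply: integral_ge0 => r _; rewrite lee_fin mulr_ge0 ?sqr_ge0// addr_ge0 ?sqr_ge0.
Qed.

(** Both limits are nonnegative with sum zero, so each vanishes. The factor [8] in the proof
    compensates that of [int3_sum_le]. *)
Lemma exterior_grad_small (e : R) : 0 < e -> exists T : R, forall t : R, T <= `|t| ->
  (wnorm2 `[(rho0 + `|t|)%R, +oo[ (grad (U t).1) <= e%:E)%E.
Proof.
move=> e0.
have Ep0 : (0 <= Ep)%E.
  by apply: (cvge_ge _ hEp); apply: nearW => t; exact: exterior_energy_ge0.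
have Em0 : (0 <= Em)%E.
  by apply: (cvge_ge _ hEm); apply: nearW => t; exact: exterior_energy_ge0.
have [/eqP Ep_0 /eqP Em_0] : Ep == 0%E /\ Em == 0%E.
  by apply/andP; rewrite -padde_eq0// hE.
have e8 : 0 < e * 8 by rewrite mulr_gt0.
have hp : \forall t \near +oo, (exterior_energy rho0 U t <= (e * 8)%:E)%E.
  by apply: cvge0_le e8; rewrite -Ep_0.
have hm : \forall t \near -oo, (exterior_energy rho0 U t <= (e * 8)%:E)%E.
  by apply: cvge0_le e8; rewrite -Em_0.
have [Tp [_ HTp]] := hp; have [Tm [_ HTm]] := hm.
exists (`|Tp| + `|Tm| + 1) => t tT.
have E : (exterior_energy rho0 U t <= (e * 8)%:E)%E.
  have := ler_norm Tp; have := ler_norm (- Tm); rewrite normrN => h1 h2.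
  have [t0|t0] := leP 0 t.
    by apply: HTp; move: tT; rewrite (ger0_norm t0); have := normr_ge0 Tm; lra.
  by apply: HTm; move: tT; rewrite (ltr0_norm t0); have := normr_ge0 Tp; lra.
have fg := grad_spec (nlw_inH hU t).1; have mv := (nlw_inH hU t).2.1.
have sub : `[rho0 + `|t|, +oo[ `<=` @Omega R.
  by apply: ray_Omega; have := normr_ge0 t; have := rho1; lra.
have mO := @measurable_Omega R.
have [] := int3_sum_le (measurable_ray _) (measurable_funS mO sub fg.1) (measurable_funS mO sub mv) E.
by rewrite mulfK.
Qed.

(** Compactness in time for [|t| <= T]; beyond [T] the exterior energy is below [1], and it alone
    controls the values at [r >= rho0 + |t|]. *)
Lemma nlw_bound : exists2 C : R, 0 < C & forall t r : R, rho0 + `|t| <= r ->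
  (U t).1 r ^+ 2 * r <= C.
Proof.
have [T HT] := exterior_grad_small ltr01; have [C HC] := nlw_bound_compact T.
exists (`|C| + 2); first by rewrite ltr_wpDl.
move=> t r tr; have r1 : 1 <= r.
  have t0 := normr_ge0 t; have := rho1; lra.
have [tT|/ltW tT] := leP `|t| T.
  apply: le_trans (HC t tT r r1) _; have := ler_norm C; lra.
have fg := grad_spec (nlw_inH hU t).1.
have mg := fg.1.
suff : (U t).1 r ^+ 2 <= 2 * 1 * r^-1.
  by rewrite mulr1 ler_pdivlMr; [have := normr_ge0 C; lra|lra].
apply: (radial_value fg r1); apply: le_trans (HT t tT).
have mO := @measurable_Omega R.
apply: wnorm2_subset => //.
- apply: measurable_funS mg => //; apply: ray_Omega; have := normr_ge0 t; have := rho1; lra.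
- by move=> x /=; rewrite !in_itv/= !andbT; exact: le_trans.
Qed.

End NLWBounds.

(** * The Duhamel integral in null coordinates *)

Section DuhamelCone.
Context {R : realType}.
Implicit Types (f g k : R -> R) (G K : R -> R -> R) (a b c e r s t x T xi eta : R).
Local Notation mu := (@lebesgue_measure R).

Lemma Rint_add f g a b : continuous f -> continuous g ->
  \int[mu]_(x in `[a, b]) (f x + g x) =
  \int[mu]_(x in `[a, b]) f x + \int[mu]_(x in `[a, b]) g x.
Proof.
by move=> cf cg; apply: RintegralD => //; exact: continuous_integrable.
Qed.

Lemma Rint_le f g a b : continuous f -> continuous g -> (forall x, f x <= g x) ->
  \int[mu]_(x in `[a, b]) f x <= \int[mu]_(x in `[a, b]) g x.
Proof.
by move=> cf cg H; apply: le_Rintegral => //; exact: continuous_integrable.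
Qed.

Definition jcont G := continuous (fun p : R * R => G p.1 p.2).

Lemma continuous_pair (a b : R -> R) s : {for s, continuous a} -> {for s, continuous b} ->
  {for s, continuous (fun x : R => (a x, b x))}.
Proof.
move=> ca cb A [[B C] [/= NB NC] BC].
have h1 := ca B NB; have h2 := cb C NC.
apply: (@filterS2 R (nbhs s) _ _ _ _ _ h1 h2) => x /= Bx Cx.
exact: (BC (a x, b x)).
Qed.

Lemma jcont_slice G s : jcont G -> continuous (G s).
Proof.
move=> cG x; apply: (@continuous_comp _ _ _ (fun y : R => (s, y)) (fun p : R * R => G p.1 p.2) x).
  by apply: (@continuous_pair (fun=> s) id); [exact: cvg_cst|exact: cvg_id].
exact: cG.
Qed.

Lemma jcont_unif G s0 M e : jcont G -> 0 < e ->
  \forall s \near s0, forall x, - M <= x <= M -> `|G s x - G s0 x| <= e.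
Proof.
move=> cG e0.
have /compact_near_coveringP cK : compact (`[- M, M]%classic : set R) by exact: segment_compact.
pose P (s x : R) : Prop := `|G s x - G s0 x| <= e.
suff : \forall s \near s0, `[- M, M]%classic `<=` P s.
  by apply: filterS => s H x xM; apply: H; rewrite /= in_itv.
apply: (cK R (nbhs s0) P) => x _.
have e2 : 0 < e / 2 by rewrite divr_gt0.
have /cvgrPdist_le/(_ _ e2) N := cG (s0, x).
have [[A B] [/= NA NB] AB] := N.
exists (B, A) => // -[y s] [/= By As].
have h1 := AB (s, y) (conj As By).
have h2 := AB (s0, y) (conj (nbhs_singleton NA) By).
rewrite /P (le_trans (ler_distD (G s0 x) _ _))// distrC.
by have := lerD h1 h2; rewrite /=; lra.
Qed.

Lemma prim0 f : prim f 0 = 0.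
Proof. by rewrite /prim /oint lexx Rint_point. Qed.

Lemma prim_diff_bound f g e x : continuous f -> continuous g ->
  (forall y, `|y| <= `|x| -> `|f y - g y| <= e) -> `|prim f x - prim g x| <= e * `|x|.
Proof.
move=> cf cg H.
have [|c cx] := @MVT_dist R (prim f - prim g) (fun y => f y - g y) 0 x.
  by move=> c _; apply: is_deriveB; exact: is_derive_prim.
rewrite !fctE !prim0 !subr0 => ->; rewrite normrM ler_wpM2r//.
by apply: H; rewrite !subr0 in cx.
Qed.

Lemma prim_jcont G : jcont G -> jcont (fun s => prim (G s)).
Proof.
move=> cG [s0 x0]; apply/cvgrPdist_le => e e0 /=.
pose M := `|x0| + 1.
have M0 : 0 < M by rewrite /M ltr_wpDl.
have e1 : 0 < e / 2 / M by rewrite !divr_gt0.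
have e2 : 0 < e / 2 by rewrite divr_gt0.
have N1 := jcont_unif s0 M cG e1.
have /cvgrPdist_le/(_ _ e2) N2 := @continuous_prim R (G s0) (jcont_slice (s := s0) cG) x0.
have N3 : \forall x \near x0, `|x| <= M.
  have /cvgrPdist_le/(_ _ ltr01) := @cvg_id _ (nbhs x0).
  apply: filterS => x /= h; rewrite /M -{1}(subrK x0 x).
  by apply: le_trans (ler_normD _ _) _; rewrite addrC lerD2l distrC.
near=> p.
have A1 : forall x, - M <= x <= M -> `|G p.1 x - G s0 x| <= e / 2 / M.
  by near: p; exact: (@near_fst _ _ _ (nbhs x0) _ _ N1).
have A2 : `|prim (G s0) x0 - prim (G s0) p.2| <= e / 2.
  by near: p; exact: (@near_snd _ _ (nbhs s0) _ _ _ N2).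
have A3 : `|p.2| <= M.
  by near: p; exact: (@near_snd _ _ (nbhs s0) _ _ _ N3).
rewrite (le_trans (ler_distD (prim (G s0) p.2) _ _))//.
have A4 : `|prim (G s0) p.2 - prim (G p.1) p.2| <= e / 2.
  rewrite distrC; apply: (@le_trans _ _ (e / 2 / M * `|p.2|)).
    apply: prim_diff_bound; [exact: jcont_slice|exact: jcont_slice|].
    by move=> y yp; apply: A1; rewrite -ler_norml; exact: le_trans yp A3.
  by rewrite mulrAC ler_pdivrMr// ler_wpM2l// ltW.
by rewrite (le_trans (lerD A2 A4))//; lra.
Unshelve. all: end_near. Qed.

(* Equal to [0] when [b < a]. *)
Definition slice f a b : R := \int[mu]_(x in `[a, b]) f x.

Lemma slice_prim f a b : continuous f -> slice f a b = prim f (Num.max a b) - prim f a.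
Proof.
move=> cf; rewrite /slice; have [ab|ba] := leP a b; first by rewrite prim_sub.
by rewrite Rint_empty// subrr.
Qed.

(** The primitive taken at [max a b] stays valid, and continuous, when the endpoints cross and the
    slice becomes empty. *)
Lemma slice_continuous G (a b : R -> R) : jcont G -> continuous a -> continuous b ->
  continuous (fun s => slice (G s) (a s) (b s)).
Proof.
move=> cG ca cb.
have -> : (fun s => slice (G s) (a s) (b s)) =
   (fun s => prim (G s) (Num.max (a s) (b s)) - prim (G s) (a s)).
  by apply/funext => s; rewrite slice_prim//; exact: jcont_slice.
have cp := prim_jcont cG.
have cc (c : R -> R) : continuous c -> continuous (fun s => prim (G s) (c s)).
  move=> hc s.
  apply: (@continuous_comp _ _ _ (fun s : R => (s, c s)) (fun p : R * R => prim (G p.1) p.2) s).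
    by apply: (@continuous_pair id c); [exact: cvg_id|exact: hc].
  exact: cp.
have cm : continuous (fun s => Num.max (a s) (b s)).
  by move=> s; exact: continuous_max (ca s) (cb s).
by move=> s; apply: cvgB; [exact: (cc _ cm)|exact: cc].
Qed.

Lemma prim_mono f a b : continuous f -> a <= b -> (forall x, a <= x <= b -> 0 <= f x) ->
  prim f a <= prim f b.
Proof.
by move=> cf ab H; apply: (@ge0_is_derive_le _ _ f) => // x _; exact: is_derive_prim.
Qed.

(* With [H] a primitive of [f], [slice f a b = H (max a b) - H a] and the terms
   [H a] cancel in the second difference. *)
Lemma slice_supermodular f a1 a2 b1 b2 : continuous f -> a1 <= a2 -> b1 <= b2 ->
  (forall x, a1 <= x <= a2 -> b1 <= x <= b2 -> 0 <= f x) ->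
  slice f a1 b1 + slice f a2 b2 <= slice f a1 b2 + slice f a2 b1.
Proof.
move=> cf a12 b12 f0; rewrite !slice_prim//.
suff : prim f (Num.max a1 b1) + prim f (Num.max a2 b2) <=
       prim f (Num.max a1 b2) + prim f (Num.max a2 b1) by lra.
have mono a b : a <= b -> a1 <= a -> b1 <= a -> b <= a2 -> b <= b2 -> prim f a <= prim f b.
  move=> ab h1 h2 h3 h4; apply: prim_mono => // x /andP[x1 x2].
  by apply: f0; apply/andP; split; lra.
have [h1|/ltW h1] := leP a1 b1.
- rewrite (max_r (le_trans h1 b12)); have [h4|/ltW h4] := leP a2 b1.
    by rewrite (max_r (le_trans h4 b12)) addrC.
  have [h2|/ltW h2] := leP a2 b2; first by rewrite addrC lerD2l mono.
  by rewrite lerD2r mono.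
- rewrite (max_l (le_trans h1 a12)); have [h4|/ltW h4] := leP b2 a1.
    by rewrite (max_l (le_trans h4 a12)).
  have [h2|/ltW h2] := leP a2 b2; first by rewrite addrC lerD2l mono.
  by rewrite lerD2r mono.
Qed.

Lemma affineD_continuous c : continuous (fun s : R => c + s).
Proof. by move=> s; apply: cvgD; [exact: cvg_cst|exact: cvg_id]. Qed.

Lemma affineB_continuous c : continuous (fun s : R => c - s).
Proof. by move=> s; apply: cvgB; [exact: cvg_cst|exact: cvg_id]. Qed.

(** Section at time [s] of the dependence cone of [(t, r)]: its ends [r - (t - s)] and [r + (t - s)]
    are [xi + s] and [eta - s]. Their order is that of a positive [t - s] here, and is exchanged in
    [cone_down]. *)
Definition cone_up G xi eta s : R := slice (G s) (xi + s) (eta - s).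
Definition cone_down G xi eta s : R := slice (G s) (eta - s) (xi + s).

Lemma cone_up_continuous G xi eta : jcont G -> continuous (cone_up G xi eta).
Proof. by move=> cG; apply: slice_continuous; [|exact: affineD_continuous|exact: affineB_continuous]. Qed.

Lemma cone_down_continuous G xi eta : jcont G -> continuous (cone_down G xi eta).
Proof. by move=> cG; apply: slice_continuous; [|exact: affineB_continuous|exact: affineD_continuous]. Qed.

(* Twice the Duhamel integral at the point of null coordinates
   [xi = r - t], [eta = r + t], for any [T >= |t|]. *)
Definition cone_int T G xi eta : R :=
  \int[mu]_(s in `[0, T]) cone_up G xi eta s +
  \int[mu]_(s in `[- T, 0]) cone_down G xi eta s.

(** For [t >= 0] the sections at times outside [[0, t]] are empty or reduced to a point, so
    enlarging the time interval to [[- T, T]] changes nothing. *)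
Lemma cone_int_pos T G xi eta : jcont G -> xi <= eta -> eta - xi <= 2 * T ->
  cone_int T G xi eta = \int[mu]_(s in `[0, (eta - xi) / 2]) cone_up G xi eta s.
Proof.
move=> cG xe tT; rewrite /cone_int; set t := (eta - xi) / 2.
have -> : \int[mu]_(s in `[- T, 0]) cone_down G xi eta s = 0.
  rewrite (eq_Rintegral _ (g := cst 0)) ?Rintegral_cst// ?mul0r// => s.
  rewrite inE/= in_itv/= => /andP[s1 s2]; rewrite /cone_down /slice.
  have [h|h] := ltP (xi + s) (eta - s); first by rewrite Rint_empty.
  have -> : eta - s = xi + s by lra.
  by rewrite Rint_point.
rewrite addr0 (@Rint_split _ _ 0 t T).
- have -> : \int[mu]_(s in `[t, T]) cone_up G xi eta s = 0; last by rewrite addr0.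
  rewrite (eq_Rintegral _ (g := cst 0)) ?Rintegral_cst// ?mul0r// => s.
  rewrite inE/= in_itv/= => /andP[s1 s2]; rewrite /cone_up /slice.
  have [h|h] := ltP (eta - s) (xi + s); first by rewrite Rint_empty.
  have -> : eta - s = xi + s by rewrite /t in s1; lra.
  by rewrite Rint_point.
- exact: cone_up_continuous.
- by rewrite /t; lra.
- by rewrite /t; lra.
Qed.

Lemma cone_int_neg T G xi eta : jcont G -> eta <= xi -> xi - eta <= 2 * T ->
  cone_int T G xi eta = \int[mu]_(s in `[(eta - xi) / 2, 0]) cone_down G xi eta s.
Proof.
move=> cG xe tT; rewrite /cone_int; set t := (eta - xi) / 2.
have -> : \int[mu]_(s in `[0, T]) cone_up G xi eta s = 0.
  rewrite (eq_Rintegral _ (g := cst 0)) ?Rintegral_cst// ?mul0r// => s.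
  rewrite inE/= in_itv/= => /andP[s1 s2]; rewrite /cone_up /slice.
  have [h|h] := ltP (eta - s) (xi + s); first by rewrite Rint_empty.
  have -> : eta - s = xi + s by lra.
  by rewrite Rint_point.
rewrite add0r (@Rint_split _ _ (- T) t 0).
- have -> : \int[mu]_(s in `[- T, t]) cone_down G xi eta s = 0; last by rewrite add0r.
  rewrite (eq_Rintegral _ (g := cst 0)) ?Rintegral_cst// ?mul0r// => s.
  rewrite inE/= in_itv/= => /andP[s1 s2]; rewrite /cone_down /slice.
  have [h|h] := ltP (xi + s) (eta - s); first by rewrite Rint_empty.
  have -> : eta - s = xi + s by rewrite /t in s2; lra.
  by rewrite Rint_point.
- exact: cone_down_continuous.
- by rewrite /t; lra.
- by rewrite /t; lra.
Qed.

Lemma sliceD f g a b : continuous f -> continuous g ->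
  slice (fun x => f x + g x) a b = slice f a b + slice g a b.
Proof. exact: Rint_add. Qed.

Lemma jcontD G K : jcont G -> jcont K -> jcont (fun s x => G s x + K s x).
Proof. by move=> cG cK p; apply: cvgD; [exact: cG|exact: cK]. Qed.

Lemma jcontN G : jcont G -> jcont (fun s x => - G s x).
Proof. by move=> cG p; apply: cvgN; exact: cG. Qed.

Lemma cone_intD T G K xi eta : jcont G -> jcont K ->
  cone_int T (fun s x => G s x + K s x) xi eta = cone_int T G xi eta + cone_int T K xi eta.
Proof.
move=> cG cK; rewrite /cone_int.
have -> : cone_up (fun s x => G s x + K s x) xi eta = fun s => cone_up G xi eta s + cone_up K xi eta s.
  by apply/funext => s; rewrite /cone_up sliceD//; exact: jcont_slice.
have -> : cone_down (fun s x => G s x + K s x) xi eta = fun s => cone_down G xi eta s + cone_down K xi eta s.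
  by apply/funext => s; rewrite /cone_down sliceD//; exact: jcont_slice.
have cu H := @cone_up_continuous H xi eta; have cd H := @cone_down_continuous H xi eta.
rewrite (Rint_add _ _ (cu G cG) (cu K cK)) (Rint_add _ _ (cd G cG) (cd K cK)).
exact: addrACA.
Qed.

Lemma cone_intN T G xi eta : jcont G ->
  cone_int T (fun s x => - G s x) xi eta = - cone_int T G xi eta.
Proof.
move=> cG; have := @cone_intD T G (fun s x => - G s x) xi eta cG (jcontN cG).
have -> : (fun s x => G s x + - G s x) = (fun _ _ => 0).
  by apply/funext => s; apply/funext => x; rewrite subrr.
have -> : cone_int T (fun _ _ => 0) xi eta = 0.
  have s0 (a b : R) : slice (fun=> 0) a b = 0 by rewrite /slice Rintegral_cst// mul0r.
  rewrite /cone_int /cone_up /cone_down.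
  by rewrite !(eq_Rintegral _ (g := cst 0)) ?Rintegral_cst ?mul0r ?addr0//; move=> s _; rewrite s0.
lra.
Qed.

(** With a common [T] the four cone integrals run over the same times, so the inequality is proved
    section by section. The sections differ only inside the null rectangle, where alone the sign of
    [G] is required. *)
Lemma cone_int_supermodular T G xi1 xi2 eta1 eta2 : jcont G -> xi1 <= xi2 -> eta1 <= eta2 ->
  (forall s x, xi1 <= x - s <= xi2 -> eta1 <= x + s <= eta2 -> 0 <= G s x) ->
  cone_int T G xi1 eta1 + cone_int T G xi2 eta2 <= cone_int T G xi1 eta2 + cone_int T G xi2 eta1.
Proof.
move=> cG x12 e12 G0.
have xs s : xi1 + s <= xi2 + s by rewrite lerD2r.
have es s : eta1 - s <= eta2 - s by rewrite lerD2r.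
have Gs s x : xi1 + s <= x <= xi2 + s -> eta1 - s <= x <= eta2 - s -> 0 <= G s x.
  by move=> h1 h2; apply: G0; lra.
have Gs' s x : eta1 - s <= x <= eta2 - s -> xi1 + s <= x <= xi2 + s -> 0 <= G s x.
  by move=> h1 h2; exact: Gs.
have num (u1 u2 u3 u4 d1 d2 d3 d4 : R) : u1 + u2 <= u3 + u4 -> d1 + d2 <= d3 + d4 ->
  (u1 + d1) + (u2 + d2) <= (u3 + d4) + (u4 + d3) by lra.
have cu xi eta := @cone_up_continuous G xi eta cG.
have cd xi eta := @cone_down_continuous G xi eta cG.
have U : \int[mu]_(s in `[0, T]) (cone_up G xi1 eta1 s + cone_up G xi2 eta2 s) <=
         \int[mu]_(s in `[0, T]) (cone_up G xi1 eta2 s + cone_up G xi2 eta1 s).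
  apply: Rint_le => [s|s|s]; [exact: cvgD (cu _ _ s) (cu _ _ s)|exact: cvgD (cu _ _ s) (cu _ _ s)|].
  by apply: slice_supermodular (xs s) (es s) (Gs s); exact: jcont_slice.
have D : \int[mu]_(s in `[- T, 0]) (cone_down G xi1 eta1 s + cone_down G xi2 eta2 s) <=
         \int[mu]_(s in `[- T, 0]) (cone_down G xi2 eta1 s + cone_down G xi1 eta2 s).
  apply: Rint_le => [s|s|s]; [exact: cvgD (cd _ _ s) (cd _ _ s)|exact: cvgD (cd _ _ s) (cd _ _ s)|].
  by apply: slice_supermodular (es s) (xs s) (Gs' s); exact: jcont_slice.
rewrite !(Rint_add _ _ (cu _ _) (cu _ _)) in U.
rewrite !(Rint_add _ _ (cd _ _) (cd _ _)) in D.
exact: num U D.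
Qed.

(** Supermodularity applied to the nonnegative sources [K + (G1 - G2)] and [K - (G1 - G2)]. *)
Lemma cone_int_compare T G1 G2 K xi1 xi2 eta1 eta2 : jcont G1 -> jcont G2 -> jcont K ->
  xi1 <= xi2 -> eta1 <= eta2 ->
  (forall s x, xi1 <= x - s <= xi2 -> eta1 <= x + s <= eta2 ->
     `|G1 s x - G2 s x| <= K s x) ->
  `| (cone_int T G1 xi1 eta1 + cone_int T G1 xi2 eta2 - cone_int T G1 xi1 eta2 - cone_int T G1 xi2 eta1)
   - (cone_int T G2 xi1 eta1 + cone_int T G2 xi2 eta2 - cone_int T G2 xi1 eta2 - cone_int T G2 xi2 eta1) |
  <= cone_int T K xi1 eta2 + cone_int T K xi2 eta1 - cone_int T K xi1 eta1 - cone_int T K xi2 eta2.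
Proof.
move=> c1 c2 cK x12 e12 H.
have num (a b : R) : `|a| <= b -> 0 <= b + a /\ 0 <= b - a.
  by rewrite ler_norml; lra.
have N1 s x : xi1 <= x - s <= xi2 -> eta1 <= x + s <= eta2 -> 0 <= K s x + (G1 s x - G2 s x).
  by move=> h1 h2; have [] := num _ _ (H s x h1 h2).
have N2 s x : xi1 <= x - s <= xi2 -> eta1 <= x + s <= eta2 -> 0 <= K s x + (G2 s x - G1 s x).
  by move=> h1 h2; have [] := num _ _ (H s x h1 h2); rewrite opprB.
have c12 := jcontD c1 (jcontN c2); have c21 := jcontD c2 (jcontN c1).
have P1 := @cone_int_supermodular T _ xi1 xi2 eta1 eta2 (jcontD cK c12) x12 e12.
have P2 := @cone_int_supermodular T _ xi1 xi2 eta1 eta2 (jcontD cK c21) x12 e12.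
rewrite !(cone_intD _ _ _ cK c12) !(cone_intD _ _ _ c1 (jcontN c2)) !(cone_intN _ _ _ c2) in P1.
rewrite !(cone_intD _ _ _ cK c21) !(cone_intD _ _ _ c2 (jcontN c1)) !(cone_intN _ _ _ c1) in P2.
have {}P1 := P1 N1; have {}P2 := P2 N2.
move: P1 P2.
move: (cone_int T K xi1 eta1) (cone_int T K xi1 eta2) (cone_int T K xi2 eta1) (cone_int T K xi2 eta2).
move: (cone_int T G1 xi1 eta1) (cone_int T G1 xi1 eta2) (cone_int T G1 xi2 eta1) (cone_int T G1 xi2 eta2).
move: (cone_int T G2 xi1 eta1) (cone_int T G2 xi1 eta2) (cone_int T G2 xi2 eta1) (cone_int T G2 xi2 eta2).
clear; move=> *; rewrite ler_norml; lra.
Qed.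

(** A section of [k''] integrates to a difference of values of [k'], and integrating in time gives
    [k]. The terms [k xi] and [k eta] drop out of second differences, leaving
    [- 2 k ((xi + eta) / 2)]. *)
Lemma cone_int_static T (k k' k'' : R -> R) xi eta :
  continuous (fun x => k'' (Num.max x 1)) ->
  (forall x, 1 <= x -> is_derive x 1 k (k' x)) ->
  (forall x, 1 <= x -> is_derive x 1 k' (k'' x)) ->
  1 <= xi -> 1 <= eta -> `|eta - xi| <= 2 * T ->
  cone_int T (fun _ x => k'' (Num.max x 1)) xi eta = k xi + k eta - 2 * k ((xi + eta) / 2).
Proof.
move=> ck dk dk' xi1 eta1; rewrite ler_norml => tT.
set G := fun (_ : R) (x : R) => k'' (Num.max x 1).
have cG : jcont G.
  by move=> p; apply: (@continuous_comp _ _ _ snd (fun x => k'' (Num.max x 1)) p); [exact: cvg_snd|exact: ck].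
have sl a b : 1 <= a -> a <= b -> slice (G 0) a b = k' b - k' a.
  move=> a1 ab; apply: Rint_FTC => // x /andP[ax xb].
  by rewrite /G max_l; [apply: dk'; lra|lra].
have dkc (c u z : R) : 1 <= c + u * z -> is_derive z 1 (fun s => k (c + u * s)) (u * k' (c + u * z)).
  by move=> h; apply: is_derive_comp_affine; exact: dk.
pose F (s : R) := - (k (eta + -1 * s) + k (xi + 1 * s)).
have dF s : 1 <= eta - s -> 1 <= xi + s -> is_derive s 1 F (k' (eta - s) - k' (xi + s)).
  move=> h1 h2.
  have h1' : 1 <= eta + -1 * s by lra.
  have h2' : 1 <= xi + 1 * s by lra.
  have D := is_deriveN (is_deriveD (dkc _ _ _ h1') (dkc _ _ _ h2')).
  by apply: (is_derive_eq D); rewrite !mulN1r !mul1r; lra.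
have [xe|/ltW xe] := leP xi eta.
- rewrite cone_int_pos//; last lra.
  set t := (eta - xi) / 2.
  have -> : \int[mu]_(s in `[0, t]) cone_up G xi eta s = F t - F 0.
    apply: Rint_FTC; first by rewrite /t; lra.
      exact: cone_up_continuous.
    move=> s /andP[s0 st]; rewrite /cone_up -[G s]/(G 0) sl; [|lra|rewrite /t in st; lra].
    by apply: dF; rewrite /t in st; lra.
  rewrite /F !mulN1r !mul1r oppr0 !addr0.
  have -> : eta - t = (xi + eta) / 2 by rewrite /t; lra.
  have -> : xi + t = (xi + eta) / 2 by rewrite /t; lra.
  by clear; lra.
- rewrite cone_int_neg//; last lra.
  set t := (eta - xi) / 2.
  have -> : \int[mu]_(s in `[t, 0]) cone_down G xi eta s = (- F) 0 - (- F) t.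
    apply: Rint_FTC; first by rewrite /t; lra.
      exact: cone_down_continuous.
    move=> s /andP[s0 st]; rewrite /cone_down -[G s]/(G 0) sl; [|rewrite /t in s0; lra|rewrite /t in s0; lra].
    have D : is_derive s 1 F (k' (eta - s) - k' (xi + s)) by apply: dF; rewrite /t in s0; lra.
    by apply: (is_derive_eq (is_deriveN D)); rewrite opprB.
  rewrite !fctE /F !mulN1r !mul1r oppr0 !addr0.
  have -> : eta - t = (xi + eta) / 2 by rewrite /t; lra.
  have -> : xi + t = (xi + eta) / 2 by rewrite /t; lra.
  by clear; lra.
Qed.

End DuhamelCone.

(** * The solution in the exterior region *)

Section Representation.
Context {R : realType} (m : nat) (hm : (2 < m)%N) (rho0 : R) (rho1 : 1 < rho0) (d : data R)
  (U : R -> data R) (hU : nlw_solution m rho0 d U).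
Local Notation mu := (@lebesgue_measure R).

(** [r u^(2m+1)] without the cutoff and frozen below [r = 1]. Unlike [source], which may jump at
    [r = rho0 + |t|], it is jointly continuous; both agree on the dependence cones of exterior
    points. *)
Definition Gsrc (t x : R) : R := Num.max x 1 * (U t).1 (Num.max x 1) ^+ (2 * m + 1).

Lemma Gsrc_jcont : jcont Gsrc.
Proof.
have cJ := nlw_joint_continuous hU.
have cm : continuous (fun p : R * R => Num.max p.2 1).
  by move=> p; apply: continuous_max; [exact: cvg_snd|exact: cvg_cst].
move=> p; apply: cvgM; first exact: cm.
elim: (2 * m + 1)%N => [|n IH]; first by under eq_fun do rewrite expr0; exact: cvg_cst.
by under eq_fun do rewrite exprS; rewrite exprS; apply: cvgM => //; exact: cJ.
Qed.

Lemma source_eq (s x : R) : rho0 + `|s| < x -> x * source m rho0 U s x = Gsrc s x.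
Proof.
move=> sx; have := normr_ge0 s => s0; have x1 : 1 <= x by have := rho1; lra.
rewrite /source /cutoff sx mulr1 /Gsrc max_l// exprM real_normK ?num_real//.
by rewrite -exprM addn1 exprSr.
Qed.

Lemma int_invsq_fin : (\int[mu]_(x in @Omega R) ((x ^+ 2)^-1)%:E < +oo)%E.
Proof.
rewrite /Omega.
rewrite (@ge0_continuous_FTC2y R (fun x : R => (x ^+ 2)^-1) (fun x => - x^-1) 1 0).
- by rewrite ltry.
- by move=> x _; rewrite invr_ge0 sqr_ge0.
- apply: continuous_in_subspaceT => x; rewrite inE/= in_itv/= andbT => x1.
  apply: cvgV; first by rewrite expf_neq0// gt_eqF//; lra.
  exact: exprn_continuous.
- rewrite -oppr0; apply: (@cvgN _ _ _ _ _ (fun x : R => x^-1) 0).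
  have P : \forall x \near +oo, 0 < (id x : R) by exact: nbhs_pinfty_gt.
  exact: (iffRL (gtr0_cvgV0 P) (@cvg_id _ _)).
- move=> x x1; have xn0 : x != 0 by rewrite gt_eqF//; lra.
  by have [] := is_deriveN (is_deriveV xn0 (is_derive_id x 1)).
- apply: cvg_at_right_filter; apply: cvgN; apply: cvgV => //; exact: cvg_id.
- move=> x; rewrite in_itv/= andbT => x1; have xn0 : x != 0 by rewrite gt_eqF//; lra.
  have [_] := is_deriveN (is_deriveV xn0 (is_derive_id x 1)).
  rewrite derive1E => ->.
  by rewrite /GRing.scale/= mulr1 opprK.
Unshelve. all: end_near. Qed.

(** [duhamel] describes [W s] only when the source at time [s] is in L^2. From [u^2 <= C / x], the
    integrand is at most [C^(2m+1) x^(1-2m)], and [1 - 2m <= -2]. *)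
Lemma source_inL2 (s : R) : inL2 (source m rho0 U s).
Proof.
have mO := @measurable_Omega R.
have cs := nlw_slice_continuous hU (t := s).
have ms : measurable_fun (@Omega R) (source m rho0 U s).
  have E : {in @Omega R, (fun x : R => `|(U s).1 (Num.max x 1)| ^+ (2 * m) *
       (U s).1 (Num.max x 1) * \1_(`](rho0 + `|s|)%R, +oo[%classic : set R) x) =1 source m rho0 U s}.
    move=> x; rewrite inE /Omega/= in_itv/= andbT => x1.
    rewrite /source /cutoff max_l// indicE; congr (_ * _%:R).
    by rewrite mem_setE in_itv/= andbT.
  apply: (eq_measurable_fun _ E).
  have mm : measurable_fun (@Omega R) (fun x => (U s).1 (Num.max x 1)).
    exact: continuous_measurable_on.
  apply: measurable_funM; last exact: measurable_indic.
  apply: measurable_funM => //; apply: measurable_funX.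
  exact: measurableT_comp.
split => //; have [C HC] := nlw_bound_at hU s.
rewrite /L2norm2 int3_wnorm2 lte_mul_pinfty ?lee_fin ?ltW ?pi4_gt0//.
have minv : measurable_fun (@Omega R) (fun x : R => ((x ^+ 2)^-1)%:E : \bar R).
  apply/measurable_EFinP.
  have E : {in @Omega R, (fun x : R => (Num.max x 1 ^+ 2)^-1) =1 (fun x : R => (x ^+ 2)^-1)}.
    by move=> x; rewrite inE /Omega/= in_itv/= andbT => x1; rewrite max_l.
  apply: (eq_measurable_fun _ E); apply: continuous_measurable_on => // x.
  apply: cvgV; first by rewrite expf_neq0// gt_eqF// lt_max ltr01 orbT.
  apply: (@continuous_pow _ (fun x : R => Num.max x 1)) => y.
  by apply: continuous_max; [exact: cvg_id|exact: cvg_cst].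
have C0 : 0 <= C by apply: le_trans (HC 1 (lexx _)); rewrite mulr1 sqr_ge0.
have Cn0 : 0 <= C ^+ (2 * m + 1) by rewrite exprn_ge0.
apply: (@le_lt_trans _ _ (\int[mu]_(x in @Omega R) ((C ^+ (2 * m + 1))%:E * ((x ^+ 2)^-1)%:E))%E).
  apply: ge0_le_integral => //.
  - by move=> x _; rewrite lee_fin mulr_ge0 ?sqr_ge0.
  - exact: measurable_wsq.
  - exact: measurable_funeM.
  - move=> x; rewrite /Omega/= in_itv/= andbT => x1; rewrite -EFinM lee_fin.
    rewrite /source /cutoff; case: (rho0 + `|s| < x); last first.
      by rewrite mulr0 expr0n/= mul0r mulr_ge0// invr_ge0 sqr_ge0.
    have x0 : 0 < x by lra.
    have u2 : (U s).1 x ^+ 2 <= C / x by rewrite ler_pdivlMr//; exact: HC.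
    rewrite mulr1 exprMn -exprM mulnC exprM real_normK ?num_real// -exprSr -[(2 * m).+1]addn1.
    apply: (@le_trans _ _ ((C / x) ^+ (2 * m + 1) * x ^+ 2)).
      by rewrite ler_wpM2r ?sqr_ge0// lerXn2r// nnegrE ?sqr_ge0// divr_ge0// ltW.
    rewrite expr_div_n -mulrA ler_wpM2l// mulrC ler_pdivrMr ?exprn_gt0//.
    rewrite mulrC ler_pdivlMr ?exprn_gt0// -exprD ler_weXn2l//.
    by move: hm; case: m => [|[|[|k]]]//; rewrite !mulnS.
rewrite ge0_integralZl_EFin//; last by move=> x _; rewrite lee_fin invr_ge0 sqr_ge0.
by rewrite lte_mul_pinfty ?lee_fin// int_invsq_fin.
Qed.

(** Finite speed of propagation: for [r > rho0 + |t|] the dependence cone stays in the exterior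
    region, where the cutoff is [1]. The factor [r] turns each [W s] into half a section integral of
    [Gsrc]. *)
Lemma nlw_representation (T t r : R) : rho0 + `|t| < r -> `|t| <= T ->
  r * (U t).1 r = ((r + t) * d.1 (r + t) + (r - t) * d.1 (r - t)) / 2
     + oint (r - t) (r + t) (fun s => s * d.2 s) / 2
     + cone_int T Gsrc (r - t) (r + t) / 2.
Proof.
move=> tr tT; have rho1' := rho1.
have [v [W [fv [fW Hd]]]] := nlw_duhamel hU.
have t0 := normr_ge0 t.
have [ht1 ht2] : - `|t| <= t /\ t <= `|t| by split; [rewrite lerNl -normrN ler_norm|rewrite ler_norm].
have r1 : 1 <= r by lra.
rewrite Hd// mulrDr (free_wave_dalembert fv); [|lra|lra].
congr (_ + _).
have cG := Gsrc_jcont.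
(* [|t - s| + |s| <= |t|] says that [s] lies between [0] and [t]; it keeps the characteristics of
   [W s] in [r > 1]. The first datum of [W s] is [0], so only the velocity integral remains. *)
have inner s : `|s| <= `|t| -> `|t - s| + `|s| <= `|t| ->
    r * (W s (t - s)).1 r = oint (r - (t - s)) (r + (t - s)) (fun x => x * source m rho0 U s x) / 2.
  move=> st ts.
  have [h1 h2] : - `|t - s| <= t - s /\ t - s <= `|t - s|.
    by split; [rewrite lerNl -normrN ler_norm|rewrite ler_norm].
  have s0 := normr_ge0 s.
  rewrite (free_wave_dalembert (fW s (source_inL2 s))); [|lra|lra].
  by rewrite !mulr0 addr0 mul0r add0r.
have sliceE s a b : rho0 + `|s| < a ->
   \int[mu]_(x in `[a, b]) (x * source m rho0 U s x) = slice (Gsrc s) a b.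
  move=> sa; apply: eq_Rintegral => x; rewrite inE/= in_itv/= => /andP[ax _].
  by apply: source_eq; lra.
have rn0 : r != 0 by rewrite gt_eqF//; lra.
have [tp|/ltW tn] := leP 0 t.
- rewrite cone_int_pos//; [|lra|rewrite ger0_norm// in tT; lra].
  have -> : (r + t - (r - t)) / 2 = t by lra.
  rewrite oint_ge//.
  have -> : \int[mu]_(s in `[0, t]) (W s (t - s)).1 r =
      \int[mu]_(s in `[0, t]) ((r^-1 / 2) * cone_up Gsrc (r - t) (r + t) s).
    apply: eq_Rintegral => s; rewrite inE/= in_itv/= => /andP[s0 st].
    have H : r * (W s (t - s)).1 r = cone_up Gsrc (r - t) (r + t) s / 2.
      have e1 : r - (t - s) = r - t + s by clear; ring.
      have e2 : r + (t - s) = r + t - s by clear; ring.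
      rewrite inner; [|rewrite !ger0_norm//|rewrite !ger0_norm ?subr_ge0//; lra].
      rewrite oint_ge; last lra.
      rewrite sliceE; last by rewrite ger0_norm// in tr; rewrite ger0_norm//; lra.
      by rewrite /cone_up e1 e2.
    by apply: (mulfI rn0); rewrite H; field.
  rewrite RintegralZl//; last by apply: continuous_integrable; exact: cone_up_continuous.
  by field.
- have tE : `|t| = - t by rewrite ler0_norm.
  rewrite cone_int_neg//; [|lra|lra].
  have -> : (r + t - (r - t)) / 2 = t by lra.
  rewrite oint_le//.
  have -> : \int[mu]_(s in `[t, 0]) (W s (t - s)).1 r =
      \int[mu]_(s in `[t, 0]) ((- r^-1 / 2) * cone_down Gsrc (r - t) (r + t) s).
    apply: eq_Rintegral => s; rewrite inE/= in_itv/= => /andP[s0 st].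
    have sE : `|s| = - s by rewrite ler0_norm.
    have tsE : `|t - s| = - (t - s) by rewrite ler0_norm// subr_le0.
    have H : r * (W s (t - s)).1 r = - cone_down Gsrc (r - t) (r + t) s / 2.
      have e1 : r - (t - s) = r - t + s by clear; ring.
      have e2 : r + (t - s) = r + t - s by clear; ring.
      rewrite inner; [|lra|lra].
      rewrite oint_le; last lra.
      rewrite sliceE; last lra.
      by rewrite /cone_down e1 e2.
    by apply: (mulfI rn0); rewrite H; field.
  rewrite RintegralZl//; last by apply: continuous_integrable; exact: cone_down_continuous.
  by field.
Qed.

End Representation.

(** * Limits along null directions *)

Section NullLimit.
Context {R : realType}.
Implicit Types (phi : R -> R -> R) (k : R -> R) (x y z rho e c X : R).

Definition rect phi x1 x2 y1 y2 : R := phi x1 y1 + phi x2 y2 - phi x1 y2 - phi x2 y1.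

Definition mid k x y : R := k ((x + y) / 2).

Definition decays k := forall e, 0 < e -> \forall x \near +oo, `|k x| <= e.

(** Integrated form of [|d_x d_y phi| <= k'' / 4]: [mid k] is the static function [k r] in null
    coordinates, with [d_x d_y (mid k) = k'' / 4]. *)
Definition rect_bounded rho phi k := forall x1 x2 y1 y2,
  rho < x1 -> x1 <= x2 -> rho < y1 -> y1 <= y2 ->
  `|rect phi x1 x2 y1 y2| <= rect (mid k) x1 x2 y1 y2.

Lemma near_pinfty_ex (P : R -> Prop) : (\forall x \near +oo, P x) ->
  exists X : R, forall x : R, X <= x -> P x.
Proof.
move=> [M [_ HM]]; exists (M + 1) => x Mx; apply: HM; lra.
Qed.

Lemma ex_near_pinfty (P : R -> Prop) X : (forall x : R, X <= x -> P x) ->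
  \forall x \near +oo, P x.
Proof. by move=> H; near=> x; apply: H; near: x; exact: nbhs_pinfty_ge (num_real _).
Unshelve. all: end_near. Qed.

Lemma decays_mid k x e : decays k -> 0 < e -> \forall y \near +oo, `|mid k x y| <= e.
Proof.
move=> dk e0; have [X HX] := near_pinfty_ex (dk e e0).
by apply: (@ex_near_pinfty _ (2 * X - x)) => y h; apply: HX; lra.
Qed.

Lemma le_of_near (a b : R) : (forall e, 0 < e -> a <= b + e) -> a <= b.
Proof. by move=> H; apply/ler_addgt0Pr => /= e; exact: H. Qed.

(* Comparing [phi x2 (y + c)] with [phi x2 y] through the vertical rectangle that
   ends on the diagonal [t = 0]. *)
Lemma edge_limit rho phi k x1 x2 e : rho < x1 -> x1 <= x2 -> decays k ->
  rect_bounded rho phi k ->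
  (forall c e, 0 <= c -> 0 < e -> \forall x \near +oo, `|phi x (x + c) - phi x x| <= e) ->
  (forall x c e, rho < x -> 0 <= c -> 0 < e ->
     \forall y \near +oo, `|phi (x + c) (y + c) - phi x y| <= e) ->
  0 < e -> \forall y \near +oo, `|phi x2 y - phi x1 y| <= e.
Proof.
move=> rx1 x12 dk H1 H2 H3 e0; pose c := x2 - x1.
have c0 : 0 <= c by rewrite /c; lra.
have e8 : 0 < e / 8 by rewrite divr_gt0.
have N1 := H2 c _ c0 e8; have N2 := H3 x1 c _ rx1 c0 e8.
have [X HX] := near_pinfty_ex (dk _ e8).
near=> y.
have h1 : `|phi y (y + c) - phi y y| <= e / 8 by near: y.
have h2 : `|phi (x1 + c) (y + c) - phi x1 y| <= e / 8 by near: y.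
have yx2 : x2 <= y by near: y; exact: nbhs_pinfty_ge (num_real _).
have yX : 2 * X - x2 <= y by near: y; exact: nbhs_pinfty_ge (num_real _).
have yX' : X <= y by near: y; exact: nbhs_pinfty_ge (num_real _).
have rx2 : rho < x2 by lra.
have ry : rho < y by lra.
have yyc : y <= y + c by lra.
have := H1 x2 y y (y + c) rx2 yx2 ry yyc.
have k1 : `|mid k x2 y| <= e / 8 by apply: HX; lra.
have k2 : `|mid k y (y + c)| <= e / 8 by apply: HX; lra.
have k3 : `|mid k x2 (y + c)| <= e / 8 by apply: HX; lra.
have k4 : `|mid k y y| <= e / 8 by apply: HX; lra.
have x2E : x1 + c = x2 by rewrite /c; ring.
rewrite x2E in h2.
move: h1 h2 k1 k2 k3 k4; rewrite /rect.
move: (phi y (y + c)) (phi y y) (phi x2 (y + c)) (phi x1 y) (phi x2 y) => p1 p2 p3 p4 p5.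
move: (mid k x2 y) (mid k y (y + c)) (mid k x2 (y + c)) (mid k y y) => q1 q2 q3 q4.
rewrite !ler_norml; clear; lra.
Unshelve. all: end_near. Qed.

(** Push the opposite edge of the rectangle to infinity, where its variation vanishes. Of the
    right-hand side there remains [mid k x1 y - mid k x2 y], and the last term is dropped by
    sign. *)
Lemma edge_bound rho phi k x1 x2 y : rho < x1 -> x1 <= x2 -> rho < y -> decays k ->
  (forall x, rho < x -> 0 <= k x) ->
  rect_bounded rho phi k ->
  (forall e, 0 < e -> \forall y \near +oo, `|phi x2 y - phi x1 y| <= e) ->
  `|phi x2 y - phi x1 y| <= mid k x1 y.
Proof.
move=> rx1 x12 ry dk k0 H1 H; apply: le_of_near => e e0.
have e4 : 0 < e / 4 by rewrite divr_gt0.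
have N1 := H _ e4; have N2 := decays_mid x1 dk e4; have N3 := decays_mid x2 dk e4.
have [z [yz z1 z2 z3]] : exists z, [/\ y <= z, `|phi x2 z - phi x1 z| <= e / 4,
    `|mid k x1 z| <= e / 4 & `|mid k x2 z| <= e / 4].
  have N4 : \forall z \near +oo, y <= z by exact: nbhs_pinfty_ge (num_real _).
  by have [z [[[? ?] ?] ?]] := filter_ex (filterI (filterI (filterI N4 N1) N2) N3); exists z.
have := H1 x1 x2 y z rx1 x12 ry yz; move: z1 z2 z3.
have : 0 <= mid k x2 y by apply: k0; lra.
rewrite /rect.
move: (phi x1 y) (phi x2 z) (phi x1 z) (phi x2 y) => p1 p2 p3 p4.
move: (mid k x1 y) (mid k x2 z) (mid k x1 z) (mid k x2 y) => q1 q2 q3 q4.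
rewrite !ler_norml; clear; lra.
Unshelve. all: end_near. Qed.

Lemma cauchy_seq_cvg (u : nat -> R) :
  (forall e, 0 < e -> exists N : nat, forall n, (N <= n)%N -> `|u n - u N| <= e) -> cvgn u.
Proof.
move=> H; apply/cauchy_cvgP/cauchy_ballP => e e0; near_simpl.
have e3 : 0 < e / 3 by rewrite divr_gt0.
have [N HN] := H _ e3.
exists ([set n | (N <= n)%N], [set n | (N <= n)%N]); first by split; exists N.
move=> [n p] [/= /HN h1 /HN h2]; rewrite /ball/=.
have := ler_distD (u N) (u n) (u p); rewrite (distrC (u N)); lra.
Qed.

(** Two edges join [(x, y)] to any point above and to the right of it, each costing at most
    [mid k x y]. The values on the diagonal are therefore Cauchy, and their limit inherits the
    bound. *)
Lemma null_limit rho phi k : 0 < rho -> decays k ->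
  (forall x, rho < x -> 0 <= k x) -> (forall x y, rho < x -> x <= y -> k y <= k x) ->
  (forall x1 x2 y, rho < x1 -> x1 <= x2 -> rho < y -> `|phi x2 y - phi x1 y| <= mid k x1 y) ->
  (forall x y1 y2, rho < x -> rho < y1 -> y1 <= y2 -> `|phi x y2 - phi x y1| <= mid k x y1) ->
  exists l : R, forall x y, rho < x -> rho < y -> `|phi x y - l| <= 2 * mid k x y.
Proof.
move=> rho0 dk k0 kmono E1 E2.
have D x y x' y' : rho < x -> rho < y -> x <= x' -> y <= y' ->
    `|phi x' y' - phi x y| <= 2 * mid k x y.
  move=> rx ry xx yy; have ry' : rho < y' by lra.
  have h1 := E1 x x' y' rx xx ry'; have h2 := E2 x y y' rx ry yy.
  have h3 : mid k x y' <= mid k x y by apply: kmono; lra.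
  rewrite (le_trans (ler_distD (phi x y') _ _))//; lra.
pose u (n : nat) : R := phi (rho + n.+1%:R) (rho + n.+1%:R).
have un (n : nat) : rho < rho + n.+1%:R by rewrite ltrDl ltr0n.
have cu : cvgn u.
  apply: cauchy_seq_cvg => e e0; have e2 : 0 < e / 2 by rewrite divr_gt0.
  have [X HX] := near_pinfty_ex (dk _ e2).
  exists (Num.truncn `|X|).+1 => n Nn.
  set N := (Num.truncn `|X|).+1 in Nn *.
  have XN : X <= N.+1%:R.
    have := truncnS_gt `|X|; rewrite -/N => h.
    by rewrite (le_trans (ler_norm _))// (le_trans (ltW h))// ler_nat.
  have NnR : N.+1%:R <= n.+1%:R :> R by rewrite ler_nat.
  have := D _ _ _ _ (un N) (un N) (_ : rho + N.+1%:R <= rho + n.+1%:R) (_ : rho + N.+1%:R <= rho + n.+1%:R).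
  rewrite lerD2l => /(_ NnR NnR); rewrite -/(u N) -/(u n) => h.
  have := HX ((rho + N.+1%:R + (rho + N.+1%:R)) / 2); rewrite -/(mid k _ _) => h2.
  have := ler_norm (mid k (rho + N.+1%:R) (rho + N.+1%:R)); move: h2 => /(_ ltac:(lra)).
  move: h; clear; lra.
pose l := limn u; exists l => x y rx ry.
apply: le_of_near => e e0.
have /cvgrPdist_le/(_ e e0) C := cu.
have [n [hn hx hy]] : exists n : nat, [/\ `|l - u n| <= e, x <= rho + n.+1%:R & y <= rho + n.+1%:R].
  have big (z : R) : \forall n \near \oo, z <= n%:R.
    exact: nbhs_infty_ger.
  have [n [[? hx] hy]] := filter_ex (filterI (filterI C (big x)) (big y)).
  have nn : n%:R <= n.+1%:R :> R by rewrite ler_nat.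
  by exists n; split => //; lra.
have := D x y (rho + n.+1%:R) (rho + n.+1%:R) rx ry hx hy.
rewrite -/(u n) => h; have := ler_distD (u n) (phi x y) l.
rewrite (distrC (phi x y) (u n)) (distrC (u n) l); move: h hn; clear; lra.
Qed.

End NullLimit.

(** * Stationary solutions *)

Section Picard.
Context {R : realType} (p : nat) (N : R -> R) (L M' l : R).
Context (L0 : 0 < L) (N_lip : forall a b : R, `|N a - N b| <= L * `|a - b|)
  (N_bound : forall a : R, `|N a| <= M').
Implicit Types (g h : R -> R) (y z Y lam c e : R).

Lemma N_continuous : continuous N.
Proof.
move=> a; apply/cvgrPdist_le => e e0.
have d0 : 0 < e / L by rewrite divr_gt0.
have C : \forall b \near a, `|a - b| <= e / L.
  by have /cvgrPdist_le/(_ _ d0) := @cvg_id _ (nbhs a).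
apply: filterS C => b ab; apply: le_trans (N_lip a b) _.
by rewrite mulrC -ler_pdivlMr.
Qed.

(* In the variable [y = 1/x] and with [f x = g (1/x)], the equation
   [f'' = - x^(-2m) N f] reads [(y g)'' = - y^p N g], [p = 2m - 3]. *)
Definition force g : R -> R := fun z => z ^+ p * N (g z).

Lemma force_continuous g : continuous g -> continuous (force g).
Proof.
move=> cg; apply: continuous_mul; first exact: exprn_continuous.
by move=> z; apply: continuous_comp; [exact: cg|exact: N_continuous].
Qed.

Definition dprim g : R -> R := prim (prim (force g)).

(** [(y g)'' = - force g], integrated twice with [y g] vanishing at [0] with slope [l], then divided
    by [y]. At [y = 0] the convention [0^-1 = 0] gives the correct value [l]; negative [y] are sent
    to [0]. *)
Definition picard_map g : R -> R := fun y => l - dprim g (Num.max y 0) / Num.max y 0.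

Lemma is_derive_dprim g y : continuous g -> is_derive y 1 (dprim g) (prim (force g) y).
Proof. by move=> cg; apply: is_derive_prim; exact/continuous_prim/force_continuous. Qed.

Lemma prim_ge0_bound (h hb Hb : R -> R) Y : continuous h -> 0 <= Y ->
  (forall y, 0 <= y <= Y -> is_derive y 1 Hb (hb y)) -> 0 <= Hb 0 ->
  (forall y, 0 <= y <= Y -> `|h y| <= hb y) -> `|prim h Y| <= Hb Y.
Proof.
move=> ch Y0 dH H0 B; rewrite ler_norml; apply/andP; split.
- have := @is_derive_le R (- Hb) (prim h) (fun y => - hb y) h 0 Y Y0 _ _ _.
  move=> /(_ (fun y hy => is_deriveN (dH y hy)) (fun y _ => is_derive_prim y ch)).
  have Q x : 0 <= x <= Y -> - hb x <= h x by move=> /B; rewrite ler_norml => /andP[].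
  by move=> /(_ Q); rewrite !fctE prim0; lra.
- have := @is_derive_le R (prim h) Hb h hb 0 Y Y0 (fun y _ => is_derive_prim y ch) dH _.
  have Q x : 0 <= x <= Y -> h x <= hb x by move=> /B; rewrite ler_norml => /andP[].
  by move=> /(_ Q); rewrite prim0; lra.
Qed.

(** At [0] the quotient is the difference quotient of [dprim g], whose derivative there is [0]. *)
Lemma picard_map_continuous g : continuous g -> continuous (picard_map g).
Proof.
move=> cg.
suff H : continuous (fun y => dprim g y / y).
  move=> y; apply: cvgB; first exact: cvg_cst.
  apply: (@continuous_comp _ _ _ (fun y : R => Num.max y 0) (fun y => dprim g y / y)); last exact: H.
  by apply: continuous_max; [exact: cvg_id|exact: cvg_cst].
move=> y; have [->|yn0] := eqVneq y 0.
  have /is_deriveP D := is_derive_dprim 0 cg.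
  apply/cvgrPdist_le => e e0; have [d d0 Hd] := D e e0.
  have C : \forall z \near (0 : R), `|z| < d.
    have /cvgrPdist_lt/(_ _ d0) := @cvg_id _ (nbhs (0 : R)).
    by apply: filterS => z; rewrite sub0r normrN.
  apply: filterS C => z zd; rewrite invr0 mulr0 sub0r normrN.
  have [->|zn0] := eqVneq z 0; first by rewrite invr0 mulr0 normr0 ltW.
  have := Hd z zd zn0; rewrite add0r prim0 /dprim prim0 !subr0.
  exact.
apply: cvgM; first exact: (is_derive_continuous (is_derive_dprim y cg)).
by apply: cvgV => //; exact: cvg_id.
Qed.

Lemma is_derive_exp_scale (k lam y : R) :
  is_derive y 1 (fun z => k * expR (lam * z)) (k * (lam * expR (lam * y))).
Proof.
have d1 := is_derive_comp_affine (@is_derive_expR R (0 + lam * y)).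
have := is_deriveZ k d1; rewrite /GRing.scale/= add0r.
have -> : k \*: (fun y0 : R => expR (0 + lam * y0)) = (fun z => k * expR (lam * z)).
  by apply/funext => z; rewrite /GRing.scale/= add0r.
by [].
Qed.

(** Exponentially weighted norm: integrating [exp (lam y)] once gains [1 / lam], which absorbs the
    Lipschitz constant, and the second integration is undone by the division by [y]. The factor
    [1/2] holds on every [[0, Y]], so the profile exists for all [x > 0] and not only near
    infinity. *)
Lemma picard_map_contract g h Y lam c : continuous g -> continuous h -> 0 < lam -> 0 <= Y -> 0 <= c ->
  2 * (L * Y ^+ p) <= lam ->
  (forall z, 0 <= z <= Y -> `|g z - h z| <= c * expR (lam * z)) ->
  forall y, 0 <= y <= Y -> `|picard_map g y - picard_map h y| <= c / 2 * expR (lam * y).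
Proof.
move=> cg ch lam0 Y0 c0 HL H y /andP[y0 yY].
have [->|yn0] := eqVneq y 0.
  rewrite /picard_map max_l// invr0 !mulr0 subrr normr0 expR0 mulr1; lra.
have {}y0 : 0 < y by rewrite lt_neqAle eq_sym yn0.
have cf := force_continuous cg; have cf' := force_continuous ch.
have cfd : continuous (fun z => force g z - force h z) by move=> z; apply: cvgB; [exact: cf|exact: cf'].
have b1 z : 0 <= z <= Y -> `|prim (fun z => force g z - force h z) z| <= c / 2 * expR (lam * z).
  move=> /andP[z0 zY].
  apply: (@prim_ge0_bound _ (fun w => c / 2 * (lam * expR (lam * w))) (fun w => c / 2 * expR (lam * w))) => //.
  - by move=> w _; exact: is_derive_exp_scale.
  - by rewrite mulr_ge0 ?expR_ge0// divr_ge0.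
  - move=> w /andP[w0 wz]; rewrite /force -mulrBr normrM.
    have wY : 0 <= w <= Y by rewrite w0 (le_trans wz).
    have wp : `|w ^+ p| <= Y ^+ p.
      by have /andP[_ wY'] := wY; rewrite ger0_norm ?exprn_ge0// lerXn2r.
    apply: (@le_trans _ _ (Y ^+ p * (L * (c * expR (lam * w))))).
      apply: ler_pM => //; apply: le_trans (N_lip _ _) _.
      by apply: ler_wpM2l; [exact: ltW|exact: H].
    have -> : Y ^+ p * (L * (c * expR (lam * w))) = (c / 2 * expR (lam * w)) * (2 * (L * Y ^+ p)) by field.
    have -> : c / 2 * (lam * expR (lam * w)) = (c / 2 * expR (lam * w)) * lam by ring.
    by rewrite ler_wpM2l// mulr_ge0 ?expR_ge0// divr_ge0.
have E : dprim g y - dprim h y = prim (prim (fun z => force g z - force h z)) y.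
  have psub (u v : R -> R) x : continuous u -> continuous v -> prim (fun z => u z - v z) x = prim u x - prim v x.
    move=> cu cv; have cuv : continuous (fun z => u z - v z) by move=> z; apply: cvgB; [exact: cu|exact: cv].
    have : (prim (fun z => u z - v z) - (prim u - prim v)) x = (prim (fun z => u z - v z) - (prim u - prim v)) 0.
      apply: is_derive_cst_between => z _.
      have D := is_deriveB (is_derive_prim z cuv) (is_deriveB (is_derive_prim z cu) (is_derive_prim z cv)).
      by apply: (is_derive_eq D); rewrite subrr.
    by rewrite !fctE !prim0; lra.
  rewrite /dprim -psub; [|exact: continuous_prim|exact: continuous_prim].
  by congr (prim _ y); apply/funext => z; rewrite psub.
have b2 : `|dprim g y - dprim h y| <= y * (c / 2 * expR (lam * y)).
  rewrite E mulrC.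
  have -> : c / 2 * expR (lam * y) * y = 0 + c / 2 * expR (lam * y) * y by rewrite add0r.
  apply: (@prim_ge0_bound _ (fun=> c / 2 * expR (lam * y)) (fun z => 0 + c / 2 * expR (lam * y) * z)).
  - exact: continuous_prim.
  - exact: ltW.
  - by move=> z _; exact: is_derive_affine.
  - by rewrite mulr0 addr0.
  - move=> z /andP[z0 zy]; apply: le_trans (b1 z _) _; first by rewrite z0 (le_trans zy).
    by rewrite ler_wpM2l ?divr_ge0// ler_expR ler_pM2l.
rewrite /picard_map max_l ?(ltW y0)//.
have -> : l - dprim g y / y - (l - dprim h y / y) = - ((dprim g y - dprim h y) / y) by field.
by rewrite normrN normrM normfV (gtr0_norm y0) ler_pdivrMr// mulrC.
Qed.

Lemma M'_ge0 : 0 <= M'.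
Proof. exact: le_trans (N_bound 0). Qed.

Lemma force_prim_bound g y : continuous g -> 0 <= y -> `|prim (force g) y| <= M' * y ^+ p.+1.
Proof.
move=> cg y0; have M0 := M'_ge0.
have -> : M' * y ^+ p.+1 = 0 + M' * y ^+ p * y by rewrite exprSr add0r mulrA.
apply: (@prim_ge0_bound _ (fun=> M' * y ^+ p) (fun z => 0 + M' * y ^+ p * z)) => //.
- exact: force_continuous.
- by move=> z _; exact: is_derive_affine.
- by rewrite mulr0 addr0.
- move=> z /andP[z0 zy]; rewrite /force normrM mulrC; apply: ler_pM => //.
  by rewrite ger0_norm ?exprn_ge0// lerXn2r.
Qed.

Lemma dprim_bound g y : continuous g -> 0 <= y -> `|dprim g y| <= M' * y ^+ p.+2.
Proof.
move=> cg y0; have M0 := M'_ge0.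
have -> : M' * y ^+ p.+2 = 0 + M' * y ^+ p.+1 * y by rewrite [in LHS]exprSr add0r mulrA.
apply: (@prim_ge0_bound _ (fun=> M' * y ^+ p.+1) (fun z => 0 + M' * y ^+ p.+1 * z)) => //.
- exact/continuous_prim/force_continuous.
- by move=> z _; exact: is_derive_affine.
- by rewrite mulr0 addr0.
- move=> z /andP[z0 zy]; apply: le_trans (force_prim_bound cg z0) _.
  by rewrite ler_wpM2l// lerXn2r.
Qed.

Definition picard_it (n : nat) : R -> R := iter n picard_map (fun=> l).

Lemma picard_it_continuous n : continuous (picard_it n).
Proof. by elim: n => [|n IH]; [move=> z; exact: cvg_cst|exact: picard_map_continuous]. Qed.

Lemma picard_map_max g y : picard_map g y = picard_map g (Num.max y 0).
Proof.
have m0 : 0 <= Num.max y 0 by rewrite le_max lexx orbT.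
by rewrite /picard_map (max_l m0).
Qed.

Lemma picard_it_max n y : picard_it n y = picard_it n (Num.max y 0).
Proof. by case: n => // n; exact: picard_map_max. Qed.

Lemma halves_small (K e : R) : 0 <= K -> 0 < e -> exists n : nat, K / 2 ^+ n <= e.
Proof.
move=> K0 e0; exists (Num.truncn (K / e)).+1.
set n := (Num.truncn (K / e)).+1.
rewrite ler_pdivrMr ?exprn_gt0// mulrC -ler_pdivrMr//.
apply: le_trans (ltW (truncnS_gt _)) _; rewrite -/n.
by rewrite -natrX ler_nat ltnW// ltn_expl.
Qed.

Lemma picard_it_step Y lam n : 0 <= Y -> 0 < lam -> 2 * (L * Y ^+ p) <= lam ->
  forall y, 0 <= y <= Y ->
  `|picard_it n.+1 y - picard_it n y| <= M' * Y ^+ p.+1 / 2 ^+ n * expR (lam * y).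
Proof.
move=> Y0 lam0 HL; have M0 := M'_ge0; elim: n => [|n IH] y yY.
- rewrite expr0 divr1 /picard_it /= /picard_map.
  have /andP[y0 yY'] := yY; rewrite max_l//.
  set D := dprim _ _; have -> : l - D / y - l = - (D / y) by ring.
  rewrite normrN; apply: (@le_trans _ _ (M' * Y ^+ p.+1)); last first.
    rewrite ler_peMr ?mulr_ge0 ?exprn_ge0//.
    by rewrite -expR0 ler_expR mulr_ge0// ltW.
  have [->|yn0] := eqVneq y 0; first by rewrite invr0 mulr0 normr0 mulr_ge0// exprn_ge0.
  have yp : 0 < y by rewrite lt_neqAle eq_sym yn0.
  rewrite normrM normfV (gtr0_norm yp) ler_pdivrMr//.
  apply: le_trans (dprim_bound (fun z => cvg_cst _) y0) _.
  rewrite exprSr mulrA ler_wpM2r// ler_wpM2l// lerXn2r//.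
- have -> : M' * Y ^+ p.+1 / 2 ^+ n.+1 = M' * Y ^+ p.+1 / 2 ^+ n / 2 by rewrite [2 ^+ n.+1]exprSr invfM mulrA.
  apply: (@picard_map_contract (picard_it n.+1) (picard_it n) Y lam) => //;
    [exact: picard_it_continuous|exact: picard_it_continuous|].
  by rewrite divr_ge0 ?exprn_ge0// mulr_ge0// exprn_ge0.
Qed.

Lemma picard_it_cauchy Y lam n j : 0 <= Y -> 0 < lam -> 2 * (L * Y ^+ p) <= lam ->
  forall y, y <= Y ->
  `|picard_it (n + j) y - picard_it n y| <= 2 * (M' * Y ^+ p.+1 * expR (lam * Y)) / 2 ^+ n.
Proof.
move=> Y0 lam0 HL; have M0 := M'_ge0.
set E := M' * Y ^+ p.+1 * expR (lam * Y).
have E0 : 0 <= E by rewrite mulr_ge0 ?expR_ge0// mulr_ge0// exprn_ge0.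
have st k y : 0 <= y <= Y -> `|picard_it k.+1 y - picard_it k y| <= E / 2 ^+ k.
  move=> yY; apply: le_trans (picard_it_step k Y0 lam0 HL yY) _.
  rewrite /E mulrAC ler_wpM2r ?invr_ge0 ?exprn_ge0//.
  rewrite ler_wpM2l ?mulr_ge0 ?exprn_ge0// ler_expR ler_pM2l//; by case/andP: yY.
have tele y : 0 <= y <= Y ->
   `|picard_it (n + j) y - picard_it n y| <= 2 * E / 2 ^+ n * (1 - (2 ^+ j)^-1).
  move=> yY; elim: j => [|j IH]; first by rewrite addn0 subrr normr0 expr0 invr1 subrr mulr0.
  rewrite addnS; apply: le_trans (ler_distD (picard_it (n + j) y) _ _) _.
  apply: le_trans (lerD (st _ _ yY) IH) _.
  rewrite le_eqVlt; apply/orP; left; apply/eqP.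
  by rewrite exprD exprS; field; rewrite !expf_neq0.
move=> y yY; rewrite (picard_it_max (n + j)) (picard_it_max n).
have mY : 0 <= Num.max y 0 <= Y by rewrite le_max lexx orbT ge_max yY.
apply: le_trans (tele _ mY) _; by rewrite ler_piMr ?divr_ge0 ?mulr_ge0 ?exprn_ge0// gerBl invr_ge0 exprn_ge0.
Qed.

(** The iterates converge uniformly on each half-line [y <= Y], with [lam] depending on [Y]; local
    uniformity gives continuity of the limit. *)
Lemma picard_fixpoint : exists2 g, continuous g & forall y, g y = picard_map g y.
Proof.
have M0 := M'_ge0; pose g y : R := limn (fun n => picard_it n y).
pose lam Y := 2 * (L * Y ^+ p) + 1.
pose K Y := 2 * (M' * Y ^+ p.+1 * expR (lam Y * Y)).
have lam0 Y : 0 <= Y -> 0 < lam Y.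
  by move=> Y0; rewrite /lam ltr_wpDl// !mulr_ge0 ?exprn_ge0// ltW.
have K0 Y : 0 <= Y -> 0 <= K Y.
  by move=> Y0; rewrite /K !mulr_ge0 ?expR_ge0 ?exprn_ge0.
have H n j Y y : 0 <= Y -> y <= Y -> `|picard_it (n + j) y - picard_it n y| <= K Y / 2 ^+ n.
  move=> Y0 yY; apply: picard_it_cauchy => //; first exact: lam0.
  by rewrite /lam lerDl.
have cv y : cvgn (fun n => picard_it n y).
  apply: cauchy_seq_cvg => e e0; have [n Hn] := halves_small (K0 `|y| (normr_ge0 y)) e0.
  exists n => k nk; apply: le_trans Hn.
  by rewrite -(subnKC nk); apply: H => //; exact: ler_norm.
have B n Y y : 0 <= Y -> y <= Y -> `|g y - picard_it n y| <= K Y / 2 ^+ n.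
  move=> Y0 yY; apply: le_of_near => e e0.
  have /cvgrPdist_le/(_ e e0) C := cv y.
  have C2 : \forall k \near \oo, (n <= k)%N by exact: nbhs_infty_ge.
  have [k [h1 nk]] := filter_ex (filterI C C2).
  have := H n (k - n)%N Y y Y0 yY; rewrite subnKC// => h2.
  have := ler_distD (picard_it k y) (g y) (picard_it n y).
  rewrite /g; move: h1 h2; clear; lra.
have cg : continuous g.
  move=> y; apply/cvgrPdist_le => e e0.
  have e3 : 0 < e / 3 by rewrite divr_gt0.
  have Y0 : 0 <= `|y| + 1 by rewrite addr_ge0.
  have [n Hn] := halves_small (K0 _ Y0) e3.
  have /cvgrPdist_le/(_ _ e3) C := @picard_it_continuous n y.
  have C2 : \forall z \near y, z <= `|y| + 1.
    by apply: lt_le_nbhsl; have := ler_norm y; lra.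
  have yY : y <= `|y| + 1 by have := ler_norm y; lra.
  near=> z; have h1 : `|picard_it n y - picard_it n z| <= e / 3 by near: z.
  have h2 : z <= `|y| + 1 by near: z.
  have b1 := le_trans (B n _ _ Y0 yY) Hn; have b2 := le_trans (B n _ _ Y0 h2) Hn.
  have t1 := ler_distD (picard_it n y) (g y) (g z).
  have t2 := ler_distD (picard_it n z) (picard_it n y) (g z).
  rewrite (distrC (picard_it n z)) in t2.
  move: h1 b1 b2 t1 t2; clear; lra.
exists g => // y.
have gmax z : g z = g (Num.max z 0).
  by rewrite /g; congr (limn _); apply/funext => n; exact: picard_it_max.
rewrite gmax picard_map_max; have : 0 <= Num.max y 0 by rewrite le_max lexx orbT.
move: (Num.max y 0) => Y Y0.
apply/eqP; rewrite -subr_eq0; apply/eqP.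
apply: (@small_le _ _ (2 * expR (lam Y * Y))); first by rewrite mulr_ge0 ?expR_ge0.
(* [g] and [picard_map g] are both within order [2^(-n)] of the iterate of index [n + 1]. *)
move=> e e0 _; have [n Hn] := halves_small (K0 _ Y0) e0.
have b1 := B n.+1 Y Y Y0 (lexx _).
have b2 : `|picard_map (picard_it n) Y - picard_map g Y| <= K Y / 2 ^+ n / 2 * expR (lam Y * Y).
  apply: (@picard_map_contract _ _ Y) => //.
  - exact: picard_it_continuous.
  - exact: lam0.
  - by rewrite divr_ge0 ?exprn_ge0// K0.
  - by rewrite /lam lerDl.
  - move=> z /andP[z0 zY]; rewrite distrC; apply: le_trans (B n Y z Y0 zY) _.
    rewrite ler_peMr ?divr_ge0 ?exprn_ge0 ?K0//.
    by rewrite -expR0 ler_expR mulr_ge0// ltW// lam0.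
  - by rewrite Y0 lexx.
have E1 : 1 <= expR (lam Y * Y) by rewrite -expR0 ler_expR mulr_ge0// ltW// lam0.
have b3 : K Y / 2 ^+ n.+1 <= e.
  apply: le_trans Hn; rewrite ler_wpM2l ?K0// lef_pV2 ?posrE ?exprn_gt0//.
  by rewrite ler_weXn2l// ler1n.
have b4 : K Y / 2 ^+ n / 2 * expR (lam Y * Y) <= e * expR (lam Y * Y).
  rewrite ler_wpM2r ?expR_ge0//; move: Hn e0 (K0 _ Y0); clear; lra.
have b1' : `|g Y - picard_map (picard_it n) Y| <= e := le_trans b1 b3.
apply: le_trans (ler_distD (picard_map (picard_it n) Y) _ _) _.
apply: le_trans (lerD b1' (le_trans b2 b4)) _.
have eE : e <= e * expR (lam Y * Y) by rewrite ler_peMr// ltW.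
have -> : 2 * expR (lam Y * Y) * e = e * expR (lam Y * Y) + e * expR (lam Y * Y) by ring.
by rewrite lerD2r.
Unshelve. all: end_near. Qed.

End Picard.

(** * The static profile and its a priori bound *)

Section Profile.
Context {R : realType}.
Implicit Types (a b v w x y M l : R) (m n : nat).

Lemma powdiff_bound M a b n : `|a| <= M -> `|b| <= M ->
  `|a ^+ n.+1 - b ^+ n.+1| <= n.+1%:R * M ^+ n * `|a - b|.
Proof.
move=> aM bM; have M0 : 0 <= M := le_trans (normr_ge0 _) aM.
elim: n => [|n IH]; first by rewrite !expr1 expr0 mulr1 mul1r.
have -> : a ^+ n.+2 - b ^+ n.+2 = a * (a ^+ n.+1 - b ^+ n.+1) + b ^+ n.+1 * (a - b).
  by rewrite !(exprS _ n.+1); ring.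
apply: le_trans (ler_normD _ _) _; rewrite !normrM.
have h1 : `|a| * `|a ^+ n.+1 - b ^+ n.+1| <= M * (n.+1%:R * M ^+ n * `|a - b|).
  exact: ler_pM.
have h2 : `|b ^+ n.+1| * `|a - b| <= M ^+ n.+1 * `|a - b|.
  by rewrite ler_wpM2r// normrX lerXn2r// nnegrE.
apply: le_trans (lerD h1 h2) _.
rewrite le_eqVlt; apply/orP; left; apply/eqP.
by rewrite -[n.+2%:R]natr1 exprS; ring.
Qed.

Lemma mul_sq_half (a b c w : R) : a * b = 1 ->
  a * ((2 * w) ^+ 2 * (b * c)) / 2 = 2 * w ^+ 2 * c.
Proof. by move=> ab; transitivity ((a * b) * (2 * w ^+ 2 * c)); [lra|rewrite ab mul1r]. Qed.

Definition clamp M v : R := if v < - M then - M else if M < v then M else v.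

Lemma clamp_bound M v : 0 <= M -> `|clamp M v| <= M.
Proof.
move=> M0; by rewrite ler_norml /clamp; case: (ltP v (- M)) => h1; case: (ltP M v) => h2; lra.
Qed.

Lemma clamp_id M v : `|v| <= M -> clamp M v = v.
Proof. by rewrite ler_norml /clamp => /andP[h1 h2]; rewrite ltNge h1/= ltNge h2. Qed.

Lemma clampN M v : 0 <= M -> clamp M (- v) = - clamp M v.
Proof.
by move=> M0; rewrite /clamp; case: (ltP v (- M)) => h1; case: (ltP M v) => h2;
  case: (ltP (- v) (- M)) => h3; case: (ltP M (- v)) => h4; lra.
Qed.

Lemma clamp_lip M v w : 0 <= M -> `|clamp M v - clamp M w| <= `|v - w|.
Proof.
move=> M0; wlog vw : v w / v <= w.
  by move=> H; have [|/ltW] := leP v w; [exact: H|rewrite distrC (distrC v); exact: H].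
rewrite (distrC v) (distrC (clamp M v)) (ger0_norm (_ : 0 <= w - v)) ?subr_ge0//.
by rewrite ler_norml /clamp; case: (ltP v (- M)) => h1; case: (ltP M v) => h2;
  case: (ltP w (- M)) => h3; case: (ltP M w) => h4; lra.
Qed.

Lemma is_derive_inv_comp (h : R -> R) x dh : x != 0 -> is_derive x^-1 1 h dh ->
  is_derive x 1 (fun z => h z^-1) (- (x ^- 2 * dh)).
Proof.
move=> xn0 Dh; have Dv : is_derive x 1 (fun z : R => z^-1) (- x ^- 2).
  have := is_deriveV xn0 (is_derive_id x 1) => D.
  by apply: (is_derive_eq D); rewrite /GRing.scale/= mulr1.
rewrite -mulNr mulrC; exact: (@is_derive1_comp R h (fun z : R => z^-1) x _ _ Dh Dv).
Qed.

Lemma is_derive_pow (h : R -> R) x dh n : is_derive x 1 h dh ->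
  is_derive x 1 (fun z => h z ^+ n.+1) (n.+1%:R * h x ^+ n * dh).
Proof.
move=> Dh; elim: n => [|n IH].
  have -> : (fun z => h z ^+ 1) = h by apply/funext => z; rewrite expr1.
  by rewrite expr0 !mul1r.
have -> : (fun z => h z ^+ n.+2) = h * (fun z => h z ^+ n.+1).
  by apply/funext => z; rewrite fctE exprS.
apply: (is_derive_eq (is_deriveM Dh IH)).
by rewrite /GRing.scale/= -[n.+2%:R]natr1 exprS; ring.
Qed.

Context (m : nat) (hm : (2 < m)%N) (l : R) (l0 : l != 0).
Let M : R := `|l|.
(* The truncation makes the nonlinearity globally Lipschitz; it is removed by the
   a priori bound [|f| <= |l|]. *)
Let N v := clamp M v ^+ (2 * m + 1).
Let M' : R := M ^+ (2 * m + 1).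
Let p := (2 * m - 3)%N.

Let M_gt0 : 0 < M. Proof. by rewrite normr_gt0. Qed.
Let M'_gt0 : 0 < M'. Proof. exact: exprn_gt0. Qed.
Let pm : (p + 3 = 2 * m)%N. Proof. by rewrite /p subnK//; move: hm; case: m => [|[|[|k]]]//; rewrite !mulnS. Qed.

Let N_lip a b : `|N a - N b| <= ((2 * m + 1)%:R * M ^+ (2 * m)) * `|a - b|.
Proof.
rewrite /N addn1; apply: le_trans (powdiff_bound _ (clamp_bound a (ltW M_gt0)) (clamp_bound b (ltW M_gt0))) _.
rewrite ler_wpM2l ?clamp_lip// ltW//.
by rewrite mulr_gt0// ?exprn_gt0.
Qed.

Let N_bd a : `|N a| <= M'.
Proof.
have M0 := ltW M_gt0; have h := clamp_bound a M0.
by rewrite /N normrX; apply: lerXn2r; rewrite ?nnegrE.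
Qed.

Let NN v : N (- v) = - N v.
Proof. by rewrite /N clampN ?ltW// exprNn -signr_odd addn1/= oddM/= mulN1r. Qed.

Let N_cont : continuous N.
Proof.
apply: (@N_continuous _ N _ _ N_lip).
by rewrite mulr_gt0// ?exprn_gt0// ltr0n addn1.
Qed.

Let V := prim N.

Let VN v : V (- v) = V v.
Proof.
have H : (fun v => V (0 + -1 * v) - V v) v = (fun v => V (0 + -1 * v) - V v) 0.
  apply: (@is_derive_cst_between R (fun v => V (0 + -1 * v) - V v) 0 v) => z _.
  have D1 := is_derive_comp_affine (is_derive_prim (0 + -1 * z) N_cont).
  have D := is_deriveB D1 (is_derive_prim z N_cont).
  by apply: (is_derive_eq D); rewrite !mulN1r add0r NN; ring.
by move: H; rewrite /= !mulN1r !add0r oppr0 subrr => /eqP; rewrite subr_eq0 => /eqP.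
Qed.

(** [V] is even and has constant slope [M' > 0] beyond [M]. This converts [V (f x) <= V l] into
    [|f x| <= |l|]. *)
Let V_above v : M < `|v| -> V l < V v.
Proof.
have H w : M < w -> V M < V w.
  move=> Mw.
  have := @is_derive_le R (fun y => 0 + M' * y) V (fun=> M') N M w (ltW Mw)
    (fun y _ => is_derive_affine _ _ _) (fun y _ => is_derive_prim y N_cont) _.
  have Q y : M <= y <= w -> M' <= N y.
    move=> /andP[My _]; rewrite /N /clamp.
    have M0 := M_gt0; case: (ltP y (- M)) => h1; first lra.
    by case: (ltP M y) => h2; [exact: lexx|rewrite lerXn2r// nnegrE; lra].
  move=> /(_ Q); have := mulr_gt0 M'_gt0 (_ : 0 < w - M); rewrite subr_gt0 => /(_ Mw).
  rewrite mulrBr; lra.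
have VM : V l = V M.
  by rewrite /M; have [?|?] := leP 0 l; [rewrite ger0_norm|rewrite ltr0_norm// VN].
move=> Mv; rewrite VM; have := H _ Mv.
by have [?|?] := leP 0 v; [rewrite ger0_norm|rewrite ltr0_norm// VN].
Qed.

Let V_lip v w : `|V v - V w| <= M' * `|v - w|.
Proof.
have [c _ ->] := @MVT_between R V N w v (fun y _ => is_derive_prim y N_cont).
by rewrite normrM ler_wpM2r// N_bd.
Qed.

Lemma profile_exists_nz : exists f f' : R -> R,
  [/\ forall x, 0 < x -> is_derive x 1 f (f' x),
      forall x, 0 < x -> is_derive x 1 f' (- (f x ^+ (2 * m + 1) / x ^+ (2 * m))),
      forall x, 0 < x -> `|f x| <= `|l|
    & exists C : R, forall x, 1 <= x -> `|f x - l| <= C / x ^+ 2 /\ `|f' x| <= C / x ^+ 2].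
Proof.
have L0 : 0 < (2 * m + 1)%:R * M ^+ (2 * m) by rewrite mulr_gt0// ?exprn_gt0// ltr0n addn1.
have [g cg gE] := @picard_fixpoint R p N _ M' l L0 N_lip N_bd.
pose A := prim (force p N g); pose D := dprim p N g.
(* [g] is only known to be continuous; the fixed-point equation rewrites [g (1/x)] as an expression
   that can be differentiated twice. *)
pose f x := l - x * D x^-1; pose f' x := x^-1 * A x^-1 - D x^-1.
have fE x : 0 < x -> f x = g x^-1.
  move=> x0; have xi0 : 0 < x^-1 by rewrite invr_gt0.
  by rewrite gE /picard_map max_l ?ltW// invrK mulrC.
have dA y : is_derive y 1 A (force p N g y).
  by apply: is_derive_prim; exact: (@force_continuous R p N _ L0 N_lip g cg).
have dD y : is_derive y 1 D (A y).
  exact: (@is_derive_dprim R p N _ L0 N_lip g y cg).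
have df x : 0 < x -> is_derive x 1 f (f' x).
  move=> x0; have xn0 : x != 0 by rewrite gt_eqF.
  have D1 := is_deriveB (is_derive_cst l x 1) (is_deriveM (is_derive_id x 1) (is_derive_inv_comp xn0 (dD x^-1))).
  apply: (is_derive_eq D1); rewrite /GRing.scale/= /f'; field; exact: xn0.
have df' x : 0 < x -> is_derive x 1 f' (- (N (f x) / x ^+ (2 * m))).
  move=> x0; have xn0 : x != 0 by rewrite gt_eqF.
  have D2 := is_derive_inv_comp xn0 (is_derive_id x^-1 1).
  have D1 := is_deriveB (is_deriveM D2 (is_derive_inv_comp xn0 (dA x^-1))) (is_derive_inv_comp xn0 (dD x^-1)).
  apply: (is_derive_eq D1); rewrite /GRing.scale/= /force -fE// -pm exprD exprVn.
  by field; rewrite expf_neq0 ?xn0.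
have yle x : 1 <= x -> 0 <= x^-1 <= 1.
  by move=> x1; rewrite invr_ge0 invf_le1; lra.
have bA y : 0 <= y -> `|A y| <= M' * y ^+ p.+1.
  by move=> y0; exact: (@force_prim_bound R p N _ M' L0 N_lip N_bd g y cg y0).
have bD y : 0 <= y -> `|D y| <= M' * y ^+ p.+2.
  by move=> y0; exact: (@dprim_bound R p N _ M' L0 N_lip N_bd g y cg y0).
have M'0 := ltW M'_gt0.
have bf' x : 1 <= x -> `|f' x| <= 2 * M' * x^-1 ^+ p.+2.
  move=> x1; have /andP[y0 y1] := yle x x1; rewrite /f'.
  apply: le_trans (ler_normB _ _) _.
  have h1 : `|x^-1 * A x^-1| <= M' * x^-1 ^+ p.+2.
    by rewrite normrM (ger0_norm y0) [_ ^+ p.+2]exprS mulrCA ler_wpM2l// bA.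
  have -> : 2 * M' * x^-1 ^+ p.+2 = M' * x^-1 ^+ p.+2 + M' * x^-1 ^+ p.+2 by ring.
  exact: lerD h1 (bD _ y0).
have pw x k j : 1 <= x -> (j <= k)%N -> x^-1 ^+ k <= (x ^+ j)^-1.
  by move=> x1 jk; have /andP[y0 y1] := yle x x1; rewrite -exprVn ler_wiXn2l.
have bfl x : 1 <= x -> `|f x - l| <= M' / x ^+ 2.
  move=> x1; have /andP[y0 y1] := yle x x1; have x0 : 0 < x by lra.
  have -> : f x - l = - (x * D x^-1) by rewrite /f; ring.
  rewrite normrN normrM (gtr0_norm x0).
  apply: (@le_trans _ _ (x * (M' * x^-1 ^+ p.+2))); first by apply: ler_wpM2l; [exact: ltW|exact: bD].
  rewrite exprS mulrCA (mulrA x) divff ?gt_eqF// mul1r ler_wpM2l//.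
  by apply: pw => //; rewrite /p; move: hm; case: m => [|[|[|k]]]//; rewrite !mulnS.
(* [E] is nondecreasing and tends to [V l] at infinity, whence [V (f x) <= V l]. *)
pose E x := x ^+ (2 * m) * f' x ^+ 2 / 2 + V (f x).
have [q qE] : exists q, (2 * m = q.+1)%N by exists (2 * m).-1; rewrite prednK//; move: hm; case: m.
(* The equation [x^(2m) f'' = - N f] cancels the derivative of [V (f x)], leaving only that of the
   weight [x^(2m)]. *)
have dE x : 0 < x -> is_derive x 1 E (q.+1%:R * x ^+ q * f' x ^+ 2 / 2).
  move=> x0; have xn0 : x != 0 by rewrite gt_eqF.
  have D1 := is_derive_pow q (is_derive_id x 1).
  have D2 := is_derive_pow 1 (df' x x0).
  have D3 : is_derive x 1 (fun z => V (f z)) (N (f x) * f' x).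
    exact: (@is_derive1_comp R V f x _ _ (is_derive_prim (f x) N_cont) (df x x0)).
  have D4 := is_deriveD (is_deriveZ (2^-1) (is_deriveM D1 D2)) D3.
  have EE : E = 2^-1 \*: ((fun z : R => z ^+ q.+1) * (fun z => f' z ^+ 2)) + (fun z => V (f z)).
    by apply/funext => z; rewrite /E !fctE /GRing.scale/= qE mulrC.
  rewrite EE; apply: (is_derive_eq D4); rewrite /GRing.scale/= !expr1 qE exprS.
  by field; rewrite expf_neq0// xn0.
have Emono x X : 0 < x -> x <= X -> E x <= E X.
  move=> x0 xX; apply: (ge0_is_derive_le xX (f' := fun x => q.+1%:R * x ^+ q * f' x ^+ 2 / 2)).
    by move=> z /andP[xz _]; apply: dE; lra.
  move=> z /andP[xz _]; rewrite divr_ge0// mulr_ge0 ?sqr_ge0// mulr_ge0// exprn_ge0//; lra.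
have EX X : 1 <= X -> E X <= V l + (3 * M' ^+ 2) / X.
  move=> X1; have /andP[y0 y1] := yle X X1; have X0 : 0 < X by lra.
  have h1 : X ^+ (2 * m) * f' X ^+ 2 / 2 <= 2 * M' ^+ 2 / X.
    have h : f' X ^+ 2 <= (2 * M' * X^-1 ^+ p.+2) ^+ 2.
      rewrite -(real_normK (num_real (f' X))) lerXn2r ?nnegrE//; last exact: bf'.
      by apply: mulr_ge0; [apply: mulr_ge0|exact: exprn_ge0].
    apply: (@le_trans _ _ (X ^+ (2 * m) * (2 * M' * X^-1 ^+ p.+2) ^+ 2 / 2)).
      by rewrite ler_wpM2r//; apply: ler_wpM2l => //; apply: exprn_ge0; exact: ltW.
    have -> : X ^+ (2 * m) * (2 * M' * X^-1 ^+ p.+2) ^+ 2 / 2 = 2 * M' ^+ 2 * X^-1 ^+ p.+1.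
      have XX k : X ^+ k * X^-1 ^+ k = 1 by rewrite -exprMn divff ?gt_eqF// expr1n.
      rewrite exprMn.
      (* [2 (p + 2) = (p + 3) + (p + 1)] with [p + 3 = 2m]: the weight is absorbed and [p + 1]
         powers of decay remain. *)
      have -> : X^-1 ^+ p.+2 ^+ 2 = X^-1 ^+ (p + 3) * X^-1 ^+ p.+1.
        by rewrite -exprM -exprD; congr (_ ^+ _); rewrite muln2 -addnn !addnS !addSn addn0.
      by rewrite -pm; apply: mul_sq_half; exact: XX.
    rewrite ler_wpM2l ?mulr_ge0 ?sqr_ge0// exprS ler_piMr// exprn_ile1//.
  have h2 : V (f X) <= V l + M' ^+ 2 / X.
    have := le_trans (V_lip (f X) l) (ler_wpM2l M'0 (bfl X X1)).
    have h3 : M' * (M' / X ^+ 2) <= M' ^+ 2 / X.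
      rewrite mulrA -expr2 ler_wpM2l ?sqr_ge0// lef_pV2 ?posrE ?exprn_gt0//.
      by rewrite expr2 ler_peMr// ltW.
    by rewrite ler_norml => /andP[_]; move: h3; lra.
  rewrite /E; have -> : 3 * M' ^+ 2 / X = 2 * M' ^+ 2 / X + M' ^+ 2 / X by ring.
  by move: h1 h2; lra.
have fbound x : 0 < x -> `|f x| <= M.
  move=> x0; rewrite leNgt; apply/negP => /V_above; apply/negP; rewrite -leNgt.
  have Vx : V (f x) <= E x.
    by rewrite /E lerDr divr_ge0// mulr_ge0 ?sqr_ge0// exprn_ge0// ltW.
  apply: le_of_near => e e0.
  pose X := Num.max (Num.max x 1) (3 * M' ^+ 2 / e).
  have X1 : 1 <= X by rewrite !le_max lexx orbT.
  have Xx : x <= X by rewrite !le_max lexx.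
  have Xe : 3 * M' ^+ 2 / X <= e.
    have X0 : 0 < X by lra.
    by rewrite ler_pdivrMr// [e * X]mulrC -ler_pdivrMr// le_max lexx orbT.
  apply: le_trans Vx _; apply: le_trans (Emono x X x0 Xx) _.
  by apply: le_trans (EX X X1) _; rewrite lerD2l.
exists f, f'; split => //.
- move=> x x0; have := df' x x0; rewrite /N clamp_id//; exact: fbound.
- exists (2 * M') => x x1; split.
    apply: le_trans (bfl x x1) _; rewrite ler_wpM2r ?invr_ge0 ?sqr_ge0//.
    by move: M'0; lra.
  apply: le_trans (bf' x x1) _; rewrite ler_wpM2l ?mulr_ge0//.
  exact: pw.
Qed.

End Profile.

(** Includes [l = 0], since the limit of [phi] may vanish; the profile is then zero. *)
Lemma profile_exists (R : realType) (m : nat) (l : R) : (2 < m)%N -> exists f f' : R -> R,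
  [/\ forall x : R, 0 < x -> is_derive x 1 f (f' x),
      forall x : R, 0 < x -> is_derive x 1 f' (- (f x ^+ (2 * m + 1) / x ^+ (2 * m))),
      forall x : R, 0 < x -> `|f x| <= `|l|
    & exists C : R, forall x : R, 1 <= x -> `|f x - l| <= C / x ^+ 2 /\ `|f' x| <= C / x ^+ 2].
Proof.
move=> hm; have [->|l0] := eqVneq l 0; last exact: profile_exists_nz.
exists (cst 0), (cst 0); split.
- by move=> x _; exact: is_derive_cst.
- by move=> x _; rewrite /= addn1 expr0n/= mul0r oppr0; exact: is_derive_cst.
- by move=> x _; rewrite /= normr0.
- by exists 0 => x _; rewrite /= subrr normr0 mul0r.
Qed.

(** * Comparison with powers *)

Section Comparison.
Context {R : realType}.
Implicit Types (f g h k : R -> R) (G : R -> R -> R) (a b c e r s t x y T xi eta rho : R).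
Local Notation mu := (@lebesgue_measure R).

Lemma Rint_le_on h k a b : continuous h -> continuous k ->
  (forall x, a <= x <= b -> h x <= k x) ->
  \int[mu]_(x in `[a, b]) h x <= \int[mu]_(x in `[a, b]) k x.
Proof.
move=> ch ck H; apply: le_Rintegral; [exact: measurable_itv|exact: continuous_integrable|exact: continuous_integrable|].
by move=> x /=; rewrite in_itv/=; exact: H.
Qed.

Lemma cone_int_mono T G1 G2 xi eta rho : jcont G1 -> jcont G2 -> rho < xi -> rho < eta ->
  (forall s x, rho + `|s| < x -> G1 s x <= G2 s x) ->
  cone_int T G1 xi eta <= cone_int T G2 xi eta.
Proof.
move=> c1 c2 rx re H; rewrite /cone_int; apply: lerD; apply: Rint_le_on.
- exact: cone_up_continuous.
- exact: cone_up_continuous.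
- move=> s /andP[s0 _]; apply: Rint_le_on; [exact: jcont_slice|exact: jcont_slice|].
  by move=> x /andP[h1 _]; apply: H; rewrite ger0_norm//; lra.
- exact: cone_down_continuous.
- exact: cone_down_continuous.
- move=> s /andP[_ s0]; apply: Rint_le_on; [exact: jcont_slice|exact: jcont_slice|].
  by move=> x /andP[h1 _]; apply: H; rewrite ler0_norm//; lra.
Qed.

(** [x^(-n/2)]: integer indices suffice, as the decay starts at order [1/2] and improves by
    [1/2]. *)
Definition qpow (n : nat) x : R := (Num.sqrt x)^-1 ^+ n.

Lemma qpow_ge0 n x : 0 <= qpow n x.
Proof. by rewrite exprn_ge0// invr_ge0 sqrtr_ge0. Qed.

Lemma qpow_add n p x : qpow (n + p) x = qpow n x * qpow p x.
Proof. exact: exprD. Qed.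

Lemma qpow_even n x : 0 <= x -> qpow (2 * n) x = (x ^+ n)^-1.
Proof. by move=> x0; rewrite /qpow exprM exprVn sqr_sqrtr// exprVn. Qed.

Lemma sqrt_ge1 x : 1 <= x -> 0 <= (Num.sqrt x)^-1 <= 1.
Proof.
move=> x1; rewrite invr_ge0 sqrtr_ge0/= invf_le1 ?sqrtr_gt0; last lra.
by rewrite -[1]sqrtr1 ler_sqrt//; lra.
Qed.

Lemma qpow_le n p x : 1 <= x -> (n <= p)%N -> qpow p x <= qpow n x.
Proof. by move=> /sqrt_ge1/andP[h0 h1] np; exact: ler_wiXn2l. Qed.

Lemma qpow_le1 n x : 1 <= x -> qpow n x <= 1.
Proof. by move=> x1; have := qpow_le x1 (leq0n n); rewrite {2}/qpow expr0. Qed.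

Lemma qpow_noninc n x y : 0 < x -> x <= y -> qpow n y <= qpow n x.
Proof.
move=> x0 xy; have y0 : 0 < y by lra.
apply: lerXn2r; rewrite ?nnegrE ?invr_ge0 ?sqrtr_ge0//.
by rewrite lef_pV2 ?posrE ?sqrtr_gt0// ler_sqrt// ltW.
Qed.

Lemma is_derive_qpow n x : 0 < x ->
  is_derive x 1 (qpow n) (- (n%:R / 2 * qpow n.+2 x)).
Proof.
move=> x0; case: n => [|n].
  have -> : qpow 0 = cst 1 by apply/funext => y; rewrite /qpow expr0.
  by rewrite mul0r mul0r oppr0; exact: is_derive_cst.
have sn0 : Num.sqrt x != 0 by rewrite gt_eqF// sqrtr_gt0.
have D1 := is_deriveV sn0 (is_derive1_sqrt x0).
have D := is_derive_pow n D1.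
apply: (is_derive_eq D); rewrite /qpow /GRing.scale/= -!exprVn invfM !exprS expr0.
by move: (_^-1) (_ ^+ n) => u v; field.
Qed.

Lemma is_derive_qpow_scale c n x : 0 < x ->
  is_derive x 1 (fun y => c * qpow n y) (- (c * n%:R / 2) * qpow n.+2 x).
Proof.
move=> x0; have D := is_deriveZ c (is_derive_qpow n x0).
by apply: (is_derive_eq D); rewrite /GRing.scale/=; ring.
Qed.

Lemma qpow_max_continuous c n : continuous (fun x : R => c * qpow n (Num.max x 1)).
Proof.
move=> x; apply: (@continuous_comp _ _ _ (fun x : R => Num.max x 1) (fun y => c * qpow n y)).
  by apply: continuous_max; [exact: cvg_id|exact: cvg_cst].
have m0 : 0 < Num.max x 1 by rewrite lt_max ltr01 orbT.
exact: (is_derive_continuous (is_derive_qpow_scale c n m0)).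
Qed.

Lemma qpow_decays c n : decays (fun x => c * qpow n.+1 x).
Proof.
move=> e e0; pose z := (`|c| + 1) / e.
have z0 : 0 < z by rewrite divr_gt0// ltr_wpDl.
apply: (@ex_near_pinfty R _ (Num.max 1 (z ^+ 2))) => x; rewrite ge_max => /andP[x1 xz].
have sz : z <= Num.sqrt x.
  by rewrite -(ger0_norm (ltW z0)) -sqrtr_sqr ler_sqrt//; lra.
have h1 : `|qpow n.+1 x| <= z^-1.
  rewrite ger0_norm ?qpow_ge0//; apply: le_trans (qpow_le x1 (_ : 1 <= n.+1)%N) _ => //.
  by rewrite /qpow expr1 lef_pV2 ?posrE// (lt_le_trans z0).
rewrite normrM; apply: (@le_trans _ _ ((`|c| + 1) * z^-1)).
  by apply: ler_pM => //; lra.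
by rewrite /z invf_div mulrC divfK// gt_eqF// ltr_wpDl.
Qed.

(* Send [x2] and [y2] to infinity in the bound on second differences. *)
Lemma corner_bound rho (delta : R -> R -> R) k kap x y : rho < x -> rho < y ->
  rect_bounded rho delta k -> decays k -> decays kap ->
  (forall x y, rho < x -> rho < y -> `|delta x y| <= mid kap x y) ->
  `|delta x y| <= mid k x y.
Proof.
move=> rx ry H dk dkap B; apply: le_of_near => e e0.
have e8 : 0 < e / 8 by rewrite divr_gt0.
have [X HX] := near_pinfty_ex (dk _ e8); have [X' HX'] := near_pinfty_ex (dkap _ e8).
pose z := `|x| + `|y| + 2 * `|X| + 2 * `|X'|.
have z_ge : - `|x| - `|y| <= z.
  by rewrite /z; have := normr_ge0 X; have := normr_ge0 X'; have := normr_ge0 x; have := normr_ge0 y; lra.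
have zx : x <= z /\ y <= z.
  by rewrite /z; have := ler_norm x; have := ler_norm y; have := normr_ge0 X; have := normr_ge0 X';
    have := normr_ge0 x; have := normr_ge0 y; lra.
have big u : - `|x| - `|y| <= u -> X <= (u + z) / 2 /\ X' <= (u + z) / 2.
  by rewrite /z; have := ler_norm X; have := ler_norm X'; have := normr_ge0 X; have := normr_ge0 X'; lra.
have [xz yz] := zx.
have [b1 b1'] : X <= (x + z) / 2 /\ X' <= (x + z) / 2.
  by apply: big; rewrite lerBlDr; have := ler_norm (- x); rewrite normrN; have := normr_ge0 y; lra.
have [b2 b2'] : X <= (z + y) / 2 /\ X' <= (z + y) / 2.
  by rewrite (addrC z); apply: big; have := ler_norm (- y); rewrite normrN; have := normr_ge0 x; lra.
have [b3 b3'] : X <= (z + z) / 2 /\ X' <= (z + z) / 2.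
  exact: big.
have rz : rho < z by lra.
have := H x z y z rx xz ry yz; rewrite /rect.
have := HX _ b1; have := HX _ b2; have := HX _ b3.
have := le_trans (B x z rx rz) (le_trans (ler_norm _) (HX' _ b1')).
have := le_trans (B z y rz ry) (le_trans (ler_norm _) (HX' _ b2')).
have := le_trans (B z z rz rz) (le_trans (ler_norm _) (HX' _ b3')).
rewrite -/(mid k x z) -/(mid k z y) -/(mid k z z).
move: (delta x y) (delta x z) (delta z y) (delta z z) (mid k x y) (mid k x z) (mid k z y) (mid k z z).
clear; move=> d1 d2 d3 d4 k1 k2 k3 k4; rewrite !ler_norml; lra.
Qed.

(** The velocity is only square integrable, so additivity rests on the integrability of [s * h s] on
    bounded intervals. *)
Lemma oint_sub h c a b : 1 <= c -> c <= a -> c <= b ->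
  measurable_fun (@Omega R) h -> (wnorm2 (@Omega R) h < +oo)%E ->
  oint a b (fun s => s * h s) = oint c b (fun s => s * h s) - oint c a (fun s => s * h s).
Proof.
move=> c1; move=> ca cb mh hoo.
have mO := @measurable_Omega R.
have ii x y : c <= x -> x <= y -> mu.-integrable `[x, y] (EFin \o (fun r => r * h r)).
  move=> cx xy; have sub : `[x, y] `<=` @Omega R.
    by move=> r /=; rewrite /Omega /= !in_itv/= andbT => /andP[? _]; lra.
  have fu : wnorm2 (@Omega R) h \is a fin_num by rewrite ge0_fin_numE ?wnorm2_ge0.
  have x0 : 0 <= x by lra.
  have [||//] := @wint_bound R x y h (fine (wnorm2 (@Omega R) h)) x0 xy.
    exact: measurable_funS sub mh.
  by rewrite fineK//; exact: wnorm2_subset.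
have sp x y : c <= x -> x <= y ->
    \int[mu]_(r in `[c, y]) (r * h r) = \int[mu]_(r in `[c, x]) (r * h r) + \int[mu]_(r in `[x, y]) (r * h r).
  move=> cx xy; have cy : c <= y by lra.
  have := @Rintegral_itvB R (fun r => r * h r) (BLeft c) (BRight y) x (ii c y (lexx _) cy).
  rewrite !bnd_simp => /(_ cx xy).
  rewrite Rintegral_itv_obnd_cbnd; last first.
    apply: (integrableS _ _ _ (ii x y cx xy)) => //; exact: subset_itv_oc_cc.
  lra.
rewrite !(oint_ge _ ca) !(oint_ge _ cb).
have [ab|/ltW ba] := leP a b; first by rewrite oint_ge// (sp a b ca ab); lra.
by rewrite oint_le// (sp b a cb ba); lra.
Qed.

End Comparison.

(** * The solution in null coordinates *)

Section NullCoordinates.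
Context {R : realType} (m : nat) (hm : (2 < m)%N) (rho0 : R) (rho1 : 1 < rho0) (d : data R)
  (hd : inH d) (U : R -> data R) (hU : nlw_solution m rho0 d U).
Local Notation mu := (@lebesgue_measure R).
Local Notation G := (Gsrc m U).

(* [r u(t, r)] in the null coordinates [xi = r - t], [eta = r + t]. *)
Definition null_profile (xi eta : R) : R :=
  (xi + eta) / 2 * (U ((eta - xi) / 2)).1 ((xi + eta) / 2).
Local Notation phi := null_profile.

Lemma null_coords (xi eta : R) : rho0 < xi -> rho0 < eta ->
  rho0 + `|(eta - xi) / 2| < (xi + eta) / 2.
Proof.
move=> h1 h2; have [t0|t0] := leP 0 ((eta - xi) / 2).
  by rewrite ger0_norm//; lra.
by rewrite ltr0_norm//; lra.
Qed.

(** Basing the velocity integral at [rho0] splits it into a function of [eta] minus a function of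
    [xi]. *)
Lemma phi_representation (T xi eta : R) : rho0 < xi -> rho0 < eta -> `|eta - xi| <= 2 * T ->
  phi xi eta = (eta * d.1 eta + xi * d.1 xi) / 2
    + (oint rho0 eta (fun s => s * d.2 s) - oint rho0 xi (fun s => s * d.2 s)) / 2
    + cone_int T G xi eta / 2.
Proof.
move=> h1 h2 hT; have rho1' := rho1.
have tT : `|(eta - xi) / 2| <= T by rewrite normrM [`|2^-1|]ger0_norm ?invr_ge0//; lra.
rewrite /null_profile (nlw_representation hm rho1 hU (null_coords h1 h2) tT).
have -> : (xi + eta) / 2 + (eta - xi) / 2 = eta by field.
have -> : (xi + eta) / 2 - (eta - xi) / 2 = xi by field.
by rewrite (@oint_sub R d.2 rho0 xi eta) ?(ltW rho1) ?(ltW h1) ?(ltW h2)//; [case: hd => _ []|exact: inL2_fin hd.2].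
Qed.

Lemma Gsrc_phi (s x : R) : rho0 + `|s| < x ->
  G s x = phi (x - s) (x + s) ^+ (2 * m + 1) / x ^+ (2 * m).
Proof.
move=> sx; have x1 : 1 <= x by have := normr_ge0 s; have := rho1; lra.
have xn0 : x != 0 by rewrite gt_eqF//; lra.
rewrite /Gsrc /null_profile max_l//.
have -> : (x - s + (x + s)) / 2 = x by field.
have -> : (x + s - (x - s)) / 2 = s by field.
rewrite exprMn; move: (_ ^+ (2 * m + 1)) => v; rewrite exprD expr1.
have := expf_neq0 (2 * m) xn0; move: (x ^+ (2 * m)) => w w0; by field.
Qed.

(* The free part of [phi] is a function of [xi] plus a function of [eta], so second
   differences of [phi] only see the source. *)
Lemma compare_static (f f' f'' k k' k'' : R -> R) :
  continuous (fun x : R => f'' (Num.max x 1)) -> continuous (fun x : R => k'' (Num.max x 1)) ->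
  (forall x : R, 1 <= x -> is_derive x 1 f (f' x)) ->
  (forall x : R, 1 <= x -> is_derive x 1 f' (f'' x)) ->
  (forall x : R, 1 <= x -> is_derive x 1 k (k' x)) ->
  (forall x : R, 1 <= x -> is_derive x 1 k' (k'' x)) ->
  (forall s x : R, rho0 + `|s| < x -> `|G s x + f'' x| <= k'' x) ->
  rect_bounded rho0 (fun x y => phi x y - mid f x y) k.
Proof.
move=> cf ck df df' dk dk' H x1 x2 y1 y2 rx1 x12 ry1 y12.
have rho1' := rho1.
have rx2 : rho0 < x2 by lra.
have ry2 : rho0 < y2 by lra.
(* One time bound serves all four vertices, as the comparison of cone integrals requires. *)
pose T := x2 + y2.
have hT x y : rho0 < x -> x <= x2 -> rho0 < y -> y <= y2 -> `|y - x| <= 2 * T.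
  by move=> *; rewrite ler_norml /T; lra.
pose G2 := (fun s x : R => - f'' (Num.max x 1)).
pose K := (fun s x : R => k'' (Num.max x 1)).
have jst (h : R -> R) : continuous h -> jcont (fun _ : R => h).
  by move=> ch p; apply: (@continuous_comp _ _ _ (fun p : R * R => p.2) h); [exact: cvg_snd|exact: ch].
have jG2' : jcont (fun _ x : R => f'' (Num.max x 1)) by exact: jst.
have jG2 : jcont G2 by exact: (jcontN jG2').
have jK : jcont K by exact: jst.
have cmp : forall s x : R, x1 <= x - s <= x2 -> y1 <= x + s <= y2 -> `|G s x - G2 s x| <= K s x.
  move=> s x /andP[a1 _] /andP[a2 _].
  have sx : rho0 + `|s| < x.
    by have [s0|s0] := leP 0 s; rewrite ?(ger0_norm s0) ?(ltr0_norm s0); lra.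
  have xm : Num.max x 1 = x by rewrite max_l//; have := normr_ge0 s; lra.
  by rewrite /G2 /K opprK xm; exact: H.
have := cone_int_compare T (Gsrc_jcont hU) jG2 jK x12 y12 cmp.
have sG x y : rho0 < x -> x <= x2 -> rho0 < y -> y <= y2 ->
    cone_int T G2 x y = - (f x + f y - 2 * mid f x y).
  move=> h1 h2 h3 h4; rewrite /G2 (cone_intN T x y jG2'); congr (- _).
  by apply: cone_int_static => //; [lra|lra|exact: hT].
have sK x y : rho0 < x -> x <= x2 -> rho0 < y -> y <= y2 ->
    cone_int T K x y = k x + k y - 2 * mid k x y.
  by move=> h1 h2 h3 h4; apply: cone_int_static => //; [lra|lra|exact: hT].
rewrite !sG// !sK// /rect.
rewrite (@phi_representation T x1 y1)//; last exact: hT.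
rewrite (@phi_representation T x2 y2)//; last exact: hT.
rewrite (@phi_representation T x1 y2)//; last exact: hT.
rewrite (@phi_representation T x2 y1)//; last exact: hT.
move: (cone_int T G x1 y1) (cone_int T G x2 y2) (cone_int T G x1 y2) (cone_int T G x2 y1) => d1 d2 d3 d4.
move: (mid f x1 y1) (mid f x2 y2) (mid f x1 y2) (mid f x2 y1) => f1 f2 f3 f4.
move: (mid k x1 y1) (mid k x2 y2) (mid k x1 y2) (mid k x2 y1) => k1 k2 k3 k4.
rewrite !ler_norml => /andP[g1 g2]; apply/andP; split; lra.
Qed.

(** The second derivative of [qpow n.+1] is [(n + 1) (n + 3) / 4] times [qpow (n.+1 + 4)]; the
    constant is the inverse of this factor, and its decay in [n] drives the final contraction. *)
Lemma compare_qpow (f f' f'' : R -> R) (c : R) (n : nat) :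
  continuous (fun x : R => f'' (Num.max x 1)) ->
  (forall x : R, 1 <= x -> is_derive x 1 f (f' x)) ->
  (forall x : R, 1 <= x -> is_derive x 1 f' (f'' x)) ->
  (forall s x : R, rho0 + `|s| < x -> `|G s x + f'' x| <= c * qpow (n.+1 + 4) x) ->
  rect_bounded rho0 (fun x y => phi x y - mid f x y)
    (fun x => c * 4 / (n.+1%:R * n.+3%:R) * qpow n.+1 x).
Proof.
move=> cf df df' H; set C := c * 4 / _.
have dk (x : R) : 1 <= x ->
    is_derive x 1 (fun x => C * qpow n.+1 x) (- (C * n.+1%:R / 2) * qpow n.+3 x).
  by move=> x1; apply: is_derive_qpow_scale; lra.
have dk' (x : R) : 1 <= x -> is_derive x 1 (fun x => - (C * n.+1%:R / 2) * qpow n.+3 x)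
    (c * qpow (n.+1 + 4) x).
  move=> x1; have x0 : 0 < x by lra.
  apply: (is_derive_eq (is_derive_qpow_scale (- (C * n.+1%:R / 2)) n.+3 x0)).
  have -> : n.+3.+2 = (n.+1 + 4)%N by rewrite !addnS addn0.
  congr (_ * _); rewrite /C; field.
  have n0 : 0 <= n%:R :> R by exact: ler0n.
  by apply/andP; split; rewrite gt_eqF//; lra.
exact: (compare_static cf (@qpow_max_continuous R c (n.+1 + 4)) df df' dk dk' H).
Qed.

Context (Ep Em : \bar R)
    (hEp : exterior_energy rho0 U t @[t --> +oo] --> Ep)
    (hEm : exterior_energy rho0 U t @[t --> -oo] --> Em)
    (hE : (Ep + Em = 0)%E).

(** [|u| <= C x^(-1/2)] gives a source of order [x^(1 - (2m+1)/2)], at most [x^(-5/2)] because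
    [2m - 1 >= 5]. *)
Lemma Gsrc_bound : exists2 K : R, 0 <= K &
  forall s x : R, rho0 + `|s| < x -> `|G s x| <= K * qpow 5 x.
Proof.
have [C C0 HC] := nlw_bound rho1 hU hEp hEm hE.
exists (Num.sqrt C ^+ (2 * m + 1)); first by rewrite exprn_ge0 ?sqrtr_ge0.
move=> s x sx; have x1 : 1 <= x by have := normr_ge0 s; have := rho1; lra.
have x0 : 0 < x by lra.
have sx0 : 0 < Num.sqrt x by rewrite sqrtr_gt0.
rewrite /Gsrc max_l//.
have hu : `|(U s).1 x| <= Num.sqrt C * qpow 1 x.
  rewrite /qpow expr1 ler_pdivlMr// -[leLHS]ger0_norm ?mulr_ge0 ?sqrtr_ge0//.
  rewrite -sqrtr_sqr ler_sqrt ?(ltW C0)// exprMn sqr_sqrtr ?(ltW x0)// real_normK ?num_real//.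
  exact: HC _ _ (ltW sx).
rewrite normrM (ger0_norm (ltW x0)) normrX.
have h : `|(U s).1 x| ^+ (2 * m + 1) <= (Num.sqrt C * qpow 1 x) ^+ (2 * m + 1).
  by rewrite lerXn2r// nnegrE ?mulr_ge0 ?sqrtr_ge0 ?qpow_ge0.
apply: le_trans (ler_wpM2l (ltW x0) h) _.
rewrite exprMn mulrCA ler_wpM2l ?exprn_ge0 ?sqrtr_ge0//.
have -> : (2 * m + 1 = 2 * 1 + (2 * m - 1))%N by move: hm; lia.
rewrite exprD {1}/qpow expr1 -/(qpow (2 * 1) x) qpow_even ?(ltW x0)// expr1 mulVKf ?gt_eqF//.
rewrite -[(Num.sqrt x)^-1 ^+ _]/(qpow _ _) qpow_le//.
by move: hm; lia.
Qed.

(** Comparison with the zero static function at [n = 0], whence the constant [4 / (1 * 3)]. *)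
Lemma phi_rect_bounded : exists2 K : R, 0 <= K & rect_bounded rho0 phi (fun x => K * qpow 1 x).
Proof.
have [K K0 HK] := Gsrc_bound; exists (K * 4 / (1 * 3)); first by rewrite !divr_ge0// ?mulr_ge0.
have H0 (x : R) : 1 <= x -> is_derive x 1 (cst 0 : R -> R) ((cst 0 : R -> R) x).
  by move=> _; exact: is_derive_cst.
have := @compare_qpow (cst 0) (cst 0) (cst 0) K 0 (fun x => cvg_cst _) H0 H0.
have -> : (fun x y : R => phi x y - mid (cst 0) x y) = phi.
  by apply/funext => x; apply/funext => y; rewrite /mid/= subr0.
by apply=> s x sx; rewrite addr0; exact: HK.
Qed.

(* A shift at fixed [t]: the exterior energy tends to [0] as [|t| --> oo]. *)
Lemma phi_shift_decay (x c e : R) : rho0 < x -> 0 <= c -> 0 < e ->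
  \forall y \near +oo, `|phi (x + c) (y + c) - phi x y| <= e /\ `|phi (y + c) (x + c) - phi y x| <= e.
Proof.
move=> rx c0 e0; have rho1' := rho1.
pose D := 4 * (c + c ^+ 2) + 1.
have D0 : 0 < D by rewrite /D ltr_wpDl// mulr_ge0// addr_ge0 ?sqr_ge0.
have e1 : 0 < e ^+ 2 / D by rewrite divr_gt0// exprn_gt0.
have [T HT] := exterior_grad_small rho1 hU hEp hEm hE e1.
apply: (@ex_near_pinfty _ _ (`|x| + 2 * `|T| + rho0)) => y hy.
have T0 := ler_norm T; have x0 := ler_norm x; have T0' := normr_ge0 T; have x0' := normr_ge0 x.
have ry : rho0 < y by lra.
suff key a b : rho0 < a -> rho0 < b -> T <= `|(b - a) / 2| -> `|phi (a + c) (b + c) - phi a b| <= e.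
  split; apply: key => //.
    by apply: le_trans (ler_norm _); lra.
  by rewrite -normrN; apply: le_trans (ler_norm _); lra.
move=> ra rb hT; rewrite -ler_sqr ?nnegrE ?(ltW e0)// real_normK ?num_real//.
rewrite /null_profile.
have -> : (b + c - (a + c)) / 2 = (b - a) / 2 by field.
have -> : (a + c + (b + c)) / 2 = (a + b) / 2 + c by field.
have ab := null_coords ra rb.
set t := (b - a) / 2 in hT ab *; set r := (a + b) / 2 in ab *.
have t0 := normr_ge0 t.
have r1 : 1 <= r by lra.
have rrc : r <= r + c by lra.
have fg := grad_spec (nlw_inH hU t).1.
have N : (wnorm2 `[r, +oo[ (grad (U t).1) <= (e ^+ 2 / D)%:E)%E.
  apply: le_trans (HT t hT); apply: wnorm2_subset => //.
    apply: measurable_funS fg.1; [exact: measurable_Omega|apply: ray_Omega; lra].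
  by move=> z /=; rewrite !in_itv/= !andbT; apply: le_trans; lra.
apply: le_trans (radial_weighted_increment fg r1 rrc N) _.
have -> : r + c - r = c by ring.
have -> : 4 * (e ^+ 2 / D) * (c + c ^+ 2) = e ^+ 2 * (4 * (c + c ^+ 2) / D) by ring.
by rewrite ler_piMr ?sqr_ge0// ler_pdivrMr// /D; lra.
Qed.

(** The source is dominated by a static one whose cone integral is explicit, at most [k xi + k eta],
    whatever [T] is. *)
Lemma cone_int_Gsrc_small (e : R) : 0 < e -> exists X : R, forall T xi eta : R,
  rho0 < xi -> rho0 < eta -> `|eta - xi| <= 2 * T -> X <= xi -> X <= eta ->
  `|cone_int T G xi eta| <= e.
Proof.
move=> e0; have rho1' := rho1; have [K K0 HK] := Gsrc_bound; pose C := K * 4 / (1 * 3).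
have C0 : 0 <= C by rewrite !divr_ge0// ?mulr_ge0.
have e2 : 0 < e / 2 by rewrite divr_gt0.
have [X HX] := near_pinfty_ex (@qpow_decays R C 0 _ e2).
exists X => T xi eta h1 h2 hT X1 X2.
have dk (x : R) : 1 <= x ->
    is_derive x 1 (fun x => C * qpow 1 x) (- (C * 1 / 2) * qpow 3 x).
  by move=> x1; apply: is_derive_qpow_scale; lra.
have dk' (x : R) : 1 <= x -> is_derive x 1 (fun x => - (C * 1 / 2) * qpow 3 x) (K * qpow 5 x).
  move=> x1; have x0 : 0 < x by lra.
  apply: (is_derive_eq (is_derive_qpow_scale (- (C * 1 / 2)) 3 x0)).
  by congr (_ * _); rewrite /C; field.
have jK : jcont (fun _ x : R => K * qpow 5 (Num.max x 1)).
  move=> p; apply: (@continuous_comp _ _ _ (fun p : R * R => p.2) (fun x => K * qpow 5 (Num.max x 1))).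
    exact: cvg_snd.
  exact: qpow_max_continuous.
have cG := Gsrc_jcont (m := m) hU.
have xi1 : 1 <= xi by lra.
have eta1 : 1 <= eta by lra.
have st := cone_int_static (@qpow_max_continuous R K 5) dk dk' xi1 eta1 hT.
have kk (s x : R) : rho0 + `|s| < x -> `|G s x| <= K * qpow 5 (Num.max x 1).
  by move=> sx; rewrite max_l; [exact: HK|have := normr_ge0 s; lra].
have up : cone_int T G xi eta <= cone_int T (fun _ x => K * qpow 5 (Num.max x 1)) xi eta.
  apply: cone_int_mono cG jK h1 h2 _ => s x sx; exact: le_trans (ler_norm _) (kk s x sx).
have dn : cone_int T (fun s x => - G s x) xi eta <= cone_int T (fun _ x => K * qpow 5 (Num.max x 1)) xi eta.
  apply: cone_int_mono (jcontN cG) jK h1 h2 _ => s x sx.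
  by apply: le_trans (ler_norm _) _; rewrite normrN; exact: kk.
rewrite (cone_intN T xi eta cG) in dn; rewrite st in up dn.
have q1 := le_trans (ler_norm _) (HX xi X1); have q2 := le_trans (ler_norm _) (HX eta X2).
have q3 : 0 <= C * qpow 1 ((xi + eta) / 2) by rewrite mulr_ge0 ?qpow_ge0.
rewrite ler_norml; move: q1 q2 q3 up dn.
move: (C * qpow 1 ((xi + eta) / 2)) (C * qpow 1 xi) (C * qpow 1 eta) (cone_int T G xi eta).
by move=> a b c D; lra.
Qed.

(* Near [t = 0]: the increment is controlled by the tails of the data. *)
Lemma phi_diag_decay (c e : R) : 0 <= c -> 0 < e ->
  \forall x \near +oo, `|phi x (x + c) - phi x x| <= e /\ `|phi (x + c) x - phi x x| <= e.
Proof.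
move=> c0 e0; have rho1' := rho1.
have num (a b i D e1 : R) : `|b - a| <= e1 -> `|i| <= e1 -> `|D| <= e1 -> e1 = e / 2 ->
    `|(b + a) / 2 + i / 2 + D / 2 - a| <= e.
  by rewrite !ler_norml; lra.
pose D := 4 * (c + c ^+ 2) + 1.
have D0 : 0 < D by rewrite /D ltr_wpDl// mulr_ge0// addr_ge0 ?sqr_ge0.
have e2 : 0 < e / 2 by rewrite divr_gt0.
have e1 : 0 < (e / 2) ^+ 2 / D by rewrite divr_gt0// exprn_gt0.
have fg := grad_spec hd.1.
have [a1 a11 Ha1] := wnorm2_tail fg.1 (grad_fin fg) e1.
have [a2 a21 Ha2] := wnorm2_tail hd.2.1 (inL2_fin hd.2) e1.
have [X HX] := cone_int_Gsrc_small e2.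
apply: (@ex_near_pinfty _ _ (`|a1| + `|a2| + `|X| + rho0 + 1)) => x hx.
have := normr_ge0 a1; have := normr_ge0 a2; have := normr_ge0 X.
have := ler_norm a1; have := ler_norm a2; have := ler_norm X => b1 b2 b3 b4 b5 b6.
have xa1 : a1 <= x by lra.
have xa2 : a2 <= x by lra.
have xX : X <= x by lra.
have rx : rho0 < x by lra.
have xc : x <= x + c by lra.
have x1 : 1 <= x by lra.
have mO := @measurable_Omega R.
have sub (h : R -> R) (a : R) : 1 <= a -> a <= x -> measurable_fun (@Omega R) h ->
    (wnorm2 `[x, +oo[ h <= wnorm2 `[a, +oo[ h)%E.
  move=> a_1 ax mh; apply: wnorm2_subset => //.
    exact: measurable_funS (ray_Omega a_1) mh.
  by move=> z /=; rewrite !in_itv/= !andbT; exact: le_trans.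
have rt (E M : R) : 0 <= M -> M <= D -> E ^+ 2 <= (e / 2) ^+ 2 / D * M -> `|E| <= e / 2.
  move=> M0 MD h; rewrite -ler_sqr ?nnegrE ?(ltW e2)// real_normK ?num_real//.
  apply: le_trans h _; rewrite -mulrA ler_piMr ?sqr_ge0// mulrC ler_pdivrMr// mul1r//.
have h1 : `|(x + c) * d.1 (x + c) - x * d.1 x| <= e / 2.
  apply: (rt _ (4 * (c + c ^+ 2))); [by rewrite mulr_ge0// addr_ge0 ?sqr_ge0|by rewrite /D; lra|].
  apply: le_trans (radial_weighted_increment fg x1 xc (le_trans (sub _ _ a11 xa1 fg.1) Ha1)) _.
  by have -> : x + c - x = c; [ring|rewrite le_eqVlt; apply/orP; left; apply/eqP; ring].
pose I y := oint rho0 y (fun s => s * d.2 s).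
have IE : I (x + c) - I x = \int[mu]_(s in `[x, (x + c)]) (s * d.2 s).
  rewrite -oint_ge// (@oint_sub R d.2 rho0)//; [lra|lra|lra|exact: hd.2.1|exact: inL2_fin hd.2].
have h2 : `|I (x + c) - I x| <= e / 2.
  rewrite IE; apply: (rt _ c) => //; first by rewrite /D; have := sqr_ge0 c; lra.
  have sx : `[x, (x + c)%R] `<=` `[x, +oo[%classic.
    by move=> z /=; rewrite !in_itv/= andbT => /andP[].
  have x0 : 0 <= x by lra.
  have mx : measurable_fun `[x, +oo[ d.2 by exact: measurable_funS (ray_Omega x1) hd.2.1.
  have [||_] := @wint_bound R x (x + c) d.2 ((e / 2) ^+ 2 / D) x0 xc.
  - exact: measurable_funS sx mx.
  - apply: le_trans (le_trans (sub _ _ a21 xa2 hd.2.1) Ha2).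
    exact: wnorm2_subset.
  - by have -> : x + c - x = c by ring.
have cc : `|c| <= 2 * c by rewrite ger0_norm//; lra.
have rxc : rho0 < x + c by lra.
have Xxc : X <= x + c by lra.
(* At [t = 0] the cone degenerates and the velocity integrals cancel. *)
have E0 : phi x x = x * d.1 x.
  have s0 : `|x - x| <= 2 * c by rewrite subrr normr0; lra.
  rewrite (phi_representation rx rx s0) (cone_int_pos (Gsrc_jcont hU))//; [|lra].
  have -> : (x - x) / 2 = 0 by ring.
  rewrite Rint_point; move: (oint _ _ _) (x * d.1 x) => i a; lra.
have sA : `|x + c - x| <= 2 * c by have -> : x + c - x = c by ring.
have sB : `|x - (x + c)| <= 2 * c by rewrite distrC.
rewrite E0 (phi_representation rx rxc sA) (phi_representation rxc rx sB) -/(I x) -/(I (x + c)).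
split; first by apply: (num _ _ _ _ (e / 2)) => //; exact: HX.
rewrite [x * d.1 x + _ in X in `|X|]addrC; apply: (num _ _ _ _ (e / 2)) => //; last exact: HX.
by rewrite distrC.
Qed.

End NullCoordinates.

(** * Rigidity *)

(** Exchanging [xi] and [eta] is time reversal; it transfers the estimates as [t --> +oo] to
    [t --> -oo]. *)
Lemma rect_bounded_transpose (R : realType) (rho : R) (phi : R -> R -> R) (k : R -> R) :
  rect_bounded rho phi k -> rect_bounded rho (fun x y => phi y x) k.
Proof.
move=> H x1 x2 y1 y2 a b c e; have := H y1 y2 x1 x2 c e a b.
rewrite /rect /mid ![x1 + _]addrC ![x2 + _]addrC.
by rewrite -!addrA [- _ + - phi y1 x2]addrC [- _ + - k ((y1 + x2) / 2)]addrC.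
Qed.

(** In half powers: the difference of the sources decays with index [n + 1] from [phi - f] and
    [2 (2m)] from [x^(-2m)]; a bound of index [n + 2] on [phi - f] requires [n + 2 + 4]. *)
Lemma exponent_gain (m n : nat) : (2 < m)%N -> (n.+2 + 4 <= n.+1 + 2 * (2 * m))%N.
Proof. by lia. Qed.

Section Rigidity.
Context {R : realType} (m : nat) (hm : (2 < m)%N) (rho0 : R) (rho1 : 1 < rho0) (d : data R)
  (hd : inH d) (U : R -> data R) (hU : nlw_solution m rho0 d U).
Context (Ep Em : \bar R)
    (hEp : exterior_energy rho0 U t @[t --> +oo] --> Ep)
    (hEm : exterior_energy rho0 U t @[t --> -oo] --> Em)
    (hE : (Ep + Em = 0)%E).
Local Notation mu := (@lebesgue_measure R).
Local Notation G := (Gsrc m U).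
Local Notation phi := (null_profile U).

(** Edges in [xi] are pushed to [eta = +oo], where [t --> +oo]; edges in [eta] are pushed to
    [xi = +oo], where [t --> -oo]. Both halves of the energy assumption are thus used. *)
Lemma phi_limit : exists l K : R, 0 <= K /\
  forall x y : R, rho0 < x -> rho0 < y -> `|phi x y - l| <= K * mid (qpow 1) x y.
Proof.
have [K K0 H] := phi_rect_bounded hm rho1 hd hU hEp hEm hE.
have rho1' := rho1.
have dk := @qpow_decays R K 0.
have k0 (x : R) : rho0 < x -> 0 <= K * qpow 1 x by move=> _; rewrite mulr_ge0 ?qpow_ge0.
have km (x y : R) : rho0 < x -> x <= y -> K * qpow 1 y <= K * qpow 1 x.
  by move=> x0 xy; rewrite ler_wpM2l// qpow_noninc//; lra.
have D1 (c e : R) : 0 <= c -> 0 < e -> \forall x \near +oo, `|phi x (x + c) - phi x x| <= e.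
  by move=> c0 e0; apply: filterS (phi_diag_decay hm rho1 hd hU hEp hEm hE c0 e0) => x [].
have D2 (c e : R) : 0 <= c -> 0 < e -> \forall x \near +oo, `|phi (x + c) x - phi x x| <= e.
  by move=> c0 e0; apply: filterS (phi_diag_decay hm rho1 hd hU hEp hEm hE c0 e0) => x [].
have S1 (x c e : R) : rho0 < x -> 0 <= c -> 0 < e ->
    \forall y \near +oo, `|phi (x + c) (y + c) - phi x y| <= e.
  by move=> h c0 e0; apply: filterS (phi_shift_decay rho1 hU hEp hEm hE h c0 e0) => y [].
have S2 (x c e : R) : rho0 < x -> 0 <= c -> 0 < e ->
    \forall y \near +oo, `|phi (y + c) (x + c) - phi y x| <= e.
  by move=> h c0 e0; apply: filterS (phi_shift_decay rho1 hU hEp hEm hE h c0 e0) => y [].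
have HT := rect_bounded_transpose H.
have r0 : 0 < rho0 by lra.
have [||l Hl] := @null_limit R rho0 phi _ r0 dk k0 km.
- move=> x1 x2 y r1 x12 ry; apply: (edge_bound r1 x12 ry dk k0 H) => e e0.
  exact: (edge_limit r1 x12 dk H D1 S1 e0).
- move=> x y1 y2 rx ry y12; rewrite /mid (addrC x).
  apply: (@edge_bound R rho0 (fun x y => phi y x) _ _ _ _ ry y12 rx dk k0 HT) => e e0.
  exact: (@edge_limit R rho0 (fun x y => phi y x) _ _ _ _ ry y12 dk HT D2 S2 e0).
exists l, (2 * K); split; first by rewrite mulr_ge0.
by move=> x y rx ry; rewrite -mulrA; exact: Hl.
Qed.

(** [phi] and the static profile with the same limit [l] at infinity have sources whose difference
    is controlled by [phi - f] itself. [corner_bound] turns this control back into a bound on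
    [phi - f], the previous bound supplying the decay at infinity it needs. *)
Lemma phi_static : exists l : R, exists f f' : R -> R,
  [/\ forall x : R, 0 < x -> is_derive x 1 f (f' x),
      forall x : R, 0 < x -> is_derive x 1 f' (- (f x ^+ (2 * m + 1) / x ^+ (2 * m))),
      forall x : R, 0 < x -> `|f x| <= `|l|,
      exists C : R, forall x : R, 1 <= x -> `|f x - l| <= C / x ^+ 2 /\ `|f' x| <= C / x ^+ 2
    & forall x y : R, rho0 < x -> rho0 < y -> phi x y = mid f x y].
Proof.
have rho1' := rho1.
have [l [K [K0 Hl]]] := phi_limit.
have [f [f' [df df' fl [C HC]]]] := profile_exists l hm.
exists l, f, f'; split => //; first by exists C.
have C0 : 0 <= C.
  by have [+ _] := HC 1 (lexx _); rewrite expr1n divr1; exact: le_trans.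
pose f'' (x : R) := - (f x ^+ (2 * m + 1) / x ^+ (2 * m)).
have m1 (x : R) : 0 < Num.max x 1 by rewrite lt_max ltr01 orbT.
have cmax : continuous (fun x : R => Num.max x 1).
  by move=> x; apply: continuous_max; [exact: cvg_id|exact: cvg_cst].
have cf'' : continuous (fun x : R => f'' (Num.max x 1)).
  move=> x; apply: cvgN; apply: cvgM.
    apply: (@continuous_pow _ (fun x : R => f (Num.max x 1))) => y.
    apply: (@continuous_comp _ _ _ (fun x : R => Num.max x 1) f); first exact: cmax.
    exact: is_derive_continuous (df _ (m1 y)).
  apply: cvgV; first by rewrite expf_neq0// gt_eqF.
  exact: (continuous_pow cmax).
have df1 (x : R) : 1 <= x -> is_derive x 1 f (f' x) by move=> x1; apply: df; lra.
have df1' (x : R) : 1 <= x -> is_derive x 1 f' (f'' x) by move=> x1; apply: df'; lra.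
(* [M] dominates both [phi] and [f] on the whole quadrant, the latter by [|f| <= |l|]; hence [L] is
   a single Lipschitz constant for the power. *)
pose M := `|l| + K.
pose L := (2 * m + 1)%:R * M ^+ (2 * m).
have M0 : 0 <= M by rewrite addr_ge0.
have L0 : 0 <= L by rewrite mulr_ge0 ?exprn_ge0.
have mid1 (x y : R) : rho0 < x -> rho0 < y -> 1 <= (x + y) / 2 by lra.
have phiM (x y : R) : rho0 < x -> rho0 < y -> `|phi x y| <= M.
  move=> rx ry; have := Hl x y rx ry; have q1 := qpow_le1 1 (mid1 x y rx ry).
  have : K * mid (qpow 1) x y <= K by rewrite ler_piMr.
  by have := ler_normD (phi x y - l) l; rewrite subrK /M; lra.
pose bd n (A : R) := forall x y : R, rho0 < x -> rho0 < y ->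
  `|phi x y - mid f x y| <= mid (fun x => A * qpow n.+1 x) x y.
have bd0 : bd 0%N (K + C).
  move=> x y rx ry; have z1 := mid1 x y rx ry; rewrite /mid.
  have [h _] := HC _ z1.
  have h3 : C / ((x + y) / 2) ^+ 2 <= C * qpow 1 ((x + y) / 2).
    rewrite ler_wpM2l// -qpow_even; last lra.
    exact: qpow_le.
  apply: le_trans (ler_distD l _ _) _; rewrite (distrC l) (mulrDl K C).
  exact: lerD (Hl x y rx ry) (le_trans h h3).
have src n A : 0 <= A -> bd n A -> forall s x : R, rho0 + `|s| < x ->
    `|G s x + f'' x| <= (L * A) * qpow (n.+2 + 4) x.
  move=> A0 B s x sx; have s0 := normr_ge0 s.
  have x1 : 1 <= x by lra.
  have x0 : 0 < x by lra.
  have [s1 s2] : - `|s| <= s /\ s <= `|s| by split; [rewrite lerNl -normrN ler_norm|rewrite ler_norm].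
  have rx : rho0 < x - s by lra.
  have ry : rho0 < x + s by lra.
  have xE : (x - s + (x + s)) / 2 = x by field.
  have := B _ _ rx ry; rewrite /mid xE => h.
  have fM : `|f x| <= M by apply: le_trans (fl x x0) _; rewrite /M lerDl.
  have := powdiff_bound (2 * m) (phiM _ _ rx ry) fM; rewrite -[(2 * m).+1]addn1 -/L => h2.
  rewrite (Gsrc_phi _ rho1 _ sx)// /f'' -mulrBl normrM [`|(_ ^+ _)^-1|]ger0_norm ?invr_ge0 ?exprn_ge0 ?(ltW x0)//.
  rewrite -qpow_even ?(ltW x0)//.
  apply: (@le_trans _ _ (L * (A * qpow n.+1 x) * qpow (2 * (2 * m)) x)).
    by rewrite ler_wpM2r ?qpow_ge0//; apply: le_trans h2 _; rewrite ler_wpM2l.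
  have -> : forall q r : R, L * (A * q) * r = L * A * (q * r) by move=> q r; rewrite !mulrA.
  apply: ler_wpM2l; first exact: mulr_ge0.
  rewrite -qpow_add; apply: qpow_le => //.
  exact: exponent_gain.
(* The order of decay of [phi - f] improves by [1/2] at each step; at a large fixed
   order the constant is halved instead. *)
have step n A : 0 <= A -> bd n A -> bd n.+1 (L * A * 4 / (n.+2%:R * n.+4%:R)).
  move=> A0 B x y rx ry.
  apply: (corner_bound rx ry (compare_qpow hm rho1 hd hU cf'' df1 df1' (src n A A0 B)) _ _ B).
  - exact: qpow_decays.
  - exact: qpow_decays.
have contr n A : 0 <= A -> bd n A -> bd n (L * A * 4 / (n.+1%:R * n.+3%:R)).
  move=> A0 B x y rx ry.
  (* The surplus half power is given up here, in exchange for keeping the order [n] fixed. *)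
  have src' (s z : R) : rho0 + `|s| < z -> `|G s z + f'' z| <= (L * A) * qpow (n.+1 + 4) z.
    move=> sz; apply: le_trans (src n A A0 B s z sz) _.
    apply: ler_wpM2l; first exact: mulr_ge0.
    by apply: qpow_le => //; have := normr_ge0 s; lra.
  apply: (corner_bound rx ry (compare_qpow hm rho1 hd hU cf'' df1 df1' src') _ _ B).
  - exact: qpow_decays.
  - exact: qpow_decays.
have all_bd n : exists2 A : R, 0 <= A & bd n A.
  elim: n => [|n [A A0 B]]; first by exists (K + C) => //; exact: addr_ge0.
  exists (L * A * 4 / (n.+2%:R * n.+4%:R)); last exact: step.
  have LA : 0 <= L * A by exact: mulr_ge0.
  by apply: divr_ge0; [exact: mulr_ge0|apply: mulr_ge0; exact: ler0n].
(* Then [n + 1 > 8 L], so [4 L / ((n + 1) (n + 3)) <= 1/2] and each further comparison halves the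
   constant. *)
pose n := Num.truncn (8 * L).
have [A A0 BA] := all_bd n.
have half j : bd n (A / 2 ^+ j).
  elim: j => [|j IH]; first by rewrite expr0 divr1.
  have A2 : 0 <= A / 2 ^+ j by rewrite divr_ge0 ?exprn_ge0.
  move=> x y rx ry; apply: le_trans (contr n _ A2 IH x y rx ry) _.
  rewrite /mid; apply: ler_wpM2r; first exact: qpow_ge0.
  have -> : A / 2 ^+ j.+1 = A / 2 ^+ j / 2 by rewrite exprSr invfM mulrA.
  have h8 : 8 * L < n.+1%:R by exact: truncnS_gt.
  have n3 : 1 <= n.+3%:R :> R by rewrite ler1n.
  have n1 : 0 < n.+1%:R :> R by rewrite ltr0n.
  move: (A / 2 ^+ j) A2 => a a0.
  rewrite ler_pdivrMr; last by apply: mulr_gt0 => //; rewrite ltr0n.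
  have : 8 * L * a <= n.+1%:R * a by rewrite ler_wpM2r// ltW.
  have : n.+1%:R * a <= n.+1%:R * a * n.+3%:R by rewrite ler_peMr// mulr_ge0// ltW.
  have -> : a / 2 * (n.+1%:R * n.+3%:R) = n.+1%:R * a * n.+3%:R / 2 by ring.
  have -> : L * a * 4 = 8 * L * a / 2 by field.
  lra.
move=> x y rx ry; apply/eqP; rewrite -subr_eq0 -normr_le0; apply: le_of_near => e e0.
rewrite add0r; have [j Hj] := halves_small A0 e0.
apply: le_trans (half j x y rx ry) (le_trans _ Hj); rewrite /mid.
by rewrite ler_piMr ?divr_ge0 ?exprn_ge0// qpow_le1// mid1.
Qed.

End Rigidity.

(** * From the profile [f] to the stationary solution [f / r] *)

Section Stationary.
Context {R : realType} (m : nat) (l : R) (f f' : R -> R)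
  (df : forall x : R, 0 < x -> is_derive x 1 f (f' x))
  (df' : forall x : R, 0 < x -> is_derive x 1 f' (- (f x ^+ (2 * m + 1) / x ^+ (2 * m)))).

Let Z (x : R) := f x / x.
Let Z' (x : R) := f' x / x - f x / x ^+ 2.
Let f'' (x : R) := - (f x ^+ (2 * m + 1) / x ^+ (2 * m)).
Let Z'' (x : R) := f'' x / x - 2 * f' x / x ^+ 2 + 2 * f x / x ^+ 3.

Lemma is_derive_div_pow (h : R -> R) (x dh : R) (n : nat) : 0 < x -> is_derive x 1 h dh ->
  is_derive x 1 (fun y => h y / y ^+ n.+1) (dh / x ^+ n.+1 - n.+1%:R * h x / x ^+ n.+2).
Proof.
move=> x0 dhx; have xn0 : x != 0 by rewrite gt_eqF.
have D1 := is_deriveV xn0 (is_derive_id x (1 : R)).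
have D := is_deriveM dhx (is_derive_pow n D1).
have -> : (fun y => h y / y ^+ n.+1) = (h * (fun z : R => (id z)^-1 ^+ n.+1))%R.
  by apply/funext => y; rewrite /GRing.mul/= exprVn.
apply: (is_derive_eq D); rewrite /GRing.scale/= !exprS !invfM -exprVn expr0.
by rewrite -!exprVn; move: (x^-1 ^+ n) (x^-1) => v w; ring.
Qed.

Let is_derive_Z (x : R) : 0 < x -> is_derive x 1 Z (Z' x).
Proof.
move=> x0; have := is_derive_div_pow 0 x0 (df x0).
by rewrite expr1 mul1r; under eq_fun do rewrite expr1.
Qed.

Let is_derive_Z' (x : R) : 0 < x -> is_derive x 1 Z' (Z'' x).
Proof.
move=> x0; have A := is_derive_div_pow 0 x0 (df' x0).
have B := is_derive_div_pow 1 x0 (df x0).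
have -> : Z' = (fun y => f' y / y ^+ 1) - (fun y => f y / y ^+ 2).
  by apply/funext => y.
apply: (is_derive_eq (is_deriveB A B)); rewrite /Z'' /f'' expr1 mul1r.
have num (a b c : R) : a - b - (b - 2 * c) = a - 2 * b + 2 * c by ring.
by rewrite -!(mulrA 2); exact: num.
Qed.

Let derive_Z (x : R) : 0 < x -> derive1 Z x = Z' x.
Proof. by move=> x0; rewrite derive1E; have := is_derive_Z x0 => D; rewrite derive_val. Qed.

Let near_pos (x : R) : 0 < x -> \forall y \near x, 0 < y.
Proof. by move=> x0; exact: lt_nbhsr. Qed.

Let is_derive_Z1 (x : R) : 0 < x -> is_derive x 1 (derive1 Z) (Z'' x).
Proof.
move=> x0; apply: (near_eq_is_derive _ (is_derive_Z' x0)).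
by apply: filterS (near_pos x0) => y y0; rewrite derive_Z.
Qed.

Let derive_Z1 (x : R) : 0 < x -> derive1n 2 Z x = Z'' x.
Proof.
move=> x0; rewrite /derive1n/=.
by rewrite derive1E; have := is_derive_Z1 x0 => D; rewrite derive_val.
Qed.

(** With [f = r Z], the radial Laplacian of [Z] is [f'' / r], which gives the equation; and
    [r^2 Z' = r f' - f] tends to [- l] because [f' = O(r^(-2))]. *)
Lemma stationary_profile :
  (exists C : R, forall x : R, 1 <= x -> `|f x - l| <= C / x ^+ 2 /\ `|f' x| <= C / x ^+ 2) ->
  is_Z m l (fun x => f x / x).
Proof.
move=> [C HC]; change (is_Z m l Z); split; last split.
- move=> r r0; split.
  + by have [] := is_derive_Z r0.
  + by have [] := is_derive_Z1 r0.
  + have cid := @cvg_id _ (nbhs r).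
    have cf : f x @[x --> r] --> f r by exact: is_derive_continuous (df r0).
    have cf' : f' x @[x --> r] --> f' r by exact: is_derive_continuous (df' r0).
    have cp n : (x ^+ n)^-1 @[x --> r] --> (r ^+ n)^-1.
      apply: cvgV; first by rewrite expf_neq0// gt_eqF.
      exact: exprn_continuous.
    have cfp n : f x ^+ n @[x --> r] --> f r ^+ n.
      elim: n => [|n IH]; first by under eq_fun do rewrite expr0; exact: cvg_cst.
      by under eq_fun do rewrite exprS; rewrite exprS; exact: cvgM.
    have cZ : Z'' x @[x --> r] --> Z'' r.
      apply: cvgD; last by apply: cvgM; [apply: cvgM; [exact: cvg_cst|]|exact: cp].
      apply: cvgB; last by apply: cvgM; [apply: cvgM; [exact: cvg_cst|]|exact: cp].
      apply: cvgM; last by have := cp 1%N; under eq_fun do rewrite expr1; rewrite expr1.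
      by apply: cvgN; apply: cvgM.
    rewrite /prop_for /continuous_at derive_Z1//; apply: cvg_trans cZ; apply: near_eq_cvg.
    by apply: filterS (near_pos r0) => y y0; rewrite derive_Z1.
  + rewrite derive_Z1// derive_Z// /Z'' /Z' /Z /f'' expr_div_n.
    have rn0 : r != 0 by rewrite gt_eqF.
    rewrite [r ^+ (2 * m + 1)]exprD expr1; have := expf_neq0 (2 * m) rn0.
    by move: (r ^+ (2 * m)) (f r ^+ _) => w v w0; field; rewrite rn0 w0.
- exists C => r r1; have r0 : r != 0 by rewrite gt_eqF//; lra.
  by rewrite /Z mulrCA divff// mulr1; have [] := HC r r1.
- apply/cvgrPdist_le => e e0; apply: (@ex_near_pinfty _ _ (Num.max 1 (2 * C / e))) => r.
  rewrite ge_max => /andP[r1 re]; have r0 : 0 < r by lra.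
  have rn0 : r != 0 by rewrite gt_eqF.
  rewrite derive_Z// /Z'; have [h1 h2] := HC r r1.
  have -> : - l - r ^+ 2 * (f' r / r - f r / r ^+ 2) = (f r - l) - r * f' r by field.
  apply: le_trans (ler_normB _ _) _; rewrite normrM (gtr0_norm r0).
  have C0 : 0 <= C.
    by have [+ _] := HC 1 (lexx _); rewrite expr1n divr1; exact: le_trans.
  have k1 : r * `|f' r| <= C / r.
    apply: le_trans (ler_wpM2l (ltW r0) h2) _.
    by have -> : r * (C / r ^+ 2) = C / r by field.
  have k2 : C / r ^+ 2 <= C / r.
    by rewrite ler_wpM2l// lef_pV2 ?posrE ?exprn_gt0// expr2 ler_peMr// ltW.
  have k3 : 2 * C / r <= e by rewrite ler_pdivrMr// [X in _ <= X]mulrC -ler_pdivrMr.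
  move: k3; rewrite -mulrA; move: h1 k1 k2; move: (C / r) (C / r ^+ 2) => a b; lra.
Qed.

End Stationary.

(** * Recovering the initial data *)

Section Vanishing.
Context {R : realType}.
Local Notation mu := (@lebesgue_measure R).

Lemma wnorm2_le0_ae (a : R) (h : R -> R) : 1 <= a -> measurable_fun `[a, +oo[ h ->
  (wnorm2 `[a, +oo[ h <= 0)%E -> {ae mu, forall r : R, a <= r -> h r = 0}.
Proof.
move=> a1 mh w0; have ma := @measurable_ray R a.
have mw := measurable_wsq mh.
have [+ _] := @ae_eq_integral_abs _ _ R (@lebesgue_measure R : {measure set _ -> \bar R}) _ ma _ mw.
have -> : (\int[mu]_(x in `[a, +oo[) `|(h x ^+ 2 * x ^+ 2)%:E| = wnorm2 `[a, +oo[ h)%E.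
  by apply: eq_integral => x _; rewrite gee0_abs// lee_fin mulr_ge0 ?sqr_ge0.
have -> : wnorm2 `[a, +oo[ h = 0%E by apply/eqP; rewrite eq_le w0 wnorm2_ge0.
move=> /(_ erefl); apply: filterS => r H ar.
have := H; rewrite /= in_itv/= andbT => /(_ ar) [] /eqP.
rewrite mulf_eq0 !expf_eq0/= => /orP[/eqP//|/eqP r0]; move: ar a1; rewrite r0; lra.
Qed.

(** The open ray is exhausted by countably many closed ones, so the exceptional null sets add up to
    a null set. *)
Lemma ae_ray (rho : R) (P : R -> Prop) :
  (forall a : R, rho < a -> {ae mu, forall r : R, a <= r -> P r}) ->
  {ae mu, forall r : R, rho < r -> P r}.
Proof.
move=> H; have A (n : nat) : {ae mu, forall r : R, rho + n.+1%:R^-1 <= r -> P r}.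
  by apply: H; rewrite ltrDl invr_gt0 ltr0n.
apply: filterS (ae_foralln A) => r HP rr.
have rr0 : 0 < r - rho by rewrite subr_gt0.
apply: (HP (Num.truncn (r - rho)^-1)); rewrite addrC -lerBrDr.
by rewrite -[leRHS]invrK lef_pV2 ?posrE ?invr_gt0 ?ltr0n// ltW// truncnS_gt.
Qed.

Context (m : nat) (rho0 : R) (rho1 : 1 < rho0) (d : data R)
  (hd : inH d) (U : R -> data R) (hU : nlw_solution m rho0 d U).

(** Equality holds at every [r >= 1], as a zero norm forces the continuous representatives to
    coincide. *)
Lemma nlw_initial_value (r : R) : 1 <= r -> d.1 r = (U 0).1 r.
Proof.
move=> r1; have H0 : (Hnorm2 (U 0 - d)%R <= (0 : R)%:E)%E by rewrite (nlw_initial hU).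
have := Hnorm2_value (inH_sub (nlw_inH hU 0) hd) H0 r1 => /=.
rewrite pmulr_lle0; last lra.
by rewrite le_eqVlt ltNge sqr_ge0 orbF sqrf_eq0 subr_eq0 => /eqP.
Qed.

Lemma nlw_measurable (t : R) : measurable_fun (@Omega R) (U t).1.
Proof.
have E : {in @Omega R, (fun x : R => (U t).1 (Num.max x 1)) =1 (U t).1}.
  by move=> x; rewrite inE /Omega/= in_itv/= andbT => x1; rewrite max_l.
apply: (eq_measurable_fun _ E).
exact: continuous_measurable_on (@measurable_Omega R) (nlw_slice_continuous hU (t := t)).
Qed.

(** The velocity is only an L^2 limit of difference quotients. On [[a, +oo[] with [a > rho0], the
    times [|h| < a - rho0] stay in the exterior region, where the quotient is exactly [0]; the
    velocity is then bounded by an arbitrarily small error. *)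
Lemma static_velocity_zero :
  (forall h r : R, rho0 + `|h| < r -> (U h).1 r = (U 0).1 r) ->
  {ae mu, forall r : R, rho0 < r -> d.2 r = 0}.
Proof.
move=> st; have rho1' := rho1; apply: ae_ray => a ra; have a1 : 1 <= a by lra.
have mO := @measurable_Omega R; have sub := ray_Omega a1.
have mV := (nlw_inH hU 0).2.1.
have V0 : (wnorm2 `[a, +oo[ (U 0).2 <= 0)%E.
  apply/lee_addgt0Pr => e e0; rewrite add0e.
  have e8 : 0 < e * 8 by rewrite mulr_gt0.
  have N1 : \forall h \near (0 : R)^',
      (L2norm2 (fun r => ((U (0 + h)).1 r - (U 0).1 r) / h - (U 0).2 r)%R <= (e * 8)%:E)%E.
    exact: cvge0_le (nlw_vel hU 0) e8.
  have N2 : \forall h \near (0 : R)^', `|h| < a - rho0.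
    have a0 : 0 < a - rho0 by rewrite subr_gt0.
    apply: cvg_within; apply: filterS (nbhs0_lt a0) => // .
  have [h [Hh ha]] := filter_ex (filterI N1 N2).
  pose F (r : R) := ((U (0 + h)).1 r - (U 0).1 r) / h - (U 0).2 r.
  have mF : measurable_fun (@Omega R) F.
    apply: measurable_funB => //; apply: measurable_funM => //.
    by apply: measurable_funB; exact: nlw_measurable.
  (* A zero second component makes [int3_sum_le] applicable to a single function. *)
  have [wF _] : (wnorm2 (@Omega R) F <= (e * 8 / 8)%:E)%E /\ (wnorm2 (@Omega R) (cst 0%R) <= (e * 8 / 8)%:E)%E.
    apply: int3_sum_le => //; apply: le_trans Hh.
    rewrite /L2norm2 le_eqVlt; apply/orP; left; apply/eqP; congr (int3 _ _).
    by apply/funext => r; rewrite expr0n/= addr0.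
  rewrite mulfK// in wF; apply: le_trans wF.
  have -> : wnorm2 `[a, +oo[ (U 0).2 = wnorm2 `[a, +oo[ F.
    apply: eq_integral => r; rewrite inE/= in_itv/= andbT => ar.
    by rewrite /F add0r st ?subrr ?mul0r ?sub0r ?sqrrN//; lra.
  exact: wnorm2_subset.
have D0 : (wnorm2 (@Omega R) (U 0 - d)%R.2 <= 0)%E.
  have H0 : (Hnorm2 (U 0 - d)%R <= (0 : R)%:E)%E by rewrite (nlw_initial hU).
  by have [_] := Hnorm2_bounds (inH_sub (nlw_inH hU 0) hd) H0; rewrite mul0r.
have mD := (inH_sub (nlw_inH hU 0) hd).2.1.
apply: wnorm2_le0_ae => //; first exact: measurable_funS hd.2.1.
have -> : d.2 = (fun r => (U 0).2 r + (- (U 0 - d).2) r).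
  apply/funext => r; transitivity ((U 0).2 r - ((U 0).2 r - d.2 r)); first by ring.
  by [].
have ma := @measurable_ray R a.
apply: le_trans (wnorm2_add ma _ _) _.
- exact: measurable_funS mV.
- by apply: measurableT_comp => //; exact: measurable_funS mD.
have wV : wnorm2 `[a, +oo[ (U 0).2 = 0%E by apply/eqP; rewrite eq_le V0 wnorm2_ge0.
have wD : wnorm2 `[a, +oo[ (U 0 - d)%R.2 = 0%E.
  by apply/eqP; rewrite eq_le wnorm2_ge0 andbT; apply: le_trans D0; exact: wnorm2_subset.
by rewrite wnorm2N wV wD !mule0 adde0.
Qed.

End Vanishing.

(** * The dichotomy *)

Theorem proposition3p1 (R : realType) (m : nat) (hm : (2 < m)%N)
    (rho0 : R) (hrho0 : 1 < rho0)
    (u0 u1 : R -> R) (hdata : inH (u0, u1))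
    (U : R -> data R) (hU : nlw_solution m rho0 (u0, u1) U)
    (Ep Em : \bar R)
    (hEp : exterior_energy rho0 U t @[t --> +oo] --> Ep)
    (hEm : exterior_energy rho0 U t @[t --> -oo] --> Em)
    (hE : (Ep + Em = 0)%E) :
  {ae lebesgue_measure, forall r : R, rho0 < r -> u0 r = 0 /\ u1 r = 0} \/
  exists (l : R) (iota : R) (Z : R -> R),
    l <> 0 /\ (iota = 1 \/ iota = -1) /\ is_Z m l Z /\
    (forall r : R, rho0 < r -> u0 r = iota * Z r) /\
    {ae lebesgue_measure, forall r : R, rho0 < r -> u1 r = 0}.
Proof.
have [l [f [f' [df df' fl HC E]]]] := phi_static hm hrho0 hdata hU hEp hEm hE.
have V (h r : R) : rho0 + `|h| < r -> (U h).1 r = f r / r.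
  move=> hr; have r0 : r != 0 by rewrite gt_eqF//; have := normr_ge0 h; lra.
  have [h1 h2] : - `|h| <= h /\ h <= `|h| by split; [rewrite lerNl -normrN ler_norm|rewrite ler_norm].
  have hx : rho0 < r - h by lra.
  have hy : rho0 < r + h by lra.
  have := E _ _ hx hy; rewrite /null_profile /mid.
  have -> : (r - h + (r + h)) / 2 = r by field.
  have -> : (r + h - (r - h)) / 2 = h by field.
  by move=> <-; field.
have u1_0 : {ae lebesgue_measure, forall r : R, rho0 < r -> u1 r = 0}.
  apply: (static_velocity_zero hrho0 hdata hU) => h r hr.
  by rewrite !V// normr0 addr0; have := normr_ge0 h; lra.
have u0E (r : R) : rho0 < r -> u0 r = f r / r.
  move=> rr; rewrite -(V 0 r) ?normr0 ?addr0//.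
  by apply: (nlw_initial_value hdata hU); lra.
(* The bound [|f| <= |l|] decides the alternative: [l = 0] forces [f = 0]. *)
have [l0|/eqP l0] := eqVneq l 0; [left|right].
  apply: (@filterS _ (almost_everywhere (@lebesgue_measure R)) _ _ _ _ u1_0) => r H rr.
  split; last exact: H.
  have r0 : 0 < r by lra.
  have := fl r r0; rewrite l0 normr0 normr_le0 => /eqP f0.
  by rewrite u0E// f0 mul0r.
(* The sign of the solution is carried by [l], hence [iota = 1]. *)
exists l, 1, (fun r => f r / r); split => //; split; first by left.
split; first exact: (stationary_profile df df' HC).
by split => // r rr; rewrite mul1r u0E.
Qed.
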